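(* Let $(M_N)_{N\ge1}$ be probability measures, $M_N$ on $\mathbb Y(N)$, whose Jack generating functions $F_N$ satisfy Assumption A and Assumption C (with constants $\mathfrak c_k,\mathfrak d_{k,l}$). Then the random measures $\mu[\lambda]$ ($\lambda\sim M_N$) satisfy the central limit theorem, and for all $k,l\ge1$ $$\lim_{N\to\infty}\mathrm{cov}(\xi^{(k)}[\lambda],\xi^{(l)}[\lambda])=[z^{-1}w^{-1}]\left(\sum_{a\ge1}\frac a\theta z^{a-1}w^{-a-1}+\frac{V_\mu(z+1,w+1)}{\theta^2}\right)\left(\frac1z+\frac{1+z}{\theta}U_\mu(1+z)\right)^k\left(\frac1w+\frac{1+w}{\theta}U_\mu(1+w)\right)^l,$$ where $U_\mu(z)=\sum_{k\ge1}\frac{\mathfrak c_k}{(k-1)!}(z-1)^{k-1}$ and $V_\mu(z,w)=\sum_{k,l\ge1}\frac{\mathfrak d_{k,l}}{(k-1)!(l-1)!}(z-1)^{k-1}(w-1)^{l-1}$ are formal power series, and $[z^{-1}w^{-1}]$ extracts the coefficient of $z^{-1}w^{-1}$.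
   Context: Fix $\theta>0$. Young diagrams $\lambda=(\lambda_1\ge\lambda_2\ge\dots\ge0)$, $\ell(\lambda)$ = number of nonzero parts, $|\lambda|=\sum\lambda_i$, $\mathbb Y(N)$ = diagrams with $\ell(\lambda)\le N$, $\mathbb Y=\bigcup_N\mathbb Y(N)$. Symmetric functions are identified with $\mathbb R[p_1,p_2,\dots]$, $p_n=\sum_ix_i^n$, $p_\lambda=\prod p_{\lambda_i}$. $J_\lambda(\mathbf p;\theta)$ is the Jack symmetric function (orthogonal for $\langle p_\lambda,p_\mu\rangle=\delta_{\lambda\mu}z_\lambda\theta^{-\ell(\lambda)}$, triangular in the monomial basis w.r.t. dominance order, leading term $x_1^{\lambda_1}\cdots x_\ell^{\lambda_\ell}$). ''$\mathbf p=1^N$'' means $p_n=N$ for all $n$. Jack generating function of a probability measure $M_N$ on $\mathbb Y(N)$: $F_N(\mathbf p;\theta)=\sum_{\lambda\in\mathbb Y(N)}M_N(\lambda)J_\lambda(\mathbf p;\theta)/J_\lambda(1^N;\theta)=\sum_{\lambda\in\mathbb Y}a_{M_N}(\lambda)p_\lambda$. Assumption A: there is $\varepsilon>0$ such that for all $N$, $\sum_\lambda|a_{M_N}(\lambda)|N^{\ell(\lambda)}|x|^{|\lambda|}$ converges for complex $|x|<1+\varepsilon$. Assumption C: (1) for each $k\ge1$, $\lim_N\frac1N\sum_{i\ge1}k!\binom ik\frac{\partial\ln F_N}{\partial p_i}\big|_{\mathbf p=1^N}=\mathfrak c_k$; (2) for each $k,l\ge1$, $\lim_N\sum_{i,j\ge1}k!\,l!\binom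 ik\binom jl\frac{\partial^2\ln F_N}{\partial p_i\partial p_j}\big|_{\mathbf p=1^N}=\mathfrak d_{k,l}$; (3) for each $r\ge3$ and $k_1,\dots,k_r\ge1$, $\lim_N\sum_{i_1,\dots,i_r\ge1}\prod_j\binom{i_j}{k_j}\frac{\partial^r\ln F_N}{\partial p_{i_1}\cdots\partial p_{i_r}}\big|_{\mathbf p=1^N}=0$. Empirical measure: for $\lambda\in\mathbb Y(N)$, $y_i=\frac{\lambda_i}{\theta N}-\frac{i-1}N$ and $\mu[\lambda]=\frac1N\sum_{i=1}^N\delta_{y_i}$; $\xi^{(k)}[\lambda]=N\big(\int x^kd\mu[\lambda]-\mathbb E\int x^kd\mu[\lambda]\big)$. Central limit theorem: the law of large numbers holds (there are numbers $\mathfrak p_k$ with $\lim_N\mathbb E\prod_i\int x^{k_i}d\mu[\lambda]=\prod_i\mathfrak p_{k_i}$ for all finite families) and the family $(\xi^{(k)}[\lambda])_{k\ge1}$ converges in the sense of moments to a centered Gaussian vector: the limits of covariances exist and all joint cumulants of order $r\ge3$ tend to $0$. *)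

(* Defs.v *)
From Stdlib Require Import Reals Lra List Arith ZArith ClassicalEpsilon.
Import ListNotations.
Open Scope R_scope.

Definition lsum {A : Type} (f : A -> R) (l : list A) : R :=
  fold_right (fun x acc => f x + acc) 0 l.
Definition lprod {A : Type} (f : A -> R) (l : list A) : R :=
  fold_right (fun x acc => f x * acc) 1 l.

Definition is_partition (l : list nat) : Prop :=
  (forall i, (i < length l)%nat -> (0 < nth i l 0%nat)%nat) /\
  (forall i, (S i < length l)%nat -> (nth (S i) l 0%nat <= nth i l 0%nat)%nat).

Definition psize (l : list nat) : nat := list_sum l.

Fixpoint partsF (fuel n m : nat) : list (list nat) :=
  match fuel with
  | O => if Nat.eqb n 0 then [[]] else []
  | S f => if Nat.eqb n 0 then [[]] else
      flat_map (fun k => map (cons k) (partsF f (n - k) k)) (seq 1 (Nat.min n m))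
  end.
Definition partitions (n : nat) : list (list nat) := partsF n n n.

Definition mult (l : list nat) (j : nat) : nat := count_occ Nat.eq_dec l j.

Definition zee (nu : list nat) : R :=
  lprod (fun j => INR j ^ mult nu j * INR (fact (mult nu j))) (seq 1 (psize nu)).

Fixpoint ff (m c : nat) : nat :=
  match c with O => 1%nat | S c' => ((m - c') * ff m c')%nat end.

(* Homogeneous symmetric functions of degree n are represented by their *)
(* coefficients f nu in the power-sum basis p_nu, nu a partition of n.  *)

Definition jinner (theta : R) (n : nat) (f g : list nat -> R) : R :=
  lsum (fun nu => f nu * g nu * zee nu / theta ^ length nu) (partitions n).

Fixpoint maps (k m : nat) : list (list nat) :=
  match k with
  | O => [[]]
  | S k' => flat_map (fun j => map (cons j) (maps k' m)) (seq 0 m)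
  end.
Definition fiber_sum (nu phi : list nat) (j : nat) : nat :=
  list_sum (map fst (filter (fun pr => Nat.eqb (snd pr) j) (combine nu phi))).
(* coefficient of the monomial x_1^{mu_1} ... x_l^{mu_l} in p_nu *)
Definition pm_coef (nu mu : list nat) : R :=
  INR (length (filter
    (fun phi => forallb (fun j => Nat.eqb (fiber_sum nu phi j) (nth j mu 0%nat))
                        (seq 0 (length mu)))
    (maps (length nu) (length mu)))).
Definition mon_coef (n : nat) (f : list nat -> R) (mu : list nat) : R :=
  lsum (fun nu => f nu * pm_coef nu mu) (partitions n).

Definition dominated (mu la : list nat) : Prop :=
  psize mu = psize la /\
  forall i, (list_sum (firstn i mu) <= list_sum (firstn i la))%nat.

Definition JackFamily (theta : R) (P : list nat -> list nat -> R) : Prop :=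
  forall la, is_partition la ->
    mon_coef (psize la) (P la) la = 1 /\
    (forall mu, In mu (partitions (psize la)) ->
        mon_coef (psize la) (P la) mu <> 0 -> dominated mu la) /\
    (forall mu, In mu (partitions (psize la)) -> mu <> la ->
        jinner theta (psize la) (P la) (P mu) = 0).

(* Jack theta la nu = coefficient of p_nu in J_la(p; theta) *)
Definition Jack (theta : R) : list nat -> list nat -> R :=
  epsilon (inhabits (fun _ _ => 0)) (JackFamily theta).

(* J_la(1^N) : p_n = N for all n *)
Definition Jack1 (theta : R) (N : nat) (la : list nat) : R :=
  lsum (fun nu => Jack theta la nu * INR N ^ length nu) (partitions (psize la)).

Definition series_val (u : nat -> R) : R :=
  epsilon (inhabits 0) (fun l => Un_cv (fun K => sum_f_R0 u K) l).
Definition lim_val (u : nat -> R) : R :=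
  epsilon (inhabits 0) (fun l => Un_cv u l).

Definition Ysum (N : nat) (g : list nat -> R) (n : nat) : R :=
  lsum (fun la => if Nat.leb (length la) N then g la else 0) (partitions n).

Definition is_prob_YN (N : nat) (MN : list nat -> R) : Prop :=
  (forall la, 0 <= MN la) /\ Un_cv (fun K => sum_f_R0 (Ysum N MN) K) 1.

(* coefficient a_{M_N}(nu) of p_nu in F_N *)
Definition acoef (theta : R) (M : nat -> list nat -> R) (N : nat) (nu : list nat) : R :=
  Ysum N (fun la => M N la * Jack theta la nu / Jack1 theta N la) (psize nu).

Definition AssumptionA (theta : R) (M : nat -> list nat -> R) : Prop :=
  exists eps, 0 < eps /\
  forall N, (1 <= N)%nat -> forall x, 0 <= x < 1 + eps ->
    exists S, Un_cv (fun K => sum_f_R0 (fun n =>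
        lsum (fun nu => Rabs (acoef theta M N nu) * INR N ^ length nu * x ^ n)
             (partitions n)) K) S.

(* partial derivative d^r F_N / dp_{i_1} ... dp_{i_r} at p = 1^N, where
   is = [i_1; ...; i_r] (term-by-term differentiation of sum a(nu) p_nu) *)
Definition dF (theta : R) (M : nat -> list nat -> R) (N : nat) (is : list nat) : R :=
  series_val (fun n => lsum (fun nu =>
     acoef theta M N nu
     * lprod (fun j => INR (ff (mult nu j) (mult is j))) (seq 1 (list_max is))
     * INR N ^ (length nu - length is)) (partitions n)).

Fixpoint insert_each (x : nat) (pi : list (list nat)) : list (list (list nat)) :=
  match pi with
  | [] => []
  | B :: rest => ((x :: B) :: rest) :: map (cons B) (insert_each x rest)
  end.
Fixpoint setparts (l : list nat) : list (list (list nat)) :=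
  match l with
  | [] => [[]]
  | x :: xs => flat_map (fun pi => ([x] :: pi) :: insert_each x pi) (setparts xs)
  end.

Definition mobius_coef (pi : list (list nat)) : R :=
  (-1) ^ (length pi - 1) * INR (fact (length pi - 1)).

(* d^r ln F / dp_{i_1}..dp_{i_r} at 1^N, via the chain rule (Faa di Bruno):
   sum over set partitions pi of {1..r} of
   (-1)^{|pi|-1} (|pi|-1)! prod_{B in pi} (d^B F) / F^{|pi|} *)
Definition dlnF (theta : R) (M : nat -> list nat -> R) (N : nat) (is : list nat) : R :=
  lsum (fun pi => mobius_coef pi *
          lprod (fun B => dF theta M N (map (fun s => nth s is 0%nat) B)
                          / dF theta M N []) pi)
       (setparts (seq 0 (length is))).

Definition box (r K : nat) : list (list nat) := map (map S) (maps r K).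
Definition multisum (r : nat) (f : list nat -> R) : R :=
  lim_val (fun K => lsum f (box r K)).

Definition binomR (i k : nat) : R := INR (ff i k) / INR (fact k).

Definition AssumptionC (theta : R) (M : nat -> list nat -> R)
   (c : nat -> R) (d : nat -> nat -> R) : Prop :=
  (forall k, (1 <= k)%nat ->
     Un_cv (fun N => / INR N * multisum 1 (fun is =>
        INR (fact k) * binomR (nth 0%nat is 0%nat) k * dlnF theta M N is)) (c k)) /\
  (forall k l, (1 <= k)%nat -> (1 <= l)%nat ->
     Un_cv (fun N => multisum 2 (fun is =>
        INR (fact k) * INR (fact l) * binomR (nth 0%nat is 0%nat) k * binomR (nth 1%nat is 0%nat) l
        * dlnF theta M N is)) (d k l)) /\
  (forall ks : list nat, (3 <= length ks)%nat -> Forall (fun k => (1 <= k)%nat) ks ->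
     Un_cv (fun N => multisum (length ks) (fun is =>
        lprod (fun s => binomR (nth s is 0%nat) (nth s ks 0%nat)) (seq 0 (length ks))
        * dlnF theta M N is)) 0).

Definition ycoord (theta : R) (N : nat) (la : list nat) (i0 : nat) : R :=
  INR (nth i0 la 0%nat) / (theta * INR N) - INR i0 / INR N.
Definition moment (theta : R) (N k : nat) (la : list nat) : R :=
  / INR N * lsum (fun i0 => ycoord theta N la i0 ^ k) (seq 0 N).

Definition Ex (M : nat -> list nat -> R) (N : nat) (g : list nat -> R) : R :=
  series_val (Ysum N (fun la => M N la * g la)).

Definition xi (theta : R) (M : nat -> list nat -> R) (N k : nat) (la : list nat) : R :=
  INR N * (moment theta N k la - Ex M N (moment theta N k)).

Definition covar (theta : R) (M : nat -> list nat -> R) (N k l : nat) : R :=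
  Ex M N (fun la => xi theta M N k la * xi theta M N l la)
  - Ex M N (xi theta M N k) * Ex M N (xi theta M N l).

Definition joint_cum (theta : R) (M : nat -> list nat -> R) (N : nat) (ks : list nat) : R :=
  lsum (fun pi => mobius_coef pi *
          lprod (fun B => Ex M N (fun la =>
                   lprod (fun s => xi theta M N (nth s ks 0%nat) la) B)) pi)
       (setparts (seq 0 (length ks))).

Definition CLT (theta : R) (M : nat -> list nat -> R) : Prop :=
  (exists p : nat -> R, forall ks : list nat, Forall (fun k => (1 <= k)%nat) ks ->
     Un_cv (fun N => Ex M N (fun la => lprod (fun k => moment theta N k la) ks))
           (lprod p ks)) /\
  (forall k l, (1 <= k)%nat -> (1 <= l)%nat ->
     exists v, Un_cv (fun N => covar theta M N k l) v) /\
  (forall ks : list nat, (3 <= length ks)%nat -> Forall (fun k => (1 <= k)%nat) ks ->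
     Un_cv (fun N => joint_cum theta M N ks) 0).

Definition ps := nat -> R.
Definition ps_mul (f g : ps) : ps :=
  fun n => sum_f_R0 (fun i => f i * g (n - i)%nat) n.
Fixpoint ps_pow (f : ps) (k : nat) : ps :=
  match k with
  | O => fun n => if Nat.eqb n 0 then 1 else 0
  | S k' => ps_mul f (ps_pow f k')
  end.
(* U_mu(1+z) = sum_{j>=0} c_{j+1}/j! z^j *)
Definition U1 (c : nat -> R) : ps := fun j => c (S j) / INR (fact j).
Definition zz1 : ps := fun n => if orb (Nat.eqb n 1) (Nat.eqb n 2) then 1 else 0.
(* B(z) = 1 + z(1+z) U(1+z)/theta, so that 1/z + (1+z)/theta U(1+z) = B(z)/z *)
Definition Bser (theta : R) (c : nat -> R) : ps :=
  fun n => (if Nat.eqb n 0 then 1 else 0) + / theta * ps_mul zz1 (U1 c) n.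
(* [z^j] (1/z + (1+z)/theta U(1+z))^k = [z^{j+k}] B(z)^k, j in Z *)
Definition coefA (theta : R) (c : nat -> R) (k : nat) (j : Z) : R :=
  let e := (j + Z.of_nat k)%Z in
  if (e <? 0)%Z then 0 else ps_pow (Bser theta c) k (Z.to_nat e).
(* V_mu(1+z,1+w) = sum_{p,q>=0} d_{p+1,q+1}/(p! q!) z^p w^q *)
Definition V1 (d : nat -> nat -> R) (p q : nat) : R :=
  d (S p) (S q) / (INR (fact p) * INR (fact q)).

(* [z^{-1} w^{-1}] ( sum_{a>=1} a/theta z^{a-1} w^{-a-1} + V(z+1,w+1)/theta^2 )
                    * A(z)^k A(w)^l ;  terms with a > k or p >= k or q >= l vanish *)
Definition limit_cov (theta : R) (c : nat -> R) (d : nat -> nat -> R) (k l : nat) : R :=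
  lsum (fun a => INR a / theta * coefA theta c k (- Z.of_nat a)%Z
                   * coefA theta c l (Z.of_nat a)) (seq 1 k)
  + / theta ^ 2 * lsum (fun p => lsum (fun q =>
        V1 d p q * coefA theta c k (-1 - Z.of_nat p)%Z
                 * coefA theta c l (-1 - Z.of_nat q)%Z) (seq 0 l)) (seq 0 k).

(* Main.v *)
(** The Nazarov-Sklyanin Lax operator [L] acts on polynomials in an auxiliary variable [w] with
    coefficients in the power sums; the operators [K_j] given by the vacuum matrix elements of its powers
    are self-adjoint for the Jack product and triangular in the monomial basis, so Jack polynomials are
    their joint eigenvectors, with eigenvalues depending on the shifted coordinates
    [s_i = la_i / theta - i] through a rational generating function.  Taking logarithmic derivatives
    turns the [K_j] into operators [Y_k] with eigenvalues [sum_i y_i ^ k], so that joint moments of the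
    empirical measure are obtained by applying products of the [Y_k] to the generating function.

    Near [p = 1^N] use the coordinates [q_k], for which [d/dq_k = sum_i 'C(i, k) d/dp_i]; these
    derivatives of [ln F_N] are the quantities of Assumption C, and [w = 1 + z] turns [L] into a Toeplitz
    operator in [z].  Conjugated by [F_N], each [Y_k] becomes [N] times a scalar plus a first order
    operator [psi_k = m_k + sum_b al_k b * q_b + sum_a be_k a * d/dq_a] plus [o(1)].  Hence the
    fluctuations are Gaussian by Wick's formula with covariance [sum_a be_k a * al_l a], and a Wiener-Hopf
    factorization of the Toeplitz symbol [1/z + (1 + z) U(1 + z) / theta] identifies [al] and [be] with
    the coefficients in the statement. *)
From Stdlib Require Reals ZArith ClassicalEpsilon.
From HB Require structures.
From mathcomp Require all_boot all_order all_algebra all_fingroup boolp.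
From mathcomp Require ring lra zify mpoly Rstruct.
Require Defs.

(** Three obstacles shape the argument. Jack polynomials are chosen from a specification that
    demands orthogonality for every pair of partitions, also dominance-incomparable ones, so a
    family has to be constructed: orthogonalization against dominated monomials already gives joint
    eigenvectors, and simplicity of the joint spectrum supplies the remaining orthogonality.
    Division by [J_la(1^N)] requires positivity of the monomial coefficients, read off from the
    second order operator [Kop 1]. Finally, the leading part of each operator has size [N] and
    Assumption C gives no rate of convergence, so leading scalars are kept exact in [N] and only the
    next order passes to the limit. That order is the first variation of a power of a truncated
    Toeplitz operator, polluted by boundary terms; the same logarithmic derivative that converts
    eigenvalues into power sums cancels these terms exactly and leaves plain coefficient extraction.
    All limits are taken on single Taylor coefficients at [p = 1^N], where each operator needs
    finitely many coefficients, so no uniformity is involved. *)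

Module JackCLT.
Import Reals ZArith.
Import HB.structures.
Import all_boot all_order all_algebra all_fingroup boolp ring lra zify mpoly Rstruct.
Set Implicit Arguments. Unset Strict Implicit. Unset Printing Implicit Defensive.
Import Order.TTheory GRing.Theory Num.Theory.
Local Open Scope ring_scope.
Bind Scope ring_scope with R.

(** * Formal power series *)

Definition fps (K : Type) : Type := nat -> K.

Section FpsRing.
Variable K : comNzRingType.
Implicit Types f g h : fps K.

HB.instance Definition _ := gen_eqMixin (fps K).
HB.instance Definition _ := gen_choiceMixin (fps K).

Definition fps_add f g : fps K := fun n => f n + g n.
Definition fps_opp f : fps K := fun n => - f n.
Definition fps_zero : fps K := fun=> 0.
Definition fps_one : fps K := fun n => (n == 0%N)%:R.
Definition fps_mul f g : fps K := fun n => \sum_(i < n.+1) f i * g (n - i)%N.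
Definition fps_trunc (n : nat) f : {poly K} := \poly_(i < n.+1) f i.

Lemma coef_fps_trunc n f i : (i <= n)%N -> (fps_trunc n f)`_i = f i.
Proof. by move=> h; rewrite coef_poly ltnS h. Qed.

(** Coefficients up to order [n] of a product only see the polynomial truncations, so associativity
    and commutativity are inherited from [{poly K}]. *)
Lemma fps_mul_trunc f g n m : (m <= n)%N ->
  fps_mul f g m = (fps_trunc n f * fps_trunc n g)`_m.
Proof.
move=> hm; rewrite coefM; apply: eq_bigr => i _.
rewrite !coef_fps_trunc //; first by apply: leq_trans hm; rewrite leq_subr.
by apply: leq_trans hm; rewrite -ltnS.
Qed.

Lemma fps_addA : associative fps_add.
Proof. by move=> f g h; apply/funext => n; rewrite /fps_add addrA. Qed.
Lemma fps_addC : commutative fps_add.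
Proof. by move=> f g; apply/funext => n; rewrite /fps_add addrC. Qed.
Lemma fps_add0 : left_id fps_zero fps_add.
Proof. by move=> f; apply/funext => n; rewrite /fps_add add0r. Qed.
Lemma fps_addN : left_inverse fps_zero fps_opp fps_add.
Proof. by move=> f; apply/funext => n; rewrite /fps_add addNr. Qed.

HB.instance Definition _ := GRing.isZmodule.Build (fps K)
  fps_addA fps_addC fps_add0 fps_addN.

Lemma fps_mulA : associative fps_mul.
Proof.
move=> f g h; apply/funext => n.
rewrite (fps_mul_trunc f _ (leqnn n)) (fps_mul_trunc _ h (leqnn n)).
have E u v : fps_trunc n (fps_mul u v) =
   \poly_(i < n.+1) (fps_trunc n u * fps_trunc n v)`_i.
  by apply/polyP => i; rewrite !coef_poly ltnS; case: (leqP i n) => // hi; rewrite (fps_mul_trunc u v hi).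
transitivity ((fps_trunc n f * (fps_trunc n g * fps_trunc n h))`_n).
  rewrite !coefM; apply: eq_bigr => i _; congr (_ * _).
  by rewrite E coef_poly ltnS leq_subr.
rewrite mulrA !coefM; apply: eq_bigr => i _; congr (_ * _).
by rewrite E coef_poly ltn_ord.
Qed.
Lemma fps_mulC : commutative fps_mul.
Proof.
by move=> f g; apply/funext => n; rewrite !(fps_mul_trunc _ _ (leqnn n)) mulrC.
Qed.
Lemma fps_mul1 : left_id fps_one fps_mul.
Proof.
move=> f; apply/funext => n; rewrite /fps_mul big_ord_recl big1 ?addr0 /fps_one /=.
  by rewrite mul1r subn0.
by move=> i _; rewrite mul0r.
Qed.
Lemma fps_mulDl : left_distributive fps_mul fps_add.
Proof.
move=> f g h; apply/funext => n; rewrite /fps_mul /fps_add -big_split /=.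
by apply: eq_bigr => i _; rewrite mulrDl.
Qed.
Lemma fps_one_neq0 : fps_one != fps_zero.
Proof.
apply/eqP => /(congr1 (fun f => f 0%N)); rewrite /fps_one /fps_zero /= => /eqP.
by rewrite oner_eq0.
Qed.

HB.instance Definition _ := GRing.Zmodule_isComNzRing.Build (fps K)
  fps_mulA fps_mulC fps_mul1 fps_mulDl fps_one_neq0.

Lemma fpsD f g n : (f + g) n = f n + g n. Proof. by []. Qed.
Lemma fpsN f n : (- f) n = - f n. Proof. by []. Qed.
Lemma fpsB f g n : (f - g) n = f n - g n. Proof. by []. Qed.
Lemma fps1 n : (1 : fps K) n = (n == 0%N)%:R. Proof. by []. Qed.
Lemma fpsM f g n : (f * g) n = \sum_(i < n.+1) f i * g (n - i)%N. Proof. by []. Qed.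
Lemma fps_sum I r (P : pred I) (F : I -> fps K) n :
  (\sum_(i <- r | P i) F i) n = \sum_(i <- r | P i) F i n.
Proof. by elim/big_rec2: _ => // i x y _ <-; rewrite fpsD. Qed.
Lemma fpsP f g : (forall n, f n = g n) -> f = g.
Proof. by move=> h; apply/funext. Qed.
Definition fpsC (c : K) : fps K := fun n => if n == 0%N then c else 0.
Definition fpsX : fps K := fun n => (n == 1%N)%:R.

Lemma fpsCM c f n : (fpsC c * f) n = c * f n.
Proof.
rewrite fpsM big_ord_recl big1 ?addr0 ?subn0 //.
by move=> i _; rewrite /fpsC /= mul0r.
Qed.
Lemma fpsXM f n : (fpsX * f) n = if n is m.+1 then f m else 0.
Proof.
rewrite fpsM; case: n => [|m]; first by rewrite big_ord_recl big_ord0 /fpsX mul0r addr0.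
rewrite !big_ord_recl big1 ?addr0; first by rewrite /fpsX mul0r add0r mul1r /bump /= subSS subn0.
by move=> i _; rewrite /fpsX /= mul0r.
Qed.
Lemma fpsXnM k f n : (fpsX ^+ k * f) n = if (k <= n)%N then f (n - k)%N else 0.
Proof.
elim: k n => [|k IH] n; first by rewrite expr0 mul1r subn0.
by rewrite exprS -mulrA fpsXM; case: n => [|n] //; rewrite IH subSS.
Qed.
Lemma fps_exp_ord f k n : f 0%N = 0 -> (n < k)%N -> (f ^+ k) n = 0.
Proof.
move=> f0; elim: k n => // k IH n hn; rewrite exprS fpsM big1 // => i _.
case: (posnP i) => [->|hi]; first by rewrite f0 mul0r.
by rewrite IH ?mulr0 //; have := ltn_ord i; lia.
Qed.

(** Geometric series for [1 / f] when [f] has constant term one: [(1 - f) ^+ k] has order at least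
    [k], so coefficient [n] needs only [n + 1] powers. *)
Definition fps_inv f : fps K := fun n => (\sum_(k < n.+1) (1 - f) ^+ k) n.

Lemma fps_mulV f : f 0%N = 1 -> f * fps_inv f = 1.
Proof.
move=> f0; have g0 : (1 - f) 0%N = 0 by rewrite fpsB f0 fps1 subrr.
apply: fpsP => n.
have -> : (f * fps_inv f) n = (f * \sum_(k < n.+1) (1 - f) ^+ k) n.
  rewrite !fpsM; apply: eq_bigr => i _; congr (_ * _); rewrite /fps_inv !fps_sum.
  rewrite (big_ord_widen n.+1 (fun k => ((1 - f) ^+ k) (n - i)%N)); last by lia.
  rewrite [RHS](bigID (fun k : 'I_n.+1 => (k < (n - i).+1)%N)) /= [X in _ = _ + X]big1 ?addr0 //.
  by move=> k hk; apply: fps_exp_ord => //; lia.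
have := subrX1 (1 - f) n.+1.
have -> : 1 - f - 1 = - f by ring.
rewrite mulNr => E; have -> : f * (\sum_(k < n.+1) (1 - f) ^+ k) = 1 - (1 - f) ^+ n.+1.
  by rewrite -[LHS]opprK -E; ring.
by rewrite fpsB fps_exp_ord // subr0.
Qed.

(** The Euler derivation [x d/dx], which unlike [d/dx] does not shift coefficients. *)
Definition fps_dx f : fps K := fun n => f n *+ n.
Lemma fps_dxM f g : fps_dx (f * g) = fps_dx f * g + f * fps_dx g.
Proof.
apply: fpsP => n; rewrite /fps_dx fpsD !fpsM -sumrMnl -big_split /=.
apply: eq_bigr => i _; rewrite mulrnAl mulrnAr -mulrnDr; congr (_ *+ _).
by have := ltn_ord i; lia.
Qed.
Lemma fps_dxD f g : fps_dx (f + g) = fps_dx f + fps_dx g.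
Proof. by apply: fpsP => n; rewrite /fps_dx !fpsD mulrnDl. Qed.
Lemma fps_dxN f : fps_dx (- f) = - fps_dx f.
Proof. by apply: fpsP => n; rewrite /fps_dx !fpsN mulNrn. Qed.
Lemma fps_dx1 : fps_dx 1 = 0.
Proof. by apply: fpsP => n; rewrite /fps_dx fps1; case: n => [|n] //=; rewrite mul0rn. Qed.

End FpsRing.

(** * Wiener--Hopf identity for truncated Toeplitz operators *)

Section WienerHopf.
Variable K : comNzRingType.
Variable u : fps K.
Notation Z := (fps K).
Notation z := (fpsX K).

(* [toep] is the one-sided operator with symbol [symbA / z = 1/z + (1 + z) u]. *)
Definition toepE (g : Z) : Z := fun c => g c.+1 + (u * g) c.
Definition toep (g : Z) : Z :=
  fun c => toepE g c + (if c is c'.+1 then toepE g c' else 0) - g c.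
Definition symbA : Z := 1 + z * (1 + z) * u.
Definition toepg (k : nat) : Z := iter k toep 1.
Definition toept (k : nat) : K := toepg k 0%N.

(** [toep] is multiplication by [symbA / z] up to the correction [(1 + 1/z) g(0)], which cancels the
    pole. The factorization below rests on this correction depending on [g] through one scalar
    only. *)
Lemma toep_symb (g : Z) : z * toep g = symbA * g - (1 + z) * fpsC (g 0%N).
Proof.
have -> : toep g = toepE g + z * toepE g - g.
  by apply: fpsP => n; rewrite fpsB fpsD fpsXM /toep.
have E : z * toepE g = g - fpsC (g 0%N) + z * (u * g).
  apply: fpsP => n; rewrite fpsD fpsB !fpsXM /fpsC; case: n => [|n] /=; first by rewrite subrr addr0.
  by rewrite subr0.
transitivity ((1 + z) * (z * toepE g) - z * g); first by ring.
by rewrite E /symbA; ring.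
Qed.

Variables (e : nat) (b : Z) (P w : Z -> Z).
Hypothesis e_gt0 : (0 < e)%N.
Hypothesis Pw : forall g, z ^+ e * P g = b * g - w g.
Hypothesis w_supp : forall g i, (e <= i)%N -> w g i = 0.

(* [toepd k] is the first variation of [toep ^ k] applied to [1], when [toep] is perturbed by [(1+z)P];
   [w] removes the terms of [b * g] of order below [e], which makes [P] a truncated multiplication by
   [b / z ^ e]. *)
Fixpoint toepd (k : nat) : Z :=
  if k is k'.+1 then toep (toepd k') + (1 + z) * P (toepg k') else 0.
Definition toepPhi (k : nat) : K := toepd k 0%N + w (toepg k) e.-1.
Definition toepPsi (k : nat) : K := (b * symbA ^+ k) (e + k).-1.

(** Collects both truncation defects in the recursion for [toepd], that of [P] and that of [toep];
    its orders stay below [e]. *)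
Let W (k : nat) : Z := w (toepg k) + z ^+ e.-1 * fpsC (toepd k 0%N).

Lemma toepd_rec k : z ^+ e.+1 * toepd k.+1 =
  symbA * (z ^+ e * toepd k) + (1 + z) * (z * (b * toepg k - W k)).
Proof.
rewrite /= /W; have -> : z ^+ e = z * z ^+ e.-1 by rewrite -exprS prednK.
transitivity (z ^+ e * (z * toep (toepd k)) + (1 + z) * z * (z ^+ e * P (toepg k))).
  by rewrite exprS; ring.
rewrite toep_symb Pw {1}(_ : z ^+ e = z * z ^+ e.-1); last by rewrite -exprS prednK.
by ring.
Qed.

Let tau := fpsX Z.
Let cst (f : Z) : fps Z := fpsC f.
(** Rescaling [tau] to [z * tau] keeps Laurent series in [z] within power series: a coefficient of
    [tau ^ k] had only nonnegative powers of [z] exactly when the rescaled one is divisible by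
    [z ^+ k]. *)
Let sc (F : fps Z) : fps Z := fun k => z ^+ k * F k.
Let Gs := sc toepg.
Let Ds := sc toepd.
Let Ws := sc W.
Let T : fps Z := fun k => z ^+ k * fpsC (toept k).
Let H : fps Z := 1 - cst (1 + z) * (tau * T).

Lemma sc_mul F G : sc (F * G) = sc F * sc G.
Proof.
apply: fpsP => n; rewrite /sc !fpsM mulr_sumr; apply: eq_bigr => i _.
have -> : z ^+ n = z ^+ i * z ^+ (n - i) by rewrite -exprD; congr (_ ^+ _); have := ltn_ord i; lia.
by ring.
Qed.

(** The Wiener-Hopf factorization: once the rescaling is undone, [1 - tau * symbA / z] is the
    product of [H], with nonpositive powers of [z] only, and of the inverse of [Gs], with
    nonnegative powers only. *)
Lemma toep_H : (1 - tau * cst symbA) * Gs = H.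
Proof.
apply: fpsP => k; rewrite mulrBl mul1r -mulrA fpsB [RHS]fpsB fps1 fpsXM /cst fpsCM fpsXM.
case: k => [|k].
  by rewrite !subr0 /Gs /sc /toepg /= expr0 mul1r mulr0 subr0.
rewrite /= sub0r /T fpsCM /Gs /sc /toept.
have -> : z ^+ k.+1 * toepg k.+1 = z ^+ k * (z * toep (toepg k)) by rewrite exprS /=; ring.
by rewrite toep_symb; ring.
Qed.

Lemma toep_D : (1 - tau * cst symbA) * (cst (z ^+ e) * Ds) =
  cst ((1 + z) * z) * (tau * (cst b * Gs - Ws)).
Proof.
apply: fpsP => k; rewrite mulrBl mul1r -mulrA fpsB /cst !fpsXM !fpsCM.
case: k => [|k]; first by rewrite fpsXM /Ds /sc /= !mulr0 subr0.
rewrite fpsXM fpsB !fpsCM /Ds /Ws /Gs /sc.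
have -> : z ^+ e * (z ^+ k.+1 * toepd k.+1) = z ^+ k * (z ^+ e.+1 * toepd k.+1).
  by rewrite !exprS; ring.
by rewrite toepd_rec; ring.
Qed.

Let Gi : fps Z := sc (fps_inv toepg).
Let Hi := fps_inv H.
Let Ai := fps_inv (1 - tau * cst symbA).
Let zi := fps_inv (1 + z).

Lemma Gs_inv : Gs * Gi = 1.
Proof.
rewrite -sc_mul fps_mulV; last by rewrite /toepg /= .
apply: fpsP => k; rewrite /sc !fps1; case: k => [|k]; first by rewrite expr0 mul1r.
by rewrite mulr0.
Qed.
Lemma H_inv : H * Hi = 1.
Proof. by apply: fps_mulV; rewrite /H fpsB fps1 /cst fpsCM fpsXM mulr0 subr0. Qed.
Lemma A_inv : (1 - tau * cst symbA) * Ai = 1.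
Proof. by apply: fps_mulV; rewrite fpsB fps1 fpsXM subr0. Qed.
Lemma z_inv : (1 + z) * zi = 1.
Proof. by apply: fps_mulV; rewrite fpsD fps1 /fpsX addr0. Qed.

Lemma Ai_coef k : Ai k = symbA ^+ k.
Proof.
elim: k => [|k IH]; have := congr1 (fun f : fps Z => f _) A_inv.
  by move=> /(_ 0%N); rewrite mulrBl mul1r fpsB -mulrA fpsXM subr0 fps1 expr0.
move=> /(_ k.+1); rewrite mulrBl mul1r fpsB -mulrA fpsXM fps1 /cst fpsCM IH /= => /eqP.
by rewrite subr_eq0 exprS => /eqP.
Qed.

Let V := Ws * Hi.

(** Dividing the equation for [Ds] by [Gs] and [1 + z] separates the signs of the powers of [z]: the
    left side is a plus part, [V] a minus part, and together they make up the explicit series with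
    coefficients [b * symbA ^+ k]. *)
Lemma WH_factor : cst (z ^+ e) * (Ds * Gi * cst zi) =
  cst z * (tau * (cst b * Ai - V)).
Proof.
have cM x y : cst (x * y) = cst x * cst y.
  by apply: fpsP => n; rewrite /cst fpsCM /fpsC; case: ifP => // _; rewrite mulr0.
have c1 : cst 1 = 1 by apply: fpsP => n; rewrite /cst /fpsC fps1; case: eqP.
have zV : cst (1 + z) * cst zi = 1 by rewrite -cM z_inv c1.
have AH : Ai * H = Gs by rewrite -toep_H mulrA [Ai * _]mulrC A_inv mul1r.
have HG : Hi * Gs = Ai by rewrite -AH mulrCA [Hi * H]mulrC H_inv mulr1.
have GiH : Ai * Gi = Hi by rewrite -HG -mulrA Gs_inv mulr1.
have E := toep_D; rewrite cM in E.
transitivity (Ai * ((1 - tau * cst symbA) * (cst (z ^+ e) * Ds)) * Gi * cst zi).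
  transitivity ((1 - tau * cst symbA) * Ai * (cst (z ^+ e) * Ds * Gi * cst zi)).
    by rewrite A_inv; ring.
  by ring.
rewrite E.
transitivity (cst (1 + z) * cst zi * cst z * tau *
   (cst b * (Gs * Gi) * Ai - Ws * (Ai * Gi))); first by ring.
by rewrite zV Gs_inv GiH /V; ring.
Qed.

(** In the coefficient of [tau ^ k.+1] the plus part is divisible by [z ^+ k.+1] and is invisible
    one order lower. That position is the residue, where [V] therefore agrees with
    [b * symbA ^+ k]. *)
Lemma V_coef k : (V k) (e + k).-1 = toepPsi k.
Proof.
have := congr1 (fun f : fps Z => f k.+1 (e + k)%N) WH_factor.
rewrite /cst fpsCM fpsXnM leq_addr addKn.
have -> : (Ds * Gi * fpsC zi) k.+1 k = 0.
  rewrite mulrC fpsCM; have -> : Ds * Gi = sc ((toepd : fps Z) * fps_inv toepg) by rewrite sc_mul.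
  by rewrite /sc mulrCA fpsXnM ltnn.
rewrite fpsCM !fpsXM fpsB fpsCM Ai_coef.
have -> : (e + k)%N = (e + k).-1.+1 by rewrite prednK // addn_gt0 e_gt0.
by rewrite fpsB /toepPsi /= => /eqP; rewrite eq_sym subr_eq0 => /eqP.
Qed.

Lemma WH_V : V = Ws + cst (1 + z) * (tau * T) * V.
Proof.
have E : H * V = Ws by rewrite /V mulrCA H_inv mulr1.
by rewrite -{1}E /H; ring.
Qed.

Lemma fps_z1M (f : Z) n : ((1 + z) * f) n.+1 = f n.+1 + f n.
Proof. by rewrite mulrDl mul1r fpsD fpsXM. Qed.

Lemma WsE k i : (k <= i)%N -> Ws k i = W k (i - k)%N.
Proof. by move=> h; rewrite /Ws /sc fpsXnM h. Qed.

Lemma V_rec k n : V k n = Ws k n + \sum_(i < k)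
   ((1 + z) * (z ^+ i * (fpsC (toept i) * V (k - i.+1)%N))) n.
Proof.
rewrite {1}WH_V fpsD fpsD -mulrA /cst fpsCM -mulrA fpsXM.
case: k => [|k]; first by rewrite mulr0 big_ord0.
rewrite fpsM mulr_sumr fps_sum; congr (_ + _); apply: eq_bigr => i _.
by rewrite /T subSS -!mulrA.
Qed.

Lemma W_supp k i : (e <= i)%N -> W k i = 0.
Proof.
move=> h; rewrite /W fpsD w_supp // add0r fpsXnM; case: leqP => // h2.
by rewrite /fpsC; case: eqP => //; lia.
Qed.

(** Bounds the minus part from above, so that in [V_rec], read at the residue position, only the
    shifted summand of each factor [1 + z] survives. *)
Lemma V_supp k n : (e + k <= n)%N -> V k n = 0.
Proof.
elim/ltn_ind: k n => k IH n h; rewrite V_rec WsE; last by lia.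
rewrite W_supp; last by lia.
rewrite add0r big1 // => i _; have hi := ltn_ord i.
case: n h => [|n] h; first by lia.
rewrite fps_z1M !fpsXnM !fpsCM.
by rewrite !ifT ?IH ?mulr0 ?addr0 //; lia.
Qed.

(** Here [toepPsi k] is the coefficient of [z^-1] in [(b / z^e) (symbA / z)^k], free of any
    truncation. In generating functions the relation reads [Phi = (1 - X T) Psi], the form consumed
    by [logder_linear]. *)
Theorem toepPhiE k :
  toepPhi k = toepPsi k - \sum_(i < k) toept i * toepPsi (k - i.+1).
Proof.
rewrite -V_coef V_rec; have e1 : (e + k).-1 = (e.-1 + k)%N by lia.
rewrite e1 WsE ?leq_addl // addnK.
have -> : W k e.-1 = toepPhi k.
  by rewrite /W fpsD /toepPhi fpsXnM leqnn subnn /fpsC /= addrC.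
rewrite -addrA -{1}[toepPhi k]addr0; congr (_ + _); apply/esym/eqP.
rewrite subr_eq0; apply/eqP/eq_bigr => i _; have hi := ltn_ord i.
have -> : (e.-1 + k)%N = (e.-1 + k).-1.+1 by lia.
rewrite fps_z1M !fpsXnM !fpsCM !ifT; [|by lia|by lia].
rewrite V_supp; last by lia.
by rewrite mulr0 add0r -V_coef; congr (_ * V _ _); lia.
Qed.

End WienerHopf.

(** * Logarithmic derivative identities *)

Section LogDerivative.
Variable K : comNzRingType.
Notation X := (fpsX K).
Implicit Types t v phi psi : fps K.

(** Coefficientwise form of [v = - x d/dx ln (1 - x t)]. *)
Definition logder_rec t v := v 0%N = 0 /\
  forall k, v k.+1 = (t k) *+ k.+1 + \sum_(i < k.+1) t i * v (k - i)%N.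

Lemma logder_recE t v : logder_rec t v <-> (1 - X * t) * v = fps_dx (X * t).
Proof.
split=> [[v0 vS]|H].
  have E : v = fps_dx (X * t) + X * (t * v).
    apply: fpsP => -[|k]; rewrite fpsD /fps_dx !fpsXM; first by rewrite v0 mul0rn addr0.
    by rewrite vS.
  by rewrite mulrBl mul1r -mulrA {1}E addrK.
have E : v = fps_dx (X * t) + X * (t * v) by rewrite -H; ring.
split; first by rewrite E fpsD /fps_dx !fpsXM addr0.
by move=> k; rewrite {1}E fpsD /fps_dx !fpsXM.
Qed.

(** Linearization of [v = - x d/dx ln (1 - x t)]: a variation [phi = (1 - X t) psi] of [t] changes
    [v] by [x d/dx (X phi / (1 - X t)) = x d/dx (X psi)]. This is where the truncation corrections
    of [toepPhiE] disappear. *)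
Lemma logder_linear t v0 phi psi v :
  logder_rec t v0 ->
  (forall k, phi k = psi k - \sum_(i < k) t i * psi (k - i.+1)%N) ->
  v 0%N = 0 ->
  (forall k, v k.+1 = phi k *+ k.+1 +
     \sum_(i < k.+1) (t i * v (k - i)%N + v0 (k - i)%N * phi i)) ->
  forall k, v k.+1 = psi k *+ k.+1.
Proof.
move=> /logder_recE Hv0 Hphi v_0 vS.
have Ephi : phi = (1 - X * t) * psi.
  apply: fpsP => k; rewrite Hphi mulrBl mul1r fpsB; congr (_ - _); rewrite -mulrA fpsXM.
  case: k => [|k]; first by rewrite big_ord0.
  by rewrite fpsM; apply: eq_bigr => i _; rewrite subSS.
have Ev : (1 - X * t) * v = fps_dx (X * phi) + X * phi * v0.
  suff E : v = fps_dx (X * phi) + X * (t * v) + X * (phi * v0).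
    by rewrite mulrBl mul1r {1}E; ring.
  apply: fpsP => -[|k]; rewrite !fpsD /fps_dx !fpsXM; first by rewrite v_0 mul0rn !addr0.
  rewrite vS -addrA; congr (_ + _); rewrite !fpsM -big_split /=.
  by apply: eq_bigr => i _; rewrite [v0 _ * _]mulrC.
have Epsi : (1 - X * t) * fps_dx (X * psi) = fps_dx (X * phi) + X * phi * v0.
  have -> : X * phi = (1 - X * t) * (X * psi) by rewrite Ephi; ring.
  rewrite [fps_dx ((1 - _) * _)]fps_dxM [fps_dx (1 - _)]fps_dxD fps_dx1 fps_dxN -Hv0; ring.
have inv : (1 - X * t) * fps_inv (1 - X * t) = 1.
  by apply: fps_mulV; rewrite fpsB fps1 fpsXM subr0.
have E : v = fps_dx (X * psi).
  rewrite -[v]mul1r -[fps_dx _]mul1r -inv ![(_ - _) * fps_inv _]mulrC -!mulrA Ev Epsi //.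
by move=> k; rewrite E /fps_dx fpsXM.
Qed.

Definition fps_geo (s : K) : fps K := fun n => s ^+ n.
Lemma fps_geoE s : (1 - fpsC s * X) * fps_geo s = 1.
Proof.
apply: fpsP => k; rewrite mulrBl mul1r fpsB -mulrA fpsCM fpsXM fps1 /fps_geo.
by case: k => [|k]; rewrite ?mulr0 ?subr0 // exprS subrr.
Qed.
Lemma fps_dx_geo s : fps_dx (fps_geo s) = fpsC s * X * fps_geo s ^+ 2.
Proof.
have dX : fps_dx (fpsC s * X) = fpsC s * X.
  by apply: fpsP => -[|[|k]]; rewrite /fps_dx fpsCM /fpsX /= ?mulr0 ?mul0rn ?mulr1n.
have := congr1 (@fps_dx K) (fps_geoE s); rewrite fps_dxM fps_dxD fps_dx1 fps_dxN dX => H.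
rewrite -[LHS]mul1r -{1}(fps_geoE s).
have -> : (1 - fpsC s * X) * fps_geo s * fps_dx (fps_geo s) =
  fps_geo s * ((0 - fpsC s * X) * fps_geo s + (1 - fpsC s * X) * fps_dx (fps_geo s)) +
  fpsC s * X * fps_geo s ^+ 2 by ring.
by rewrite H mulr0 add0r.
Qed.

Section Rows.
Variables (N : nat) (s : nat -> K).
(* The action of [L] on the leading terms of a polynomial with dominant exponent [la]. *)
Definition rowop (g : nat -> K) : nat -> K :=
  fun i => (s i - 1) * g i - \sum_(i.+1 <= j < N) g j.
Definition rowvec (k : nat) : nat -> K := iter k rowop (fun=> 1).
Definition rowE (k : nat) : K := \sum_(0 <= i < N) rowvec k i.

Let gam (i : nat) : fps K := fun k => rowvec k i.
Let RR (i : nat) : fps K := 1 - X * \sum_(i <= j < N) gam j.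

Lemma gam_rec i : (1 - fpsC (s i - 1) * X) * gam i = RR i.+1.
Proof.
apply: fpsP => k; rewrite mulrBl mul1r fpsB -mulrA fpsCM fpsXM /RR fpsB fps1 fpsXM.
case: k => [|k]; first by rewrite mulr0 !subr0.
rewrite fps_sum /= sub0r {1}/gam /rowvec /= {1}/rowop /gam /rowvec; ring.
Qed.

(** Telescoping over rows: row [i] contributes the factor [(1 - s_i X) / (1 - (s_i - 1) X)], and the
    product over all rows is [1 - X * rowE]. *)
Lemma RR_rec i : (i < N)%N ->
  RR i = RR i.+1 * (1 - fpsC (s i) * X) * fps_geo (s i - 1).
Proof.
move=> hi; have E : RR i = RR i.+1 - X * gam i.
  by rewrite /RR (big_ltn hi); ring.
have C1 : fpsC (s i) = fpsC (s i - 1) + 1.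
  by apply: fpsP => -[|k]; rewrite fpsD /fpsC fps1 /= ?subrK ?addr0.
have H : (1 - fpsC (s i - 1) * X) * RR i = RR i.+1 * (1 - fpsC (s i) * X).
  by rewrite E mulrBr mulrCA gam_rec C1; ring.
by rewrite -H mulrAC fps_geoE mul1r.
Qed.

Lemma RR_logder i : (i <= N)%N ->
  - fps_dx (RR i) = RR i * \sum_(i <= j < N) (fps_geo (s j) - fps_geo (s j - 1)).
Proof.
move=> hi; rewrite -(subKn hi); elim: (N - i)%N (leq_subr i N) => [|m IH] hm.
  by rewrite subn0 /RR big_geq // mulr0 subr0 big_geq // mulr0 fps_dx1 oppr0.
have hlt : (N - m.+1 < N)%N by lia.
have Em : (N - m.+1).+1 = (N - m)%N by lia.
rewrite (big_ltn hlt) Em RR_rec // Em; have := IH (ltnW hm).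
set W := \sum_(_ <= j < N) _; set R1 := RR _; set g := fps_geo (s _ - 1); set si := s _.
set gs := fps_geo si => HW.
have Hs : (1 - fpsC si * X) * gs = 1 := fps_geoE si.
have Hg : (1 - fpsC (si - 1) * X) * g = 1 := fps_geoE _.
clearbody R1 W.
rewrite fps_dxM [fps_dx (R1 * _)]fps_dxM [fps_dx (1 - _)]fps_dxD fps_dx1 fps_dxN fps_dx_geo -/g -/si.
have dX : fps_dx (fpsC si * X) = fpsC si * X.
  by apply: fpsP => -[|[|k]]; rewrite /fps_dx fpsCM /fpsX /= ?mulr0 ?mul0rn ?mulr1n.
rewrite dX.
have {}HW : fps_dx R1 = - (R1 * W) by rewrite -HW opprK.
rewrite HW.
transitivity (R1 * (1 - fpsC si * X) * g * W + R1 * (fpsC si * X) * g -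
  R1 * (1 - fpsC si * X) * g * g
  + R1 * (1 - fpsC si * X) * g * ((1 - fpsC (si - 1) * X) * g)); first by ring.
rewrite Hg; transitivity (R1 * (1 - fpsC si * X) * g * W -
  R1 * (1 - fpsC si * X) * g * g + R1 * g * ((1 - fpsC si * X) * gs)); last by ring.
by rewrite Hs; ring.
Qed.

(** Under the logarithmic derivative each factor yields the difference of the geometric series of
    [s_i] and [s_i - 1], their constant terms cancelling. *)
Lemma rowE_logder :
  logder_rec rowE (fun m => \sum_(0 <= i < N) (s i ^+ m - (s i - 1) ^+ m)).
Proof.
apply/logder_recE.
have ER : RR 0 = 1 - X * (rowE : fps K).
  rewrite /RR; congr (_ - X * _); apply: fpsP => k; rewrite fps_sum; exact: eq_bigr.
have EW : \sum_(0 <= j < N) (fps_geo (s j) - fps_geo (s j - 1)) =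
   (fun m => \sum_(0 <= i < N) (s i ^+ m - (s i - 1) ^+ m)) :> fps K.
  by apply: fpsP => k; rewrite fps_sum; exact: eq_bigr.
rewrite -ER -EW -RR_logder // ER fps_dxD fps_dx1 add0r fps_dxN opprK //.
Qed.

Definition psum (k : nat) : K := \sum_(0 <= i < N) s i ^+ k.
(** Inverts the unit difference [s^(k+1) - (s-1)^(k+1)], whose leading term is [(k+1) s^k]: the
    lower powers are moved to the other side with alternating signs. *)
Lemma psum_rec k : psum k *+ k.+1 =
  \sum_(0 <= i < N) (s i ^+ k.+1 - (s i - 1) ^+ k.+1) +
  \sum_(j < k) (-1) ^+ j * psum (k.-1 - j)%N *+ 'C(k.+1, j.+2).
Proof.
rewrite /psum -sumrMnl.
under [X in _ + X]eq_bigr do rewrite mulr_sumr -sumrMnl.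
rewrite exchange_big -big_split /=; apply: eq_bigr => i _; set x := s i.
rewrite exprBn !big_ord_recl /= /bump /= !add1n subSS !subn0 bin0 bin1.
rewrite expr0 expr1 expr1n !mulr1 mul1r mulr1n.
set S1 := \sum_(i < k) _; set S2 := \sum_(j < k) _.
have -> : S1 = - - S2; last by rewrite mulN1r mulNrn; ring.
rewrite opprK; apply: eq_bigr => j _; rewrite /bump /= !add1n subSS expr1n mulr1 !exprS.
have -> : (k - j.+1)%N = (k.-1 - j)%N by lia.
by rewrite mulrA mulrNN mulr1 mul1r.
Qed.

End Rows.
End LogDerivative.

(** * Operators on power-sum polynomials *)

Lemma mpoly_gen_ind (R : comNzRingType) n (P : {mpoly R[n]} -> Prop) :
  (forall c, P c%:MP) -> (forall f g, P f -> P g -> P (f + g)) ->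
  (forall i f, P f -> P ('X_i * f)) -> forall f, P f.
Proof.
move=> PC PD PX; have PM m c : P (c *: 'X_[m]).
  elim: {m}(mdeg m) {-2}m (erefl (mdeg m)) => [|d IH] m hm.
    move/eqP: hm; rewrite mdeg_eq0 => /eqP ->; rewrite mpolyX0 -mul_mpolyC mulr1; exact: PC.
  have /existsP[i hi] : [exists i, m i != 0%N].
    rewrite -negb_forall; apply/negP => /forallP h0.
    move: hm; rewrite mdegE big1 // => i _; exact/eqP/h0.
  have -> : m = (U_(i) + (m - U_(i)))%MM by rewrite addmC submK // lep1mP.
  rewrite mpolyXD scalerAr; apply: PX; apply: IH.
  apply/eqP; rewrite -(eqn_add2l (mdeg U_(i))) -mdegD addmC submK ?lep1mP //.
  by rewrite hm mdeg1 add1n.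
move=> f; rewrite (mpolyE f); elim: (msupp f) => [|m s IH].
  by rewrite big_nil -[0](mpolyC0 n); exact: PC.
by rewrite big_cons; apply: PD.
Qed.

Section PowerSums.
Variables (R : realFieldType) (n : nat).
Notation Lam := {mpoly R[n]}.
Implicit Types f g : Lam.

(* The variable ['X_i] stands for [p_(i+1)]; [pv] and [dv] vanish at indices outside [1..n]. *)
Definition pidx (b : nat) : option 'I_n := if b is b'.+1 then insub b' else None.
Definition pv (b : nat) : Lam := if pidx b is Some i then 'X_i else 0.
Definition dv (b : nat) (f : Lam) : Lam := if pidx b is Some i then f^`M(i) else 0.

Lemma pidx_ord (i : 'I_n) : pidx i.+1 = Some i.
Proof. by rewrite /pidx; case: insubP => [j _ /val_inj -> //|]; rewrite ltn_ord. Qed.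
Lemma pidxP b : reflect (exists2 i : 'I_n, b = i.+1 & pidx b = Some i) ((0 < b) && (b <= n))%N.
Proof.
case: b => [|b] /=; first by apply: (iffP idP) => // -[].
by apply: (iffP idP) => [h|[i [->] _] //]; exists (Ordinal h); [by []|exact: (pidx_ord (Ordinal h))].
Qed.
Lemma pidx_none b : ~~ ((0 < b) && (b <= n))%N -> pidx b = None.
Proof.
case: b => [|b] //= h; case: insubP => // j hj _.
by rewrite hj in h.
Qed.
Lemma pv_ord (i : 'I_n) : pv i.+1 = 'X_i. Proof. by rewrite /pv pidx_ord. Qed.
Lemma dvD b f g : dv b (f + g) = dv b f + dv b g.
Proof. by rewrite /dv; case: pidx => [i|]; rewrite ?mderivD ?addr0. Qed.
Lemma dvZ b c f : dv b (c *: f) = c *: dv b f.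
Proof. by rewrite /dv; case: pidx => [i|]; rewrite ?mderivZ ?scaler0. Qed.
Lemma dv0 b : dv b 0 = 0. Proof. by have := dvZ b 0 0; rewrite !scale0r. Qed.
Lemma dvM b f g : dv b (f * g) = dv b f * g + f * dv b g.
Proof. by rewrite /dv; case: pidx => [i|]; rewrite ?mderivM // mul0r mulr0 addr0. Qed.
Lemma dvC b c : dv b c%:MP = 0.
Proof. by rewrite /dv; case: pidx => [i|]; rewrite ?mderivC. Qed.
Lemma dv_sum b I r (P : pred I) (F : I -> Lam) :
  dv b (\sum_(i <- r | P i) F i) = \sum_(i <- r | P i) dv b (F i).
Proof. by apply: (big_morph (dv b)); [exact: dvD | exact: dv0]. Qed.
Lemma dv_comm b c f : dv b (dv c f) = dv c (dv b f).
Proof.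
rewrite /dv; case: pidx => [i|]; case: pidx => [j|] //; rewrite ?mderiv0 //.
exact: mderiv_comm.
Qed.
Lemma dv_pv b c : dv b (pv c) = ((b == c) && ((0 < b) && (b <= n))%N)%:R.
Proof.
rewrite /dv /pv; case: pidxP => [[i -> ->]|hb]; last first.
  have -> : pidx b = None by apply: pidx_none; apply/pidxP.
  by rewrite andbF.
rewrite andbT; case: (pidxP c) => [[j -> ->]|hc].
  rewrite mderivX mnm1E; have -> : (i.+1 == j.+1)%N = (j == i) by rewrite eqSS eq_sym.
  case: (eqVneq j i) => [->|_]; last by rewrite scale0r.
  rewrite scale1r; have -> : (U_(i) - U_(i) = 0)%MM by apply/mnmP => l; rewrite mnmBE subnn mnm0E.
  by rewrite mpolyX0.
have -> : pidx c = None by apply: pidx_none; apply/pidxP.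
rewrite mderiv0; case: eqP => // E; case: hc; exists i => //; by rewrite -E pidx_ord.
Qed.

(* Homogeneous of weight exactly [n], so that the truncation to [p_1, ..., p_n] loses nothing. *)
Definition hom f := forall m, mnmwgt m <> n -> f@_m = 0.
(** The variable [w] carries weight one, which makes [Lop] preserve the total weight [n]. *)
Definition homv (g : nat -> Lam) := forall k m, (k + mnmwgt m <> n)%N -> (g k)@_m = 0.

Lemma mcoeff_dv b f m : (dv b f)@_m =
  if pidx b is Some i then f@_(m + U_(i)) *+ (m i).+1 else 0.
Proof. by rewrite /dv; case: pidx => [i|]; rewrite ?mcoeff_deriv ?mcoeff0. Qed.

Lemma mcoeff_pvM b f m : (pv b * f)@_m =
  if pidx b is Some i then (if m i == 0%N then 0 else f@_(m - U_(i))) else 0.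
Proof.
rewrite /pv; case: pidx => [i|]; last by rewrite mul0r mcoeff0.
rewrite mulrC; case: ifP => [/eqP h0|/negbT h]; last first.
  by have := mcoeffMX f U_(i) (m - U_(i)); rewrite addmC submK ?lep1mP.
apply/eqP; rewrite mcoeff_eq0 (perm_mem (msuppMX f U_(i))); apply/negP => /mapP[m' _ E].
by move: h0; rewrite E mnmDE mnm1E eqxx; lia.
Qed.

Variable theta : R.
Hypothesis theta_gt0 : 0 < theta.

(** The norm [z_nu * theta^(-l(nu))] of a power sum, written with an exponent vector in place of
    [nu]. *)
Definition zet (m : 'X_{1..n}) : R :=
  \prod_(i < n) ((i.+1%:R / theta) ^+ m i * (m i)`!%:R).
Definition ip f g : R := \sum_(m <- msupp f) f@_m * g@_m * zet m.

Lemma zet_gt0 m : 0 < zet m.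
Proof.
apply: prodr_gt0 => i _; rewrite mulr_gt0 ?exprn_gt0 ?divr_gt0 ?ltr0n //.
exact: fact_gt0.
Qed.

Lemma zetU m i : zet (m + U_(i)) = zet m * (i.+1%:R / theta) * (m i).+1%:R.
Proof.
rewrite /zet (bigD1 i) //= [X in X * _ * _](bigD1 i) //= mnmDE mnm1E eqxx addn1.
rewrite factS natrM exprS.
under eq_bigr => j hj do rewrite mnmDE mnm1E eq_sym (negbTE hj) addn0.
set P := \prod_(j < n | j != i) _; ring.
Qed.

Lemma ip_sub f g s : uniq s -> {subset msupp f <= s} ->
  ip f g = \sum_(m <- s) f@_m * g@_m * zet m.
Proof.
move=> us hs; rewrite [RHS](bigID (fun m => m \in msupp f)) /=.
rewrite [X in _ = _ + X]big1 ?addr0; last first.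
  by move=> m hm; rewrite memN_msupp_eq0 // !mul0r.
rewrite -big_filter /ip; apply: perm_big; apply: uniq_perm => //.
  by rewrite filter_uniq.
by move=> m; rewrite mem_filter; case: (boolP (m \in msupp f)) => // /hs ->.
Qed.

Lemma ip_sym f g : ip f g = ip g f.
Proof.
set s := undup (msupp f ++ msupp g).
have us : uniq s by exact: undup_uniq.
rewrite (@ip_sub _ _ s) // => [|m hm]; last by rewrite mem_undup mem_cat hm.
rewrite [RHS](@ip_sub _ _ s) // => [|m hm]; last by rewrite mem_undup mem_cat hm orbT.
by apply: eq_bigr => m _; rewrite [f@_m * _]mulrC.
Qed.

Lemma ipDr f g h : ip f (g + h) = ip f g + ip f h.
Proof. by rewrite /ip -big_split /=; apply: eq_bigr => m _; rewrite mcoeffD; ring. Qed.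
Lemma ipZr c f g : ip f (c *: g) = c * ip f g.
Proof. by rewrite /ip mulr_sumr; apply: eq_bigr => m _; rewrite mcoeffZ; ring. Qed.
Lemma ipDl f g h : ip (f + g) h = ip f h + ip g h.
Proof. by rewrite ip_sym ipDr ![ip h _]ip_sym. Qed.
Lemma ipZl c f g : ip (c *: f) g = c * ip f g.
Proof. by rewrite ip_sym ipZr ip_sym. Qed.
Lemma ip0r f : ip f 0 = 0.
Proof. by have := ipZr 0 f 0; rewrite scale0r mul0r. Qed.
Lemma ip0l f : ip 0 f = 0. Proof. by rewrite ip_sym ip0r. Qed.
Lemma ip_sumr I r (P : pred I) (F : I -> Lam) f :
  ip f (\sum_(i <- r | P i) F i) = \sum_(i <- r | P i) ip f (F i).
Proof. by apply: (big_morph (ip f)); [exact: ipDr | exact: ip0r]. Qed.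
Lemma ip_suml I r (P : pred I) (F : I -> Lam) f :
  ip (\sum_(i <- r | P i) F i) f = \sum_(i <- r | P i) ip (F i) f.
Proof. by rewrite ip_sym ip_sumr; apply: eq_bigr => i _; rewrite ip_sym. Qed.

Lemma ip_eq0 f : ip f f = 0 -> f = 0.
Proof.
move/eqP; rewrite psumr_eq0 => [|m _]; last first.
  by rewrite mulr_ge0 ?(ltW (zet_gt0 m)) // -expr2 sqr_ge0.
move/allP => h; apply/mpolyP => m; rewrite mcoeff0.
case: (boolP (m \in msupp f)) => [/h /=|]; last exact: memN_msupp_eq0.
by rewrite mulf_eq0 (gt_eqF (zet_gt0 m)) orbF mulf_eq0 orbb => /eqP.
Qed.

Lemma ipX m g : ip 'X_[m] g = zet m * g@_m.
Proof. by rewrite /ip msuppX big_seq1 mcoeffX eqxx mul1r mulrC. Qed.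

(** The norms of [p_b p_m] and [p_m] differ by exactly the factor that differentiation in [p_b]
    produces. Hence the entries of [L] above and below its diagonal are mutually adjoint. *)
Lemma ip_adj b f g : ip (pv b * f) g = ip f ((b%:R / theta) *: dv b g).
Proof.
rewrite (mpolyE f) mulr_sumr !ip_suml; apply: eq_bigr => m _.
rewrite -scalerAr !ipZl; congr (_ * _); rewrite ipX mcoeffZ mcoeff_dv /pv.
case: (pidxP b) => [[i -> ->]|hb]; last first.
  have -> : pidx b = None by apply: pidx_none; apply/pidxP.
  by rewrite mul0r ip0l !mulr0.
by rewrite -mpolyXD addmC ipX zetU -mulr_natr; ring.
Qed.

Definition inj0 f : nat -> Lam := fun k => if k == 0%N then f else 0.
(* [Lterm g a m] is the contribution of [g m * w ^ m] to the coefficient of [w ^ a] in [L g]. *)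
Definition Lterm (g : nat -> Lam) (a m : nat) : Lam :=
  if (m < a)%N then ((a - m)%:R / theta) *: dv (a - m) (g m)
  else if (a < m)%N then pv (m - a) * g m
  else (a%:R * (theta^-1 - 1)) *: g a.
(** The coefficient of [w ^ 0] is dropped: intermediate steps never return to the vacuum, and [Ssum]
    makes the final return. *)
Definition Lop (g : nat -> Lam) (a : nat) : Lam :=
  if a == 0%N then 0 else \sum_(m < n.+1) Lterm g a m.
Definition Ssum (g : nat -> Lam) : Lam := \sum_(m < n.+1) pv m * g m.
(** [Kop 0] is the Euler operator divided by [theta], and [Kop 1] is the second order
    Laplace-Beltrami operator. *)
Definition Kop (j : nat) f : Lam := Ssum (iter j.+1 Lop (inj0 f)).
Definition vB (g h : nat -> Lam) : R := \sum_(a < n.+1) ip (g a) (h a).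

Lemma dv_idx0 f : dv 0 f = 0. Proof. by []. Qed.

Lemma Lop_vB (g h : nat -> Lam) : g 0%N = 0 -> h 0%N = 0 -> vB (Lop g) h = vB g (Lop h).
Proof.
move=> g0 h0; rewrite /vB.
pose E1 a m := if a == 0%N then 0 else ip (Lterm g a m) (h a).
pose E2 a m := if a == 0%N then 0 else ip (g a) (Lterm h a m).
have -> : \sum_(a < n.+1) ip (Lop g a) (h a) = \sum_(a < n.+1) \sum_(m < n.+1) E1 a m.
  apply: eq_bigr => a _; rewrite /Lop /E1; case: eqP => _; first by rewrite ip0l big1.
  by rewrite ip_suml.
have -> : \sum_(a < n.+1) ip (g a) (Lop h a) = \sum_(a < n.+1) \sum_(m < n.+1) E2 a m.
  apply: eq_bigr => a _; rewrite /Lop /E2; case: eqP => _; first by rewrite ip0r big1.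
  by rewrite ip_sumr.
rewrite exchange_big; apply: eq_bigr => a _; apply: eq_bigr => m _; rewrite /E1 /E2 /Lterm.
move: (nat_of_ord a) (nat_of_ord m) => {}a {}m.
case: a => [|a]; case: m => [|m] //=.
- by rewrite g0 dv0 scaler0 ip0l.
- by rewrite h0 dv0 scaler0 ip0r.
rewrite !ltnS; case: (ltngtP a m) => [am|ma|->].
- by rewrite ip_sym -ip_adj ip_sym.
- by rewrite ip_adj.
- by rewrite ipZl ipZr.
Qed.

Lemma Lop_inj0 f a : Lop (inj0 f) a = (a%:R / theta) *: dv a f.
Proof.
rewrite /Lop; case: eqP => [->|/eqP h]; first by rewrite dv_idx0 scaler0.
rewrite big_ord_recl big1 => [|i _]; rewrite /Lterm /inj0 /=.
  by rewrite lt0n h subn0 addr0.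
by rewrite dv0 scaler0 mulr0 (negbTE h) scaler0 !if_same.
Qed.

Lemma iter_Lop_vB j (g h : nat -> Lam) : g 0%N = 0 -> h 0%N = 0 -> vB (iter j Lop g) h = vB g (iter j Lop h).
Proof.
elim: j g => // j IH g g0 h0; rewrite iterSr IH // Lop_vB //.
by case: j {IH} => [|j] //.
Qed.

(** By [ip_adj] the final step [Ssum] is adjoint to the initial step [Lop (inj0 _)], which leaves
    powers of [Lop] between two vectors without vacuum component. *)
Lemma Kop_adj j f g : ip (Kop j f) g = ip f (Kop j g).
Proof.
have E f1 g1 : ip (Kop j f1) g1 = vB (iter j Lop (Lop (inj0 f1))) (Lop (inj0 g1)).
  rewrite /Kop /Ssum ip_suml /vB -iterSr; apply: eq_bigr => m _.
  by rewrite ip_adj Lop_inj0.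
rewrite [RHS]ip_sym !E iter_Lop_vB //; apply: eq_bigr => a _; exact: ip_sym.
Qed.

Lemma homv_Lop (g : nat -> Lam) : homv g -> homv (Lop g).
Proof.
move=> hg a mo h; rewrite /Lop; case: eqP => [_|a0]; first by rewrite mcoeff0.
rewrite raddf_sum big1 //= => m _; rewrite /Lterm.
case: (ltngtP m a) => [am|ma|E].
- rewrite mcoeffZ mcoeff_dv; case: (pidxP (a - m)%N) => [[i Ei ->]|hb].
    by rewrite hg ?mul0rn ?mulr0 // mnmwgtD mnmwgt1; lia.
  by rewrite (_ : pidx _ = None) ?mulr0 //; apply: pidx_none; apply/pidxP.
- rewrite mcoeff_pvM; case: (pidxP (m - a)%N) => [[i Ei ->]|hb].
    case: eqP => // /eqP mi; rewrite hg //.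
    have : mnmwgt mo = (mnmwgt (mo - U_(i)) + i.+1)%N.
      by rewrite -{1}(submK (_ : (U_(i) <= mo)%MM)) ?lep1mP // mnmwgtD mnmwgt1.
    by lia.
  by rewrite (_ : pidx _ = None) //; apply: pidx_none; apply/pidxP.
- by rewrite mcoeffZ hg ?mulr0 //; lia.
Qed.

Lemma homv_inj0 f : hom f -> homv (inj0 f).
Proof.
move=> hf k m hk; rewrite /inj0; case: eqP hk => [->|_] hk; last by rewrite mcoeff0.
exact: hf.
Qed.

Lemma homv_iter_Lop j (g : nat -> Lam) : homv g -> homv (iter j Lop g).
Proof. by move=> hg; elim: j => //= j; exact: homv_Lop. Qed.

Lemma hom_Ssum (g : nat -> Lam) : homv g -> hom (Ssum g).
Proof.
move=> hg mo h; rewrite /Ssum raddf_sum big1 //= => m _.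
rewrite mcoeff_pvM; case: (pidxP m) => [[i Ei ->]|hb].
  case: eqP => // /eqP mi; rewrite hg //.
  have : mnmwgt mo = (mnmwgt (mo - U_(i)) + i.+1)%N.
    by rewrite -{1}(submK (_ : (U_(i) <= mo)%MM)) ?lep1mP // mnmwgtD mnmwgt1.
  by lia.
by rewrite (_ : pidx _ = None) //; apply: pidx_none; apply/pidxP.
Qed.

Lemma hom_Kop j f : hom f -> hom (Kop j f).
Proof. by move=> hf; apply/hom_Ssum/homv_iter_Lop/homv_inj0. Qed.

End PowerSums.

(** * Operators in the underlying variables *)

Section XVariables.
Variables (R : realFieldType) (n M : nat) (theta : R).
Hypothesis theta_gt0 : 0 < theta.
Notation Lam := {mpoly R[n]}.
Notation XX := {mpoly R[M]}.
Implicit Types f : Lam.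
Implicit Types g : nat -> Lam.

Definition psx (b : nat) : XX := \sum_(j < M) 'X_j ^+ b.
(** The number [M] of variables is independent of [n]: triangularity is used with [M = n],
    positivity at [1^N] with [M = N]. *)
Definition ppi (f : Lam) : XX := f \mPo [tuple psx i.+1 | i < n].

Lemma ppiD f f' : ppi (f + f') = ppi f + ppi f'. Proof. exact: comp_mpolyD. Qed.
Lemma ppi0 : ppi 0 = 0. Proof. exact: comp_mpoly0. Qed.
Lemma ppiZ c f : ppi (c *: f) = c *: ppi f. Proof. exact: comp_mpolyZ. Qed.
Lemma ppiC c : ppi c%:MP = c%:MP. Proof. exact: comp_mpolyC. Qed.
Lemma ppiM f f' : ppi (f * f') = ppi f * ppi f'. Proof. exact: rmorphM. Qed.
Lemma ppiX (i : 'I_n) : ppi 'X_i = psx i.+1.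
Proof. by rewrite /ppi comp_mpolyXU -tnth_nth tnth_mktuple. Qed.
Lemma ppi_sum I r (P : pred I) (F : I -> Lam) :
  ppi (\sum_(i <- r | P i) F i) = \sum_(i <- r | P i) ppi (F i).
Proof. by apply: (big_morph ppi); [exact: ppiD | exact: ppi0]. Qed.
Lemma ppi_pv b : (0 < b <= n)%N -> ppi (pv R n b) = psx b.
Proof. by case/pidxP => i -> _; rewrite pv_ord ppiX. Qed.

Lemma msym_Xj (s : 'S_M) j : msym s ('X_j : XX) = 'X_(s j).
Proof.
rewrite msymX; congr ('X_[_]); apply/mnmP => l; rewrite mnmE !mnm1E.
by rewrite -(inj_eq (@perm_inj _ s)) permKV.
Qed.

Lemma msym_psx s b : msym s (psx b) = psx b.
Proof.
rewrite /psx raddf_sum [RHS](reindex_inj (@perm_inj _ s)) /=.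
by apply: eq_bigr => j _; rewrite rmorphXn /= msym_Xj.
Qed.

Lemma msym_ppi s f : msym s (ppi f) = ppi f.
Proof.
elim/mpoly_gen_ind: f => [c|f f' IH IH'|i f IH].
- by rewrite ppiC -alg_mpolyC msymZ msym1.
- by rewrite ppiD msymD IH IH'.
- by rewrite ppiM msymM IH ppiX msym_psx.
Qed.

Lemma ppi_chain (j : 'I_M) f :
  'X_j * (ppi f)^`M(j) = \sum_(b < n.+1) b%:R *: ('X_j ^+ b * ppi (dv b f)).
Proof.
elim/mpoly_gen_ind: f => [c|f f' IH IH'|i f IH].
- rewrite ppiC mderivC mulr0 big1 // => b _; by rewrite dvC ppi0 mulr0 scaler0.
- rewrite ppiD mderivD mulrDr IH IH' -big_split /=; apply: eq_bigr => b _.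
  by rewrite dvD ppiD mulrDr scalerDr.
- have dps : 'X_j * (psx i.+1)^`M(j) = i.+1%:R *: 'X_j ^+ i.+1.
    rewrite /psx raddf_sum /= (bigD1 j) //= big1 => [|l hl].
      rewrite addr0 mpolyXn mderivX mulmnE mnm1E eqxx mul1n -scalerAr; congr (_ *: _).
      rewrite -mpolyXD.
      by have -> : (U_(j) + (U_(j) *+ i.+1 - U_(j)) = U_(j) *+ i.+1)%MM by rewrite mulmSr addmK addmC.
    by rewrite mpolyXn mderivX mulmnE mnm1E (negbTE hl) scale0r.
  rewrite ppiM ppiX mderivM.
  transitivity ('X_j * (psx i.+1)^`M(j) * ppi f + psx i.+1 * ('X_j * (ppi f)^`M(j))); first by ring.
  rewrite dps IH.
  have -> : i.+1%:R *: 'X_j ^+ i.+1 * ppi f =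
      \sum_(b < n.+1) (if b == i.+1 :> nat then b%:R *: ('X_j ^+ b * ppi f) else 0).
    have hi : (i.+1 < n.+1)%N by rewrite ltnS.
    rewrite (bigD1 (Ordinal hi)) //= eqxx big1 ?addr0 ?scalerAl // => b hb.
    by case: eqP => // E; case/eqP: hb; apply/val_inj.
  rewrite mulr_sumr -big_split /=; apply: eq_bigr => b _.
  rewrite -(pv_ord R i) dvM dv_pv ppiD !ppiM mulrDr scalerDr; congr (_ + _).
    case: eqP => [->|_]; last by rewrite ppi0 mul0r mulr0 scaler0.
    by rewrite /= ltn_ord mulr1n /ppi comp_mpoly1 mul1r.
  by rewrite pv_ord ppiX -scalerAr mulrCA.
Qed.

(** Substitution of [x_i] for the auxiliary variable [w]. *)
Definition GG (i : 'I_M) g : XX := \sum_(m < n.+1) ppi (g m) * 'X_i ^+ m.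
(* [DD i k g] is [x_i * (GG i g - GG k g) / (x_i - x_k)], written without division. *)
Definition DD (i k : 'I_M) g : XX :=
  \sum_(m < n.+1) ppi (g m) * \sum_(a < m) 'X_i ^+ a.+1 * 'X_k ^+ (m - a.+1).

Lemma GG_inj0 i f :
  GG i (Lop theta (inj0 f)) = theta^-1 *: ('X_i * (ppi f)^`M(i)).
Proof.
rewrite ppi_chain scaler_sumr; apply: eq_bigr => m _.
by rewrite Lop_inj0 ppiZ scalerA mulrC -scalerAr [_ / theta]mulrC.
Qed.

Lemma ppi_Ssum g : g 0%N = 0 -> ppi (Ssum g) = \sum_(i < M) GG i g.
Proof.
move=> g0; rewrite exchange_big /= ppi_sum; apply: eq_bigr => m _; rewrite -mulr_sumr ppiM.
case: (posnP m) => [->|hm]; first by rewrite g0 ppi0 mulr0 mul0r.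
have hmn : (0 < m <= n)%N by rewrite hm -ltnS /=.
by rewrite (ppi_pv hmn) mulrC.
Qed.

(** For a single power [w ^ m]: the terms of [L] raising the power assemble into [x_i d/dx_i] by the
    chain rule, those lowering it into divided differences, through [p_(m-a) = sum_k x_k^(m-a)]. *)
Lemma GG_Lop_term i g m : homv g -> (0 < m <= n)%N ->
  \sum_(0 <= a < n.+1) (if a == 0%N then 0 else ppi (Lterm theta g a m) * 'X_i ^+ a) =
  theta^-1 *: ('X_i * (ppi (g m) * 'X_i ^+ m)^`M(i))
    + \sum_(k < M | k != i) ppi (g m) * \sum_(a < m) 'X_i ^+ a.+1 * 'X_k ^+ (m - a.+1)
    - M%:R *: (ppi (g m) * 'X_i ^+ m).
Proof.
move=> hg /andP[hm hmn]; set h := ppi (g m).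
rewrite (big_cat_nat (n := m)) //=; last by lia.
rewrite (big_ltn (m := m)); last by lia.
have -> : \sum_(m.+1 <= a < n.+1)
    (if a == 0%N then 0 else ppi (Lterm theta g a m) * 'X_i ^+ a) =
    theta^-1 *: ('X_i * h^`M(i)) * 'X_i ^+ m.
  rewrite ppi_chain -(big_mkord xpredT (fun b => b%:R *: ('X_i ^+ b * ppi (dv b (g m))))).
  (* By weight, [g m] does not involve power sums of index above [n - m], so cutting the powers of
     [w] at [n] loses nothing. *)
  have Z : \sum_(n.+1 - m <= b < n.+1) b%:R *: ('X_i ^+ b * ppi (dv b (g m))) = 0.
    rewrite big_nat_cond big1 // => b /andP[/andP[hb _] _].
    suff -> : dv b (g m) = 0 by rewrite ppi0 mulr0 scaler0.
    apply/mpolyP => mo; rewrite mcoeff_dv mcoeff0; case: (pidxP n b) => [[j Ej ->]|hp].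
      by rewrite hg ?mul0rn // mnmwgtD mnmwgt1; lia.
    by rewrite (_ : pidx _ _ = None) //; apply: pidx_none; apply/pidxP.
  rewrite [X in _ = _ *: X * _](big_cat_nat (n := (n.+1 - m)%N)) //=; last by lia.
  rewrite Z addr0.
  rewrite [X in _ = _ *: X * _](big_ltn (m := 0%N)) ?scale0r ?add0r; last by lia.
  rewrite scaler_sumr mulr_suml -[m.+1]add1n big_addn.
  rewrite !big_nat; apply: eq_bigr => b hb; have -> : (b + m == 0)%N = false by lia.
  have hlt : (m < b + m)%N by lia.
  rewrite /Lterm hlt addnK ppiZ -!scalerAl scalerA [theta^-1 * _]mulrC exprD; congr (_ *: _); ring.
have -> : \sum_(0 <= a < m)
    (if a == 0%N then 0 else ppi (Lterm theta g a m) * 'X_i ^+ a) =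
    \sum_(1 <= a < m) psx (m - a) * h * 'X_i ^+ a.
  rewrite (big_ltn (m := 0%N)) // add0r !big_nat; apply: eq_bigr => a ha.
  have -> : (a == 0)%N = false by lia.
  rewrite /Lterm; have -> : (m < a)%N = false by lia.
  have -> : (a < m)%N by lia.
  by rewrite ppiM ppi_pv //; lia.
have -> : (m == 0)%N = false by lia.
rewrite {1}/Lterm ltnn ppiZ -/h.
have -> : \sum_(1 <= a < m) psx (m - a) * h * 'X_i ^+ a =
   (m.-1)%:R *: (h * 'X_i ^+ m) +
   \sum_(k < M | k != i) h * \sum_(1 <= a < m) 'X_i ^+ a * 'X_k ^+ (m - a).
  have -> : (m.-1)%:R *: (h * 'X_i ^+ m) = \sum_(1 <= a < m) h * 'X_i ^+ m.
    by rewrite sumr_const_nat subn1 scaler_nat.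
  under [X in _ + X]eq_bigr do rewrite mulr_sumr.
  rewrite exchange_big -big_split /= !big_nat; apply: eq_bigr => a ha.
  rewrite /psx (bigD1 i) //= !mulrDl; congr (_ + _).
    rewrite mulrAC mulrC -exprD; congr (_ * 'X_i ^+ _); lia.
  by rewrite !mulr_suml; apply: eq_bigr => k _; ring.
(* Each divided difference has one further monomial [x_i^m]. These [M - 1] copies, the [m - 1]
   copies from [k = i] and the diagonal [- m] produce the constant [- M]. *)
have EDD : \sum_(k < M | k != i) h * \sum_(a < m) 'X_i ^+ a.+1 * 'X_k ^+ (m - a.+1) =
   \sum_(k < M | k != i) h * \sum_(1 <= a < m) 'X_i ^+ a * 'X_k ^+ (m - a) +
   M.-1%:R *: (h * 'X_i ^+ m).
  have -> : M.-1%:R *: (h * 'X_i ^+ m) = \sum_(k < M | k != i) h * 'X_i ^+ m.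
    by rewrite sumr_const cardC1 card_ord scaler_nat.
  rewrite -big_split /=; apply: eq_bigr => k _; rewrite -mulrDr; congr (_ * _).
  rewrite -(big_mkord xpredT (fun a => 'X_i ^+ a.+1 * 'X_k ^+ (m - a.+1))).
  rewrite -(big_add1 _ _ 0 m.+1 xpredT (fun a => 'X_i ^+ a * 'X_k ^+ (m - a))) /=.
  by rewrite big_nat_recr //= subnn expr0 mulr1.
rewrite EDD.
have dX : 'X_i * ('X_i ^+ m)^`M(i) = m%:R *: ('X_i ^+ m : XX).
  rewrite mpolyXn mderivX mulmnE mnm1E eqxx mul1n -scalerAr -mpolyXD.
  by rewrite -{2}(prednK hm) mulmSr addmK addmC -mulmSr prednK.
have -> : 'X_i * (h * 'X_i ^+ m)^`M(i) = 'X_i * h^`M(i) * 'X_i ^+ m + m%:R *: (h * 'X_i ^+ m).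
  by rewrite mderivM scalerAr -dX; ring.
have Mi : (0 < M)%N by exact: leq_ltn_trans (leq0n i) (ltn_ord i).
have -> : M%:R = M.-1%:R + 1 :> R by rewrite natr1 prednK.
have -> : m%:R = m.-1%:R + 1 :> R by rewrite natr1 prednK.
rewrite -!mul_mpolyC !mpolyCM !mpolyCB !mpolyCD !mpolyC1.
ring.
Qed.

(** At [w = x_i] the Lax operator becomes the Dunkl-type operator [theta^-1 x_i d_i + sum_k x_i (1 -
    s_ik) / (x_i - x_k) - M], because the transposition [s_ik] sends [GG i g] to [GG k g]. *)
Lemma GG_Lop i g : homv g -> g 0%N = 0 ->
  GG i (Lop theta g) = theta^-1 *: ('X_i * (GG i g)^`M(i))
    + \sum_(k < M | k != i) DD i k g - M%:R *: GG i g.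
Proof.
move=> hg g0.
have E1 : GG i (Lop theta g) = \sum_(m < n.+1) \sum_(0 <= a < n.+1)
    (if a == 0%N :> nat then 0 else ppi (Lterm theta g a m) * 'X_i ^+ a).
  under eq_bigr do rewrite big_mkord.
  rewrite exchange_big /=; apply: eq_bigr => a _; rewrite /Lop; case: eqP => _.
    by rewrite ppi0 mul0r big1.
  by rewrite ppi_sum mulr_suml.
rewrite E1 /GG raddf_sum /= mulr_sumr scaler_sumr /DD [\sum_(k < M | k != i) _]exchange_big /= scaler_sumr.
rewrite -big_split -sumrB /=; apply: eq_bigr => m _.
case: (posnP m) => [->|hm]; last by rewrite GG_Lop_term // hm -ltnS /=.
rewrite g0 ppi0 !mul0r mderiv0 mulr0 !scaler0 subr0 [X in _ = _ + X]big1 ?addr0 => [|k _]; last by rewrite mul0r.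
rewrite big1 // => a _; case: eqP => // a0; rewrite /Lterm lt0n; case: eqP => // _.
by rewrite g0 dv0 scaler0 ppi0 mul0r.
Qed.
End XVariables.

(** * Coefficients of divided differences *)

Section Antisymmetrization.
Variables (R : realFieldType) (C : nat -> nat -> R).
Definition asum (a b : nat) (k : nat) : R := \sum_(j < k) (C (a + b - j) j - C j (a + b - j)).

Lemma asum_step a b : asum a b.+1 a - (C a b.+1 - C b.+1 a) = asum a.+1 b a.+1.
Proof.
rewrite /asum big_ord_recr /= !addSn addnS subSn ?leq_addr //.
rewrite addKn opprB; congr (_ + _).
Qed.

(** From [b + 1] on the summands cancel in pairs under [j -> a + b - j]. The surviving pairs of
    exponents [(a + b - j, j)] are at least as spread out as [(a, b)], which is the source of
    triangularity. *)
Lemma asum_min a b : asum a b a = asum a b (minn a b.+1).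
Proof.
rewrite /asum; case: (leqP a b.+1) => // h; set F := fun j => C (a + b - j)%N j - C j (a + b - j)%N.
rewrite -!(big_mkord xpredT F) (big_cat_nat (n := b.+1)) ?(ltnW h) //=.
suff E : \sum_(b.+1 <= j < a) F j = - \sum_(b.+1 <= j < a) F j.
  have : (\sum_(b.+1 <= j < a) F j) *+ 2 = 0 by rewrite mulr2n {1}E addNr.
  by move/eqP; rewrite mulrn_eq0 /= => /eqP ->; rewrite addr0.
rewrite {1}big_nat_rev -sumrN !big_nat; apply: eq_bigr => j hj; rewrite /F opprB.
have -> : (b.+1 + a - j.+1)%N = (a + b - j)%N by lia.
by have -> : (a + b - (a + b - j))%N = j by lia.
Qed.
End Antisymmetrization.

Section Exchange.
Variables (R : realFieldType) (n M : nat) (theta : R).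
Hypothesis theta_gt0 : 0 < theta.
Notation Lam := {mpoly R[n]}.
Notation XX := {mpoly R[M]}.
Implicit Types g : nat -> Lam.

Definition mex (eta : 'X_{1..M}) (i k : 'I_M) (u v : nat) : 'X_{1..M} :=
  [multinom if l == i then u else if l == k then v else eta l | l < M].

Lemma mcoeffXiM (i : 'I_M) (P : XX) m :
  ('X_i * P)@_m = if m i == 0%N then 0 else P@_(m - U_(i)).
Proof. by have := mcoeff_pvM i.+1 P m; rewrite pv_ord pidx_ord. Qed.

Lemma mcoeff_Xderiv (i : 'I_M) (P : XX) m : ('X_i * P^`M(i))@_m = (m i)%:R * P@_m.
Proof.
rewrite mcoeffXiM; case: eqP => [->|/eqP h]; first by rewrite mul0r.
rewrite mcoeff_deriv submK ?lep1mP // mnmBE mnm1E eqxx subn1 prednK ?lt0n //.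
by rewrite mulr_natl.
Qed.

Variables (eta : 'X_{1..M}) (i k : 'I_M).
Hypothesis ik : i != k.
Local Notation co P a b := (P : XX)@_(mex eta i k a b).

Lemma mexi a b : mex eta i k a b i = a. Proof. by rewrite mnmE eqxx. Qed.
Lemma mexk a b : mex eta i k a b k = b. Proof. by rewrite mnmE eq_sym (negbTE ik) eqxx. Qed.
Lemma mex_id : mex eta i k (eta i) (eta k) = eta.
Proof. by apply/mnmP => l; rewrite mnmE; case: eqP => [->//|_]; case: eqP => [->|]. Qed.

Lemma co_Xi P a b : co ('X_i * P) a b = if a is a'.+1 then co P a' b else 0.
Proof.
rewrite mcoeffXiM mexi; case: a => [|a] //=; congr (P@_ _).
apply/mnmP => l; rewrite mnmBE !mnmE [i == l]eq_sym; case: eqP => _; rewrite ?subn1 ?subn0 //.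
Qed.
Lemma co_Xk P a b : co ('X_k * P) a b = if b is b'.+1 then co P a b' else 0.
Proof.
rewrite mcoeffXiM mexk; case: b => [|b] //=; congr (P@_ _).
apply/mnmP => l; rewrite mnmBE !mnmE [k == l]eq_sym; case: (eqVneq l i) => [->|_].
  by rewrite (negbTE ik) subn0.
by case: eqP => _; rewrite ?subn1 ?subn0.
Qed.

Lemma DD_mul g : ('X_i - 'X_k) * DD i k g = 'X_i * (GG i g - GG k g) :> XX.
Proof.
rewrite /DD /GG -sumrB !mulr_sumr; apply: eq_bigr => m _.
rewrite -mulrBr; have -> : 'X_i ^+ m - 'X_k ^+ m =
    ('X_i - 'X_k) * \sum_(a < m) 'X_i ^+ a * 'X_k ^+ (m - a.+1) :> XX.
  rewrite subrXX (reindex_inj rev_ord_inj) /=; congr (_ * _); apply: eq_bigr => a _.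
  congr (_ ^+ _ * _ ^+ _); have := ltn_ord a; lia.
have -> : \sum_(a < m) 'X_i ^+ a.+1 * 'X_k ^+ (m - a.+1) =
    'X_i * \sum_(a < m) 'X_i ^+ a * 'X_k ^+ (m - a.+1) :> XX.
  by rewrite mulr_sumr; apply: eq_bigr => a _; rewrite exprS mulrA.
ring.
Qed.

Lemma GG_sym g : GG k g = msym (tperm i k) (GG i g) :> XX.
Proof.
rewrite /GG raddf_sum /=; apply: eq_bigr => m _.
by rewrite msymM msym_ppi rmorphXn /= msym_Xj tpermL.
Qed.

Lemma co_GGk g a b : co (GG k g) a b = co (GG i g) b a.
Proof.
rewrite GG_sym mcoeff_sym; congr (_@_ _); apply/mnmP => l; rewrite !mnmE.
case: (eqVneq l i) => [->|li].
  by rewrite tpermL eq_sym (negbTE ik) eqxx.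
case: (eqVneq l k) => [->|lk]; first by rewrite tpermR eqxx.
have -> : tperm i k l = l by rewrite tpermD // eq_sym.
by rewrite (negbTE li) (negbTE lk).
Qed.

(** Comparing coefficients in [(x_i - x_k) DD = x_i (GG_i - GG_k)] gives a recursion in [a], and
    [asum_step] is the same recursion. *)
Lemma DD_coef g a b :
  co (DD i k g) a b = asum (fun u v => co (GG i g) u v) a b a.
Proof.
elim: a b => [|a IH] b.
  rewrite /asum big_ord0; have -> : DD i k g = 'X_i * (\sum_(m < n.+1) ppi M (g m) *
      \sum_(a < m) 'X_i ^+ a * 'X_k ^+ (m - a.+1)) :> XX.
    rewrite mulr_sumr; apply: eq_bigr => m _; rewrite mulrCA; congr (_ * _).
    by rewrite mulr_sumr; apply: eq_bigr => a _; rewrite exprS mulrA.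
  by rewrite co_Xi.
have := congr1 (fun P : XX => co P a.+1 b.+1) (DD_mul g).
rewrite mulrBl mcoeffB co_Xi co_Xk co_Xi mcoeffB co_GGk IH => H.
by rewrite -asum_step -H opprB addrC subrK.
Qed.

Lemma DD_coef_min g : (DD i k g : XX)@_eta =
  asum (fun u v => co (GG i g) u v) (eta i) (eta k) (minn (eta i) (eta k).+1).
Proof.
have -> : (DD i k g : XX)@_eta = co (DD i k g) (eta i) (eta k) by rewrite mex_id.
by rewrite DD_coef asum_min.
Qed.

End Exchange.

(** * Dominance order on unsorted exponent vectors *)

Section Dominance.
Variable M : nat.
Implicit Types (la eta : 'X_{1..M}).

(** Hinge sums: for vectors of equal degree, dominance of the decreasing rearrangements is the
    inequality of these sums for all [t], which avoids sorting. *)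
Definition trsum (t : nat) eta : nat := \sum_(i < M) (eta i - t)%N.
Definition adom la eta := mdeg eta = mdeg la /\ forall t, (trsum t eta <= trsum t la)%N.
Definition sqs eta : nat := \sum_(i < M) (eta i * eta i)%N.

Section Mex.
Variables (eta : 'X_{1..M}) (i k : 'I_M).
Hypothesis ik : i != k.

Lemma sum_mex (G : nat -> nat) u v :
  (\sum_(l < M) G (mex eta i k u v l) = G u + (G v + \sum_(l < M | (l != i) && (l != k)) G (eta l)))%N.
Proof.
rewrite (bigD1 i) //= mexi (bigD1 k) 1?eq_sym //= mexk //; congr (_ + (_ + _))%N.
by apply: eq_bigr => l /andP[li lk]; rewrite mnmE (negbTE li) (negbTE lk).
Qed.
Lemma sum_mex0 (G : nat -> nat) :
  (\sum_(l < M) G (eta l) = G (eta i) + (G (eta k) + \sum_(l < M | (l != i) && (l != k)) G (eta l)))%N.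
Proof. by rewrite -sum_mex mex_id. Qed.

Lemma mdeg_mex u v : (u + v = eta i + eta k)%N -> mdeg (mex eta i k u v) = mdeg eta.
Proof.
move=> h; rewrite !mdegE (sum_mex (fun x => x)) (sum_mex0 (fun x => x)) /=.
by rewrite !addnA h.
Qed.

Lemma adom_mex la u v : (u + v = eta i + eta k)%N -> (v <= eta i)%N -> (v <= eta k)%N ->
  adom la (mex eta i k u v) -> adom la eta.
Proof.
move=> h hi hk [hd ht]; split; first by rewrite -hd mdeg_mex.
move=> t; apply: leq_trans (ht t).
rewrite /trsum (sum_mex (fun x => x - t)%N) (sum_mex0 (fun x => x - t)%N).
by rewrite !addnA leq_add2r; lia.
Qed.

Lemma sqs_mex u v : (u + v = eta i + eta k)%N -> (v < eta i)%N -> (v < eta k)%N ->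
  (sqs eta < sqs (mex eta i k u v))%N.
Proof.
move=> h hi hk.
rewrite /sqs (sum_mex (fun x => x * x)%N) (sum_mex0 (fun x => x * x)%N).
rewrite !addnA ltn_add2r; nia.
Qed.

Lemma mex_sym u v : mex eta k i v u = mex eta i k u v.
Proof.
apply/mnmP => l; rewrite !mnmE; case: (eqVneq l i) => [->|] //.
by rewrite (negbTE ik).
Qed.
End Mex.

(** From [x^2 + x = 2 * sum_t max(x - t, 0)]. It makes the sum of squares strictly monotone for
    dominance, up to permutation, hence a measure for inductions. *)
Lemma sq_trsum eta B : (forall i, eta i <= B)%N ->
  (sqs eta + mdeg eta = (\sum_(t < B) trsum t eta).*2)%N.
Proof.
move=> hB; rewrite /sqs mdegE -big_split /= /trsum exchange_big /= -muln2 big_distrl /=.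
apply: eq_bigr => i _; move: (hB i); move: (eta i : nat) => x hx.
have -> : (\sum_(t < B) (x - t) = \sum_(t < x) (x - t))%N.
  rewrite (big_ord_widen B (fun t => x - t)%N hx) [LHS](bigID (fun t : 'I_B => t < x)%N) /=.
  rewrite [X in (_ + X)%N]big1 ?addn0 // => t; rewrite -leqNgt; lia.
elim: x {hx} => [|x IH]; first by rewrite big_ord0.
rewrite big_ord_recl subn0 (eq_bigr (fun t : 'I_x => x - t)%N) => [|t _]; last by rewrite lift0 subSS.
by move: IH; set S := \sum_(_ < x) _; nia.
Qed.

Lemma adom_sqs la eta : adom la eta -> (sqs eta <= sqs la)%N.
Proof.
case=> hd ht; pose B := (\max_i maxn (eta i) (la i))%N.
have hB i : (maxn (eta i) (la i) <= B)%N by exact: (leq_bigmax i).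
have := @sq_trsum eta B (fun i => leq_trans (leq_maxl _ _) (hB i)).
have := @sq_trsum la B (fun i => leq_trans (leq_maxr _ _) (hB i)).
rewrite hd -!mul2n.
have : (\sum_(t < B) trsum t eta <= \sum_(t < B) trsum t la)%N by apply: leq_sum => t _; exact: ht.
lia.
Qed.

Lemma adom_sqs_eq la eta : adom la eta -> (sqs la <= sqs eta)%N ->
  forall t, trsum t eta = trsum t la.
Proof.
move=> [hd ht] hs t; pose B := (t.+1 + \max_i maxn (eta i) (la i))%N.
have hB i : (maxn (eta i) (la i) <= B)%N.
  have := @leq_bigmax _ (fun i => maxn (eta i) (la i)) i; rewrite /B /=; lia.
have := @sq_trsum eta B (fun i => leq_trans (leq_maxl _ _) (hB i)).
have := @sq_trsum la B (fun i => leq_trans (leq_maxr _ _) (hB i)).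
have htB : (t < B)%N by rewrite /B addSn ltnS leq_addr.
have D nu : (\sum_(i < B) trsum i nu = trsum t nu + \sum_(i < B | i != Ordinal htB) trsum i nu)%N.
  by rewrite (bigD1 (Ordinal htB)).
rewrite hd -!mul2n !D.
have : (\sum_(i < B | i != Ordinal htB) trsum i eta <= \sum_(i < B | i != Ordinal htB) trsum i la)%N.
  by apply: leq_sum => j _; exact: ht.
have := ht t; lia.
Qed.

(** Consecutive hinge sums differ by the number of entries exceeding [t], and these counts determine
    the multiset of entries. *)
Lemma trsum_perm la eta : (forall t, trsum t eta = trsum t la) ->
  mdeg eta = mdeg la -> exists s : 'S_M, eta = [multinom la (s i) | i < M].
Proof.
move=> ht hd.
pose cg (t : nat) (nu : 'X_{1..M}) := (\sum_(i < M) (t < nu i))%N.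
have cnt (nu : 'X_{1..M}) t : (trsum t nu = trsum t.+1 nu + cg t nu)%N.
  by rewrite /trsum -big_split /=; apply: eq_bigr => i _; case: ltnP; lia.
have cntE t : cg t eta = cg t la.
  have := cnt eta t; have := cnt la t; rewrite !ht; lia.
have cnt2 (nu : 'X_{1..M}) t : (count_mem t (val nu) + cg t nu =
    if t is t'.+1 then cg t' nu else M)%N.
  have -> : count_mem t (val nu) = (\sum_(i < M) (nu i == t))%N.
    rewrite -sum1_count /= -{1}(mnm_valK (val nu)) /= big_mkcond /= big_tuple.
    by apply: eq_bigr => i _; rewrite mnm_tnth; case: eqP.
  rewrite -big_split /=; case: t => [|t].
    by rewrite (eq_bigr (fun=> 1%N)) ?sum1_card ?card_ord // => i _; lia.
  by apply: eq_bigr => i _; lia.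
have : perm_eq (val eta) (val la).
  suff H : forall t, count_mem t (val eta) = count_mem t (val la).
    by apply/allP => t _ /=; apply/eqP; exact: H.
  move=> t; have := cnt2 eta t; have := cnt2 la t.
  rewrite cntE; case: t => [|t]; rewrite ?cntE => E1 E2; apply: (@addIn (cg _ la)); exact: etrans E2 (esym E1).
case/tuple_permP => s E; exists s; apply/mnmP => i; rewrite mnmE !mnm_tnth.
by rewrite (val_inj E : val eta = _) tnth_mktuple.
Qed.

Definition pairdiff eta : nat := \sum_(i < M) \sum_(k < M) (eta i - eta k)%N.

(** The two slots are replaced in turn: for fixed [k] the sum over [i] is a hinge sum, and for fixed
    [i] the sum over [k] is one up to terms that depend only on the degree and on [la i]. *)
Lemma adom_pairdiff la eta : adom la eta -> (pairdiff eta <= pairdiff la)%N.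
Proof.
move=> [hd ht].
have C (nu : 'X_{1..M}) t : (\sum_(k < M) (t - nu k) + mdeg nu = trsum t nu + M * t)%N.
  have -> : (M * t = \sum_(k < M) t)%N by rewrite sum_nat_const card_ord.
  rewrite mdegE /trsum -!big_split /=.
  by apply: eq_bigr => k _; lia.
apply: (@leq_trans (\sum_(i < M) \sum_(k < M) (la i - eta k))%N).
  rewrite /pairdiff exchange_big [X in (_ <= X)%N]exchange_big /=.
  by apply: leq_sum => k _; exact: ht.
apply: leq_sum => i _; have := C eta (la i); have := C la (la i); have := ht (la i); lia.
Qed.

End Dominance.

(** * Triangularity, eigenvalues and positivity *)

Section Triangular.
Variables (R : realFieldType) (n M : nat) (theta : R).
Hypothesis theta_gt0 : 0 < theta.
Notation Lam := {mpoly R[n]}.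
Notation XX := {mpoly R[M]}.
Implicit Types (f : Lam) (g : nat -> Lam) (la eta : 'X_{1..M}).

Definition tri la (P : XX) := forall eta, P@_eta != 0 -> adom la eta.

(** The Dunkl-type operator acting on the leading coefficients, one for each choice of the
    distinguished variable [x_i]. *)
Definition Lmat la (v : 'I_M -> R) (i : 'I_M) : R :=
  ((la i)%:R / theta - M%:R) * v i + \sum_(k < M | (la k < la i)%N) (v i - v k).
Definition kap (j : nat) la : R :=
  \sum_(i < M) iter j (Lmat la) (fun i => (la i)%:R / theta) i.

Lemma coef_GG_Lop eta i g : homv g -> g 0%N = 0 ->
  (GG i (Lop theta g) : XX)@_eta = ((eta i)%:R / theta - M%:R) * (GG i g : XX)@_eta
   + \sum_(k < M | k != i) asum (fun u v => (GG i g : XX)@_(mex eta i k u v))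
         (eta i) (eta k) (minn (eta i) (eta k).+1).
Proof.
move=> hg g0; rewrite (GG_Lop theta_gt0) // mcoeffB mcoeffD !mcoeffZ mcoeff_Xderiv.
have -> : (\sum_(k < M | k != i) DD i k g : XX)@_eta =
    \sum_(k < M | k != i) (DD i k g : XX)@_eta by rewrite raddf_sum.
rewrite [X in _ = _ + X](eq_bigr (fun k => (DD i k g : XX)@_eta)) => [|k hk].
  by ring.
by rewrite (DD_coef_min (theta := theta)) // eq_sym.
Qed.

Lemma tri_Lop la g i : homv g -> g 0%N = 0 -> tri la (GG i g) -> tri la (GG i (Lop theta g)).
Proof.
move=> hg g0 ht eta; rewrite coef_GG_Lop //; apply: contraNP => nd.
have z (P : XX) nu : tri la P -> ~ adom la nu -> P@_nu = 0.
  by move=> hP hn; apply/eqP; apply: contraPT hn => /hP h /(_ h).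
rewrite (z _ _ ht nd) mulr0 add0r big1 // => k ki; rewrite /asum big1 // => j _.
have hj := ltn_ord j; rewrite leq_min in hj; case/andP: hj => j1 j2.
have ik : i != k by rewrite eq_sym.
have n1 : ~ adom la (mex eta i k (eta i + eta k - j) j).
  by move=> h; apply: nd; apply: (adom_mex ik) h; lia.
have n2 : ~ adom la (mex eta i k j (eta i + eta k - j)).
  move=> h; apply: nd.
  have h' : adom la (mex eta k i (eta i + eta k - j) j) by rewrite mex_sym // eq_sym.
  by apply: adom_mex h' => //; lia.
by rewrite (z _ _ ht n1) (z _ _ ht n2) subrr.
Qed.

Lemma tri_GG0 la f i : tri la (ppi M f) -> tri la (GG i (Lop theta (inj0 f))).
Proof.
move=> ht eta; rewrite GG_inj0 mcoeffZ mcoeff_Xderiv => h; apply: ht.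
by move: h; rewrite !mulf_eq0 !negb_or => /andP[_ /andP[]].
Qed.

Let gj j f := iter j.+1 (Lop theta) (inj0 f).

Lemma tri_GG la f j i : hom f -> tri la (ppi M f) -> tri la (GG i (gj j f)).
Proof.
move=> hf ht; elim: j => [|j IH]; first exact: tri_GG0.
by rewrite /gj iterS; apply: tri_Lop => //; exact/homv_iter_Lop/homv_inj0.
Qed.

Lemma tri_Kop la f j : hom f -> tri la (ppi M f) -> tri la (ppi M (Kop theta j f)).
Proof.
move=> hf ht eta; rewrite ppi_Ssum // raddf_sum /= => h; apply: contrapT => nd; move: h.
rewrite big1 ?eqxx // => i _.
by case: (eqVneq (mcoeff eta (GG i (gj j f))) 0) => // /(tri_GG hf ht).
Qed.

(** Among the monomials feeding into [la], the strictly more spread ones have a larger sum of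
    squares and are excluded by triangularity. Only [la] and its swap of [i] and [k], present when
    [la k < la i], remain. *)
Lemma coef_GG la f j i : hom f -> tri la (ppi M f) ->
  (GG i (gj j f) : XX)@_la = (ppi M f)@_la * iter j (Lmat la) (fun i => (la i)%:R / theta) i.
Proof.
move=> hf ht; elim: j i => [|j IH] i.
  by rewrite /gj /= GG_inj0 mcoeffZ mcoeff_Xderiv; ring.
rewrite /gj iterS coef_GG_Lop //; last exact/homv_iter_Lop/homv_inj0.
rewrite -/(gj j f) iterS {1}/Lmat mulrDr IH mulrCA; congr (_ + _).
rewrite mulr_sumr big_mkcond [RHS]big_mkcond /=; apply: eq_bigr => k _.
case: (eqVneq k i) => [->|ki] /=; first by rewrite ltnn.
have ik : i != k by rewrite eq_sym.
have tG := tri_GG (i := i) hf ht (j := j).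
have z u v : (u + v = la i + la k)%N -> (u < la i)%N && (u < la k)%N || (v < la i)%N && (v < la k)%N ->
    (GG i (gj j f) : XX)@_(mex la i k u v) = 0.
  move=> h h2; apply/eqP; apply: contraT => /tG/adom_sqs; rewrite leqNgt.
  case/orP: h2 => /andP[h3 h4]; last by rewrite (sqs_mex ik).
  rewrite -(mex_sym _ ik) (sqs_mex (i := k) (k := i)) //; lia.
case: ifP => hk; last first.
  rewrite /asum big1 // => l _; have hl := ltn_ord l; rewrite leq_min in hl; case/andP: hl => l1 l2.
  by rewrite !z ?subrr //; lia.
have -> : minn (la i) (la k).+1 = (la k).+1 by apply/minn_idPr.
rewrite /asum big_ord_recr big1 /= ?add0r; last first.
  by move=> l _; have hl := ltn_ord l; rewrite !z ?subrr //; lia.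
rewrite addnK mex_id -(co_GGk la ik) mex_id !IH; ring.
Qed.

Lemma coef_Kop la f j : hom f -> tri la (ppi M f) ->
  (ppi M (Kop theta j f))@_la = kap j la * (ppi M f)@_la.
Proof.
move=> hf ht; rewrite ppi_Ssum // raddf_sum /= /kap mulr_suml; apply: eq_bigr => i _.
by rewrite coef_GG // mulrC.
Qed.

Lemma ppi_perm f eta (s : 'S_M) : (ppi M f)@_[multinom eta (s i) | i < M] = (ppi M f)@_eta.
Proof. by rewrite -mcoeff_sym msym_ppi. Qed.

Lemma coef_mex_swap f eta i k u v : i != k ->
  (ppi M f)@_(mex eta i k u v) = (ppi M f)@_(mex eta i k v u).
Proof.
move=> ik; rewrite -(ppi_perm f _ (tperm i k)); congr (_@_ _); apply/mnmP => l; rewrite !mnmE.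
case: (eqVneq l i) => [->|li].
  by rewrite tpermL eq_sym (negbTE ik) eqxx.
case: (eqVneq l k) => [->|lk]; first by rewrite tpermR eqxx.
have -> : tperm i k l = l by rewrite tpermD // eq_sym.
by rewrite (negbTE li) (negbTE lk).
Qed.

Lemma kap1E la : kap 1 la = (sqs la)%:R / theta ^+ 2 + (pairdiff la)%:R / theta
  - M%:R * (mdeg la)%:R / theta.
Proof.
rewrite /kap /= /Lmat /sqs /pairdiff mdegE !natr_sum mulr_sumr !mulr_suml -big_split -sumrB /=.
apply: eq_bigr => i _; rewrite natr_sum mulr_suml big_mkcond /=.
have -> : \sum_(k < M) (if (la k < la i)%N then (la i)%:R / theta - (la k)%:R / theta else 0) =
    \sum_(k < M) (la i - la k)%:R / theta.
  apply: eq_bigr => k _; case: ltnP => h; first by rewrite natrB ?(ltnW h) // mulrBl.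
  have -> : (la i - la k)%N = 0%N by lia.
  by rewrite mulr0n mul0r.
rewrite natrM; field; exact: lt0r_neq0.
Qed.

(** The off-diagonal weights are nonnegative and refer to strictly more spread monomials; the
    recursion behind [Jack_positive] depends on both facts. *)
Lemma coef_Kop1 eta f : hom f -> (ppi M (Kop theta 1 f))@_eta =
  kap 1 eta * (ppi M f)@_eta + \sum_(i < M) \sum_(k < M | k != i)
   \sum_(j < minn (eta i) (eta k)) (eta i + eta k - j.*2)%:R / theta *
      (ppi M f)@_(mex eta i k (eta i + eta k - j) j).
Proof.
move=> hf; rewrite ppi_Ssum // raddf_sum /= /kap mulr_suml -big_split /=; apply: eq_bigr => i _.
rewrite coef_GG_Lop //; last exact/homv_Lop/homv_inj0.
have E nu : (GG i (Lop theta (inj0 f)) : XX)@_nu = (nu i)%:R / theta * (ppi M f)@_nu.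
  by rewrite GG_inj0 mcoeffZ mcoeff_Xderiv; ring.
rewrite E /Lmat [in RHS]mulrDl -[in RHS]mulrA -[in RHS]addrA; congr (_ + _).
rewrite big_mkcond [X in _ = _ + X]big_mkcond [X in X * _]big_mkcond mulr_suml -big_split /=.
apply: eq_bigr => k _; case: (eqVneq k i) => [->|ki] /=; first by rewrite ltnn mul0r addr0.
have ik : i != k by rewrite eq_sym.
rewrite /asum; set F := fun j : nat => (eta i + eta k - j.*2)%:R / theta *
      (ppi M f)@_(mex eta i k (eta i + eta k - j) j).
have -> : \sum_(j < minn (eta i) (eta k).+1)
    ((GG i (Lop theta (inj0 f)) : XX)@_(mex eta i k (eta i + eta k - j) j) -
     (GG i (Lop theta (inj0 f)) : XX)@_(mex eta i k j (eta i + eta k - j))) =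
    \sum_(j < minn (eta i) (eta k).+1) F j.
  apply: eq_bigr => j _; have hj := ltn_ord j; rewrite leq_min in hj; case/andP: hj => j1 j2.
  rewrite !E !mexi (coef_mex_swap _ _ j) // -mulrBl -mulrBl /F -natrB; last by lia.
  by congr (_%:R / _ * _); lia.
case: ltnP => h.
  have -> : minn (eta i) (eta k).+1 = (eta k).+1 by apply/minn_idPr.
  rewrite big_ord_recr /= addrC; congr (_ + _); rewrite /F addnK mex_id -mulrBl -natrB ?(ltnW h) //.
  by congr (_%:R / _ * _); lia.
have -> : minn (eta i) (eta k).+1 = eta i by apply/minn_idPl; lia.
by rewrite mul0r add0r.
Qed.

(** The eigenvalue equation writes [(kap 1 la - kap 1 eta) c_eta] as a nonnegative combination of
    coefficients with larger sum of squares, and the gap is positive below [la]. It is used for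
    [J_la(1^N) > 0]. *)
Lemma Jack_positive la f : hom f -> tri la (ppi M f) -> (ppi M f)@_la = 1 ->
  Kop theta 1 f = kap 1 la *: f -> forall eta, 0 <= (ppi M f)@_eta.
Proof.
move=> hf ht h1 hK eta.
elim/ltn_ind: {eta}(sqs la - sqs eta)%N {-2}eta (erefl (sqs la - sqs eta)%N) => d IH eta hd.
case: (eqVneq (ppi M f)@_eta 0) => [->//|/ht hdom].
(* Under dominance, equal sums of squares force a permutation of [la], where the coefficient is one
   by symmetry. *)
have [hs|hs] := leqP (sqs la) (sqs eta).
  have [s ->] := trsum_perm (adom_sqs_eq hdom hs) hdom.1.
  by rewrite ppi_perm h1.
have := coef_Kop1 eta hf; rewrite hK ppiZ mcoeffZ.
set S := \sum_(i < M) _ => E.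
have S0 : 0 <= S.
  apply: sumr_ge0 => i _; apply: sumr_ge0 => k ki; apply: sumr_ge0 => j _.
  rewrite mulr_ge0 ?divr_ge0 ?ler0n ?(ltW theta_gt0) //.
  have hj := ltn_ord j; rewrite leq_min in hj; case/andP: hj => j1 j2.
  have hlt : (sqs eta < sqs (mex eta i k (eta i + eta k - j) j))%N.
    by apply: sqs_mex; rewrite 1?eq_sym //; lia.
  apply: (IH (sqs la - sqs (mex eta i k (eta i + eta k - j) j))%N) => //; lia.
have hgap : 0 < kap 1 la - kap 1 eta.
  have th0 : theta != 0 by exact: lt0r_neq0.
  rewrite !kap1E hdom.1; have hp := adom_pairdiff hdom.
  have -> : (sqs la)%:R / theta ^+ 2 + (pairdiff la)%:R / theta - M%:R * (mdeg la)%:R / theta -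
    ((sqs eta)%:R / theta ^+ 2 + (pairdiff eta)%:R / theta - M%:R * (mdeg la)%:R / theta) =
    (sqs la - sqs eta)%:R / theta ^+ 2 + (pairdiff la - pairdiff eta)%:R / theta.
    by rewrite !natrB ?(ltnW hs) //; ring.
  rewrite ltr_wpDr ?divr_ge0 ?ler0n ?(ltW theta_gt0) // divr_gt0 ?exprn_gt0 // ltr0n subn_gt0 //.
by rewrite -(pmulr_rge0 _ hgap) mulrBl E addrC addrA addNr add0r.
Qed.

End Triangular.

(** * Joint eigenvalues *)

Section PowerSumsDetermine.
Variable R : realFieldType.

Lemma psum_poly N (s : nat -> R) (p : {poly R}) :
  \sum_(0 <= i < N) p.[s i] = \sum_(k < size p) p`_k * psum N s k.
Proof.
rewrite /psum; under [RHS]eq_bigr do rewrite mulr_sumr.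
by rewrite exchange_big /=; apply: eq_bigr => i _; rewrite horner_coef.
Qed.

(** The polynomial [q ^+ 2], with [q] vanishing on all [s' j], sums to zero over [s'] and hence over
    [s]. In an ordered field each [q (s i)] then vanishes. *)
Lemma psum_mem N (s s' : nat -> R) : (forall k, psum N s k = psum N s' k) ->
  forall i, (i < N)%N -> exists2 j, (j < N)%N & s i = s' j.
Proof.
move=> h i hi; pose q : {poly R} := \prod_(j < N) ('X - (s' j)%:P).
have E : \sum_(0 <= j < N) (q * q).[s j] = 0.
  rewrite psum_poly; under eq_bigr do rewrite h.
  rewrite -psum_poly big_nat big1 // => j hj.
  by rewrite hornerM horner_prod (bigD1 (Ordinal (hj : (j < N)%N))) //= hornerXsubC subrr !mul0r.
have : (q * q).[s i] = 0.
  apply/eqP; move/eqP: E; rewrite big_mkord psumr_eq0 => [|j _]; last first.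
    by rewrite hornerM -expr2 sqr_ge0.
  by move/allP/(_ (Ordinal hi)); apply; rewrite mem_index_enum.
rewrite hornerM => /eqP; rewrite mulf_eq0 orbb horner_prod prodf_seq_eq0.
case/hasP => j _ /=; rewrite hornerXsubC subr_eq0 => /eqP hj.
by exists j.
Qed.

Lemma psum_decr_inj N (s s' : nat -> R) :
  (forall i j, (i < j)%N -> s j < s i) -> (forall i j, (i < j)%N -> s' j < s' i) ->
  (forall k, psum N s k = psum N s' k) -> forall i, (i < N)%N -> s i = s' i.
Proof.
move=> hs hs' h i hi.
have so (t : nat -> R) : (forall i j, (i < j)%N -> t j < t i) -> sorted >%R [seq t i | i <- iota 0 N].
  move=> ht; rewrite sorted_map; apply: (@sub_sorted _ ltn); last exact: iota_ltn_sorted.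
  by move=> a b /= /ht.
have E : [seq s i | i <- iota 0 N] = [seq s' i | i <- iota 0 N].
  apply: (@irr_sorted_eq _ >%R); [by move=> y x z xy yz; exact: lt_trans yz xy | by move=> x; exact: ltxx | exact: so | exact: so |].
  move=> x; apply/mapP/mapP => -[j]; rewrite mem_iota /= add0n => hj ->.
    by case: (psum_mem h hj) => l hl ->; exists l => //; rewrite mem_iota.
  by case: (psum_mem (fun k => esym (h k)) hj) => l hl ->; exists l => //; rewrite mem_iota.
have := congr1 (fun t => nth 0 t i) E.
by rewrite !(nth_map 0%N) ?size_iota // !nth_iota // add0n.
Qed.

Lemma logder_rec_inj (t v v' : nat -> R) : logder_rec t v -> logder_rec t v' -> v =1 v'.
Proof.
move=> [v0 vS] [v0' vS'] k; elim/ltn_ind: k => -[|k] IH; first by rewrite v0 v0'.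
rewrite vS vS'; congr (_ + _); apply: eq_bigr => i _; rewrite IH //.
by rewrite ltnS leq_subr.
Qed.

Lemma rowE_psum N (s s' : nat -> R) : (forall k, rowE N s k = rowE N s' k) ->
  forall k, psum N s k = psum N s' k.
Proof.
move=> h k; have Er : rowE N s = rowE N s' by apply/funext.
have W := logder_rec_inj (rowE_logder N s).
rewrite Er in W; have {}W := W _ (rowE_logder N s').
elim/ltn_ind: k => k IH; have : psum N s k *+ k.+1 = psum N s' k *+ k.+1.
  rewrite !psum_rec; congr (_ + _); first exact: W.
  apply: eq_bigr => j _; rewrite IH //; have := ltn_ord j; lia.
by move/eqP; rewrite eqrMn2r /= => /eqP.
Qed.

End PowerSumsDetermine.

Section Kappa.
Variables (R : realFieldType) (theta : R).
Hypothesis theta_gt0 : 0 < theta.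
Variable la : nat -> nat.
Hypothesis la_sorted : forall i j, (i <= j)%N -> (la j <= la i)%N.

Definition srow (i : nat) : R := (la i)%:R / theta - i%:R.
Definition kapv (N j : nat) : nat -> R := iter j (rowop N srow) (fun i => (la i)%:R / theta).
Definition kapL (N j : nat) : R := \sum_(0 <= i < N) kapv N j i.

Lemma srow_decr i j : (i < j)%N -> srow j < srow i.
Proof.
move=> ij; rewrite /srow ler_ltB ?ltr_nat // ler_pM2r ?invr_gt0 // ler_nat.
exact/la_sorted/ltnW.
Qed.

Lemma rowop_eq N (v v' : nat -> R) : (forall i, (i < N)%N -> v i = v' i) ->
  forall i, (i < N)%N -> rowop N srow v i = rowop N srow v' i.
Proof.
move=> h i hi; rewrite /rowop h //; congr (_ - _).
by rewrite !big_nat; apply: eq_bigr => j /andP[_ hj]; exact: h.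
Qed.

(** On a partition [la k < la i] may be replaced by [i < k], since ties contribute nothing to a
    vector constant on equal rows. Counting the later rows turns [- N] into [- i - 1]. *)
Lemma rowop_Lmat N (v : nat -> R) (i : 'I_N) :
  (forall a b, (a < N)%N -> (b < N)%N -> la a = la b -> v a = v b) ->
  rowop N srow v i = Lmat theta [multinom la l | l < N] (fun l => v l) i.
Proof.
move=> hv; rewrite /rowop /Lmat mnmE /srow.
have -> : \sum_(k < N | ([multinom la l | l < N] k < la i)%N) (v i - v k) =
   \sum_(i.+1 <= k < N) (v i - v k).
  rewrite big_mkcond (eq_bigr (fun k : 'I_N => if (i < k)%N then v i - v k else 0)).
    rewrite -(big_mkord xpredT (fun k => if (i < k)%N then v i - v k else 0)).
    rewrite (big_cat_nat (n := i.+1)) //= big_nat big1 ?add0r => [|k /andP[_ hk]]; last first.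
      by rewrite ltnS in hk; rewrite ltnNge hk.
    by rewrite !big_nat; apply: eq_bigr => k /andP[-> _].
  move=> k _; rewrite mnmE; case: (ltnP i k) => hik; last by rewrite ltnNge la_sorted.
  case: ltnP => // h2; rewrite (hv i k) ?subrr //; apply/eqP; rewrite eqn_leq h2 la_sorted // ltnW //.
rewrite sumrB sumr_const_nat -[v i *+ _]mulr_natr.
have -> : N%:R = (N - i.+1)%:R + i%:R + 1 :> R.
  by rewrite -natrD natr1; congr (_%:R); have := ltn_ord i; lia.
ring.
Qed.

Lemma kapv_tie N j a b : (a < N)%N -> (b < N)%N -> la a = la b -> kapv N j a = kapv N j b.
Proof.
elim: j a b => [|j IH] a b ha hb E; first by rewrite /kapv /= E.
have S c (hc : (c < N)%N) := @rowop_Lmat N (kapv N j) (Ordinal hc) IH.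
rewrite /kapv /= -/(kapv N j) (S a ha) (S b hb) /Lmat !mnmE /= E (IH a b) //.
Qed.

Lemma kap_kapL N j : kap theta j [multinom la l | l < N] = kapL N j.
Proof.
rewrite /kap /kapL big_mkord; apply: eq_bigr => i _.
elim: j i => [|j IH] i; first by rewrite /kapv /= mnmE.
rewrite iterS /kapv iterS -/(kapv N j) rowop_Lmat; last exact: kapv_tie.
rewrite /Lmat; rewrite IH; congr (_ + _); apply: eq_bigr => k _; by rewrite IH.
Qed.

Lemma kapv_supp N l j i : (forall i, (l <= i)%N -> la i = 0%N) -> (l <= i)%N -> kapv N j i = 0.
Proof.
move=> hl; elim: j i => [|j IH] i hi; first by rewrite /kapv /= hl // mul0r.
rewrite /kapv iterS -/(kapv N j) /rowop IH // mulr0 sub0r big_nat big1 ?oppr0 // => k /andP[hk _].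
by rewrite IH //; apply: leq_trans hi (ltnW hk).
Qed.

Lemma kapv_indep N l j i : (forall i, (l <= i)%N -> la i = 0%N) -> (l <= N)%N -> kapv N j i = kapv l j i.
Proof.
move=> hl hN; elim: j i => [|j IH] i //.
rewrite /kapv !iterS -!/(kapv _ j) /rowop IH; congr (_ - _).
case: (leqP l i.+1) => h.
  rewrite [RHS]big_geq // big_nat big1 // => k /andP[hk _]; apply: (kapv_supp _ _ hl).
  exact: leq_trans h hk.
rewrite (big_cat_nat (n := l)) ?(ltnW h) //= [X in _ + X]big_nat [X in _ + X]big1 ?addr0.
  by apply: eq_bigr => k _; exact: IH.
by move=> k /andP[hk _]; exact: (kapv_supp _ _ hl).
Qed.

Lemma kapL_indep N N' j : (forall i, (N <= i)%N -> la i = 0%N) -> (forall i, (N' <= i)%N -> la i = 0%N) ->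
  kapL N j = kapL N' j.
Proof.
suff H l m : (forall i, (l <= i)%N -> la i = 0%N) -> (l <= m)%N -> kapL m j = kapL l j.
  move=> h h'; case: (leqP N N') => hN; first by rewrite (H N N').
  by rewrite (H N' N) // ltnW.
move=> hl hlm; rewrite /kapL (big_cat_nat (n := l)) //= [X in _ + X]big_nat [X in _ + X]big1 ?addr0.
  by apply: eq_bigr => k _; exact: kapv_indep.
by move=> k /andP[hk _]; exact: (kapv_supp _ _ hl).
Qed.

(** One application of [rowop] to the constant vector gives [la_i / theta - N], which relates the
    two starting vectors. *)
Lemma rowE_rec N k : rowE N srow k.+1 = kapL N k - N%:R * rowE N srow k.
Proof.
have L m : forall i, (i < N)%N -> iter m (rowop N srow) (rowvec N srow 1) i =
    kapv N m i - N%:R * rowvec N srow m i.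
  elim: m => [|m IH] i hi.
    rewrite /rowvec /kapv /= /rowop /srow sumr_const_nat natrB //.
    by rewrite -[i.+1]addn1 natrD; ring.
  rewrite iterS (rowop_eq IH) // /kapv /rowvec !iterS -/(kapv N m) -/(rowvec N srow m) /rowop.
  rewrite sumrB -mulr_sumr; ring.
rewrite /rowE /kapL mulr_sumr -sumrB !big_nat; apply: eq_bigr => i /andP[_ hi].
by rewrite -L // /rowvec -iterSr.
Qed.

Lemma rowE_0 N : rowE N srow 0 = N%:R.
Proof. by rewrite /rowE /rowvec /= sumr_const_nat subn0. Qed.

End Kappa.

(** The eigenvalues determine the power sums of the strictly decreasing sequence [la_i / theta - i],
    hence the partition: the joint spectrum is simple. *)
Lemma kapL_inj (R : realFieldType) (theta : R) N (la mu : nat -> nat) : 0 < theta ->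
  (forall i j, (i <= j)%N -> (la j <= la i)%N) -> (forall i j, (i <= j)%N -> (mu j <= mu i)%N) ->
  (forall j, kapL theta la N j = kapL theta mu N j) -> forall i, (i < N)%N -> la i = mu i.
Proof.
move=> th hla hmu h i hi.
have E : forall k, rowE N (srow theta la) k = rowE N (srow theta mu) k.
  by elim=> [|k IH]; rewrite ?rowE_0 // !rowE_rec h IH.
have := psum_decr_inj (srow_decr th hla) (srow_decr th hmu) (rowE_psum E) hi.
rewrite /srow => /addIr /(mulIf (invr_neq0 (lt0r_neq0 th))) /eqP.
by rewrite eqr_nat => /eqP.
Qed.

(** * Partitions and power sums *)

Section Partitions.
Implicit Types nu mu la : seq nat.

Definition ispart (n : nat) nu := [&& sorted geq nu, all (leq 1) nu & sumn nu == n].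

Lemma ispart_perm_eq n mu nu : ispart n mu -> ispart n nu -> perm_eq mu nu -> mu = nu.
Proof.
case/and3P=> s1 _ _ /and3P[s2 _ _]; apply: (@sorted_eq _ geq).
- by move=> y x z /= xy yz; exact: leq_trans yz xy.
- by move=> x y /= /andP[h1 h2]; apply/eqP; rewrite eqn_leq h1 h2.
- exact: s1.
- exact: s2.
Qed.

Definition mono n nu : 'X_{1..n} := [multinom count_mem i.+1 nu | i < n].

Lemma sumn_count n nu : all (fun b => 0 < b <= n)%N nu ->
  sumn nu = (\sum_(i < n) count_mem i.+1 nu * i.+1)%N.
Proof.
elim: nu => [|b nu IH] /=; first by rewrite big1.
case/andP=> /andP[b0 bn] /IH ->.
under [RHS]eq_bigr do rewrite mulnDl.
rewrite big_split /=; congr (_ + _)%N.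
have hb : (b.-1 < n)%N by lia.
rewrite (bigD1 (Ordinal hb)) //= prednK // eqxx mul1n big1 ?addn0 // => i hi.
case: eqP => [E|_]; last by rewrite mul0n.
by case/eqP: hi; apply/val_inj => /=; lia.
Qed.

Lemma ispart_bound n nu : ispart n nu -> all (fun b => 0 < b <= n)%N nu.
Proof.
case/and3P=> _ /allP h0 /eqP <-; apply/allP => b hb; rewrite h0 //=.
elim: nu hb {h0} => //= a nu IH; rewrite inE => /orP[/eqP ->|/IH]; lia.
Qed.

Lemma mnmwgt_mono n nu : ispart n nu -> mnmwgt (mono n nu) = n.
Proof.
move=> h; rewrite /mnmwgt; under eq_bigr do rewrite mnmE.
by rewrite -sumn_count; [case/and3P: h => _ _ /eqP | exact: ispart_bound].
Qed.

Lemma size_ispart n mu : ispart n mu -> (size mu <= n)%N.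
Proof.
case/and3P=> _ h0 /eqP <-; elim: mu h0 => //= b mu IH /andP[b0 /IH]; lia.
Qed.

Lemma mono_inj n mu nu : ispart n mu -> ispart n nu -> mono n mu = mono n nu -> mu = nu.
Proof.
move=> h1 h2 E; apply: (ispart_perm_eq h1 h2).
apply/allP => b; rewrite mem_cat => hb; apply/eqP.
have /andP[b0 bn] : (0 < b <= n)%N.
  by case/orP: hb; [move/(allP (ispart_bound h1)) | move/(allP (ispart_bound h2))].
have hb' : (b.-1 < n)%N by lia.
have := congr1 (fun m : 'X_{1..n} => m (Ordinal hb')) E.
by rewrite !mnmE /= prednK.
Qed.

Definition mono_list n (m : 'X_{1..n}) : seq nat :=
  sort geq (flatten [seq nseq (m i) (i.+1 : nat) | i <- enum 'I_n]).

Lemma count_mono_list n (m : 'X_{1..n}) b :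
  count_mem b (mono_list m) = if pidx n b is Some i then m i else 0%N.
Proof.
rewrite /mono_list (seq.permP (permEl (perm_sort _ _))) count_flatten -map_comp sumnE big_map big_enum /=.
case: (pidxP n b) => [[i -> ->]|hb].
  rewrite (bigD1 i) //= count_nseq /= eqxx mul1n big1 ?addn0 // => j hj.
  by rewrite count_nseq /= eqSS (inj_eq val_inj) (negbTE hj).
have -> : pidx n b = None by apply: pidx_none; apply/pidxP.
rewrite big1 // => j _; rewrite count_nseq /=; case: eqP => // E.
by case: hb; exists j => //; rewrite -E pidx_ord.
Qed.

Lemma monoK n (m : 'X_{1..n}) : mono n (mono_list m) = m.
Proof. by apply/mnmP => i; rewrite mnmE count_mono_list pidx_ord. Qed.

Lemma mono_listP n (m : 'X_{1..n}) : mnmwgt m = n -> ispart n (mono_list m).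
Proof.
move=> hm.
have hb : all (fun b => 0 < b <= n)%N (mono_list m).
  apply/allP => b; rewrite -has_pred1 has_count count_mono_list.
  by case: (pidxP n b) => [//|hp]; rewrite pidx_none //; exact/pidxP.
apply/and3P; split.
- by apply: sort_sorted => x y; exact: leq_total.
- by apply/allP => b /(allP hb)/andP[].
- by rewrite (sumn_count hb) -[X in _ == X]hm /mnmwgt; apply/eqP/eq_bigr => i _; rewrite count_mono_list pidx_ord.
Qed.

(** Counts the distributions of the parts of [nu] into [m] boxes with prescribed sums, which is a
    monomial coefficient of [p_nu]. *)
Fixpoint pmn (nu : seq nat) (m : nat) (h : nat -> nat) : nat :=
  if nu is b :: nu' then
    \sum_(j < m) (if (b <= h j)%N then pmn nu' m (fun l => if l == j then (h l - b)%N else h l) else 0%N)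
  else all (fun j => h j == 0%N) (iota 0 m).

Lemma pmn_pad nu m m' h : all (leq 1) nu -> (m <= m')%N -> (forall j, (m <= j)%N -> h j = 0%N) ->
  pmn nu m' h = pmn nu m h.
Proof.
move=> h0 mm; elim: nu h h0 => [|b nu IH] h /= h0 hz.
  rewrite -(subnKC mm) iotaD all_cat add0n (_ : all _ (iota m _)) ?andbT //.
  by apply/allP => j; rewrite mem_iota => /andP[hj _]; rewrite hz.
case/andP: h0 => b0 h0.
rewrite [RHS](big_ord_widen m' (fun j => if (b <= h j)%N then pmn nu m (fun l => if l == j then (h l - b)%N else h l) else 0%N)) //.
rewrite [RHS]big_mkcond; apply: eq_bigr => j _; case: ltnP => hj.
  case: ifP => // _; apply: IH => // l hl; case: eqP => [E|_]; last exact: hz.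
  by rewrite hz.
by rewrite hz // leqNgt b0.
Qed.

Lemma coef_pmn (R : realFieldType) M nu (eta : 'X_{1..M}) (h : nat -> nat) :
  (forall j : 'I_M, h j = eta j) ->
  (\prod_(b <- nu) psx R M b)@_eta = (pmn nu M h)%:R.
Proof.
elim: nu eta h => [|b nu IH] eta h hE.
  rewrite big_nil mcoeff1 /=; congr (_%:R); congr nat_of_bool; apply/eqP/allP => [E j|E].
    rewrite mem_iota add0n => /andP[_ hj]; have := hE (Ordinal hj); rewrite /= => ->.
    by rewrite E mnm0E.
  by apply/mnmP => j; rewrite mnm0E -hE; apply/eqP/E; rewrite mem_iota add0n /=.
rewrite big_cons mulr_suml raddf_sum /= natr_sum; apply: eq_bigr => j _.
have -> : ('X_j ^+ b * (\prod_(b0 <- nu) psx R M b0))@_eta =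
    if (b <= eta j)%N then (\prod_(b0 <- nu) psx R M b0)@_(eta - U_(j) *+ b) else 0.
  rewrite mpolyXn mulrC; case: ifP => hb.
    have hs : (U_(j) *+ b <= eta)%MM.
      by apply/mnm_lepP => l; rewrite mulmnE mnm1E; case: eqP => [<-|_]; rewrite ?mul1n ?mul0n.
    by have := mcoeffMX (\prod_(b0 <- nu) psx R M b0) (U_(j) *+ b) (eta - U_(j) *+ b); rewrite addmC submK.
  apply/eqP; rewrite mcoeff_eq0 (perm_mem (msuppMX _ _)); apply/negP => /mapP[m' _ E].
  by move: hb; rewrite E mnmDE mulmnE mnm1E eqxx mul1n leq_addr.
rewrite hE; case: ifP => // _; apply: IH => l.
rewrite mnmBE mulmnE mnm1E hE [j == l]eq_sym (inj_eq val_inj).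
by case: eqP => _; rewrite ?mul1n ?mul0n ?subn0.
Qed.

Definition nzc m (h : nat -> nat) := count (fun j => h j != 0%N) (iota 0 m).

Lemma iota_split m (j : 'I_m) : perm_eq (iota 0 m) ((j : nat) :: filter (predC1 (j : nat)) (iota 0 m)).
Proof.
have h : (j : nat) \in iota 0 m by rewrite mem_iota add0n /=.
by rewrite -rem_filter ?iota_uniq // perm_to_rem.
Qed.

(** Every nonempty box needs a part, and in the case of equality each holds exactly one. This is the
    triangularity of power sums against monomials with respect to length. *)
Lemma pmn_neq0 nu m h : all (leq 1) nu -> pmn nu m h != 0%N ->
  [/\ (nzc m h <= size nu)%N, sumn nu = (\sum_(j < m) h j)%N &
      nzc m h = size nu -> perm_eq nu [seq h j | j <- iota 0 m & h j != 0%N]].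
Proof.
elim: nu h => [|b nu IH] h /=.
  rewrite eqb0 negbK => _ /allP z; have hz j : j \in iota 0 m -> h j = 0%N by move/z/eqP.
  have -> : [seq j <- iota 0 m | h j != 0%N] = [::].
    by rewrite -(filter_pred0 (iota 0 m)); apply: eq_in_filter => j /hz ->.
  split=> //; last by rewrite big1 // => j _; rewrite hz // mem_iota add0n /=.
  by rewrite leqn0 /nzc -size_filter; apply/eqP; rewrite (@eq_in_filter _ _ pred0) ?filter_pred0 // => j /hz ->.
case/andP=> b0 h0; rewrite sum_nat_eq0 negb_forall => /existsP[j].
case: ifP => // hb /(IH _ h0); set h' := fun l => _; case=> I1 I2 I3.
have hrest l : l \in filter (predC1 (j : nat)) (iota 0 m) -> h' l = h l.
  by rewrite mem_filter /= /h' => /andP[/negbTE ->].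
have hj' : h' j = (h j - b)%N by rewrite /h' eqxx.
have nz (k : nat -> nat) : nzc m k = ((k j != 0%N) + count (fun l => k l != 0%N) (filter (predC1 (j : nat)) (iota 0 m)))%N.
  by rewrite /nzc (seq.permP (iota_split j)).
have Erest : count (fun l => h' l != 0%N) (filter (predC1 (j : nat)) (iota 0 m)) =
    count (fun l => h l != 0%N) (filter (predC1 (j : nat)) (iota 0 m)).
  by apply: eq_in_count => l /hrest ->.
have hj0 : h j != 0%N by lia.
have nzh : nzc m h = (count (fun l => h l != 0%N) [seq x <- iota 0 m | predC1 (j : nat) x]).+1.
  by rewrite nz hj0.
have nzh' := nz h'; rewrite Erest in nzh'.
split.
- by rewrite nzh ltnS; apply: leq_trans I1; rewrite nzh' leq_addl.
- have S (k : nat -> nat) : (\sum_(l < m) k l = k j + \sum_(l < m | l != j) k l)%N by rewrite (bigD1 j).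
  have I2' : sumn nu = (\sum_(l < m) h' l)%N := I2.
  rewrite I2' (S h') (S h) hj' addnA subnKC //; congr (_ + _)%N.
  by apply: eq_bigr => l hl; rewrite /h' (inj_eq val_inj) (negbTE hl).
move=> Es; have hbj : h j = b.
  apply/eqP; apply: contraT => hne; move: I1; rewrite nzh' hj'.
  have -> : (h j - b != 0)%N by lia.
  by rewrite nzh in Es; case: Es => ->; rewrite add1n ltnn.
have I3' : nzc m h' = size nu.
  by rewrite nzh' hj' hbj subnn /=; rewrite nzh in Es; case: Es.
have Ep (k : nat -> nat) : perm_eq [seq k l | l <- iota 0 m & k l != 0%N]
     ((if k j != 0%N then [:: k j] else [::]) ++ [seq k l | l <- filter (predC1 (j : nat)) (iota 0 m) & k l != 0%N]).
  have := perm_map k (perm_filter (fun l => k l != 0%N) (iota_split j)).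
  by rewrite /=; case: ifP.
rewrite perm_sym; apply: perm_trans (Ep h) _; rewrite hj0 /= hbj perm_cons perm_sym.
apply: perm_trans (I3 I3') _; apply: perm_trans (Ep h') _.
rewrite hj' hbj subnn /=.
have -> : [seq h' l | l <- [seq x <- iota 0 m | predC1 (j : nat) x] & h' l != 0%N] =
  [seq h l | l <- [seq x <- iota 0 m | predC1 (j : nat) x] & h l != 0%N].
  rewrite (@eq_in_filter _ (fun l => h' l != 0%N) (fun l => h l != 0%N)) => [|l /hrest -> //].
  by apply/eq_in_map => l; rewrite mem_filter => /andP[_ /hrest].
exact: perm_refl.
Qed.

Lemma pmn_gt0 nu m h : all (leq 1) nu -> perm_eq nu [seq h j | j <- iota 0 m & h j != 0%N] ->
  (0 < pmn nu m h)%N.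
Proof.
elim: nu h => [|b nu IH] h /=.
  move=> _; rewrite perm_sym => /perm_nilP E; rewrite lt0b; apply/allP => j hj.
  apply: contraT => hn; have : h j \in [seq h j | j <- iota 0 m & h j != 0%N].
    by apply: map_f; rewrite mem_filter hn.
  by rewrite E.
case/andP=> b0 h0 P.
have : b \in [seq h j | j <- iota 0 m & h j != 0%N] by rewrite -(perm_mem P) inE eqxx.
case/mapP=> j; rewrite mem_filter mem_iota add0n => /andP[hj0 /andP[_ hj]] Eb.
rewrite (bigD1 (Ordinal hj)) //= ltn_addr // -Eb leqnn; apply: IH => //.
set h' := fun l => _; set J := Ordinal hj.
have hrest l : l \in filter (predC1 (J : nat)) (iota 0 m) -> h' l = h l.
  by rewrite mem_filter /= /h' => /andP[/negbTE ->].
have Ep (k : nat -> nat) : perm_eq [seq k l | l <- iota 0 m & k l != 0%N]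
     ((if k j != 0%N then [:: k j] else [::]) ++ [seq k l | l <- filter (predC1 (J : nat)) (iota 0 m) & k l != 0%N]).
  have := perm_map k (perm_filter (fun l => k l != 0%N) (iota_split J)).
  by rewrite /=; case: ifP.
rewrite perm_sym; apply: perm_trans (Ep h') _.
have -> : h' j = 0%N by rewrite /h' eqxx Eb subnn.
rewrite /= perm_sym -(perm_cons b); apply: perm_trans P _; apply: perm_trans (Ep h) _.
rewrite hj0 -Eb /=.
have -> : [seq h' l | l <- [seq x <- iota 0 m | predC1 (j : nat) x] & h' l != 0%N] =
  [seq h l | l <- [seq x <- iota 0 m | predC1 (j : nat) x] & h l != 0%N].
  rewrite (@eq_in_filter _ (fun l => h' l != 0%N) (fun l => h l != 0%N)) => [|l /hrest -> //].
  by apply/eq_in_map => l; rewrite mem_filter => /andP[_ /hrest].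
exact: perm_refl.
Qed.

End Partitions.

(** * Monomial symmetric functions expressed in power sums *)

Section MonomialBasis.
Variables (R : realFieldType) (n : nat) (parts : seq (seq nat)).
Hypothesis parts_uniq : uniq parts.
Hypothesis mem_parts : forall nu, (nu \in parts) = ispart n nu.
Notation Lam := {mpoly R[n]}.
Implicit Types (f : Lam) (mu nu la rho : seq nat).

Definition pol (c : seq nat -> R) : Lam := \sum_(nu <- parts) c nu *: 'X_[mono n nu].

Lemma mcoeff_pol c nu : nu \in parts -> (pol c)@_(mono n nu) = c nu.
Proof.
move=> hnu; rewrite /pol raddf_sum /= (bigD1_seq nu) //= mcoeffZ mcoeffX eqxx mulr1.
rewrite big1_seq ?addr0 // => mu /andP[hne hmu]; rewrite mcoeffZ mcoeffX.
case: eqP => [E|_]; last by rewrite mulr0.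
by case/eqP: hne; apply: (@mono_inj n) => //; rewrite -mem_parts.
Qed.

Lemma hom_pol c : hom (pol c).
Proof.
move=> m hm; rewrite /pol raddf_sum big1_seq //= => nu; rewrite mem_parts => hnu.
rewrite mcoeffZ mcoeffX; case: eqP => [E|_]; last by rewrite mulr0.
by case: hm; rewrite -E mnmwgt_mono.
Qed.

Lemma hom_polE f : hom f -> f = pol (fun nu => f@_(mono n nu)).
Proof.
move=> hf; apply/mpolyP => m.
case: (eqVneq (mnmwgt m) n) => [hm|/eqP hm]; last by rewrite hf // hom_pol.
have h := mono_listP hm; rewrite -(monoK m) mcoeff_pol ?mem_parts //.
Qed.

Lemma homD f f' : hom f -> hom f' -> hom (f + f').
Proof. by move=> h h' m hm; rewrite mcoeffD h ?h' ?addr0. Qed.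
Lemma homZ c f : hom f -> hom (c *: f).
Proof. by move=> h m hm; rewrite mcoeffZ h ?mulr0. Qed.
Lemma hom_sum I r (P : pred I) (F : I -> Lam) :
  (forall i, P i -> hom (F i)) -> hom (\sum_(i <- r | P i) F i).
Proof. by move=> h m hm; rewrite raddf_sum big1 //= => i hi; rewrite h. Qed.
Lemma hom_mono nu : nu \in parts -> hom ('X_[mono n nu] : Lam).
Proof.
rewrite mem_parts => hnu m hm; rewrite mcoeffX; case: eqP => // E.
by case: hm; rewrite -E mnmwgt_mono.
Qed.

Lemma ppi_mono M nu : ispart n nu -> ppi M ('X_[mono n nu] : Lam) = \prod_(b <- nu) psx R M b.
Proof.
move/ispart_bound; rewrite /ppi comp_mpolyX.
rewrite (eq_bigr (fun i : 'I_n => psx R M i.+1 ^+ count_mem i.+1 nu)) => [|i _]; last first.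
  by rewrite tnth_mktuple mnmE.
elim: nu => [|b nu IH] /=; first by rewrite big_nil big1.
case/andP=> /andP[b0 bn] /IH E; rewrite big_cons -E.
have hb : (b.-1 < n)%N by lia.
rewrite (bigD1 (Ordinal hb)) //= [in RHS](bigD1 (Ordinal hb)) //= prednK // eqxx add1n exprS -mulrA.
congr (_ * (_ * _)); apply: eq_bigr => i hi.
case: eqP => [Eb|_]; last by rewrite add0n.
by case/eqP: hi; apply/val_inj => /=; lia.
Qed.

Lemma coef_hom M f (eta : 'X_{1..M}) (h : nat -> nat) : (forall j : 'I_M, h j = eta j) ->
  hom f -> (ppi M f)@_eta = \sum_(nu <- parts) f@_(mono n nu) * (pmn nu M h)%:R.
Proof.
move=> hE hf; rewrite {1}(hom_polE hf) /pol ppi_sum raddf_sum /=.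
apply: eq_big_seq => nu; rewrite mem_parts => hnu.
by rewrite ppiZ mcoeffZ ppi_mono // (coef_pmn _ _ hE).
Qed.

Definition la2m M mu : 'X_{1..M} := [multinom nth 0%N mu i | i < M].
(** For weight [n], [n] variables are enough: no partition of [n] is longer. *)
Definition mcf f mu : R := (ppi n f)@_(la2m n mu).

Lemma mcfE M f mu : hom f -> (size mu <= M)%N ->
  (ppi M f)@_(la2m M mu) = \sum_(nu <- parts) f@_(mono n nu) * (pmn nu (size mu) (nth 0%N mu))%:R.
Proof.
move=> hf hs; rewrite (coef_hom (h := nth 0%N mu)) // => [|j]; last by rewrite mnmE.
apply: eq_big_seq => nu; rewrite mem_parts => /and3P[_ h0 _].
rewrite (pmn_pad (m := size mu)) // => j hj; exact: nth_default.
Qed.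

Lemma mcf_pad M f mu : hom f -> mu \in parts -> (size mu <= M)%N ->
  (ppi M f)@_(la2m M mu) = mcf f mu.
Proof.
move=> hf; rewrite mem_parts => hmu hs; rewrite /mcf !mcfE //; exact: size_ispart.
Qed.

Lemma mcfD f f' mu : mcf (f + f') mu = mcf f mu + mcf f' mu.
Proof. by rewrite /mcf ppiD mcoeffD. Qed.
Lemma mcfZ c f mu : mcf (c *: f) mu = c * mcf f mu.
Proof. by rewrite /mcf ppiZ mcoeffZ. Qed.
Lemma mcf_sum I r (P : pred I) (F : I -> Lam) mu :
  mcf (\sum_(i <- r | P i) F i) mu = \sum_(i <- r | P i) mcf (F i) mu.
Proof. by rewrite /mcf ppi_sum raddf_sum. Qed.
Lemma mcfB f f' mu : mcf (f - f') mu = mcf f mu - mcf f' mu.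
Proof. by rewrite -[- f']scaleN1r mcfD mcfZ mulN1r. Qed.

Lemma nzvals mu : all (leq 1) mu ->
  [seq nth 0%N mu j | j <- iota 0 (size mu) & nth 0%N mu j != 0%N] = mu.
Proof.
move=> h0; rewrite (@eq_in_filter _ _ xpredT) ?filter_predT; first exact: mkseq_nth.
move=> j; rewrite mem_iota add0n => /andP[_ hj]; rewrite -lt0n.
exact: (all_nthP 0%N h0).
Qed.

Lemma nzc_part mu : all (leq 1) mu -> nzc (size mu) (nth 0%N mu) = size mu.
Proof. by move=> h0; rewrite /nzc -size_filter -(size_map (nth 0%N mu)) nzvals. Qed.

Lemma pmn_part nu mu : ispart n nu -> ispart n mu -> pmn nu (size mu) (nth 0%N mu) != 0%N ->
  (size mu <= size nu)%N /\ (size mu = size nu -> nu = mu).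
Proof.
move=> hn hm; have hn0 : all (leq 1) nu by case/and3P: hn.
have hm0 : all (leq 1) mu by case/and3P: hm.
case/(pmn_neq0 hn0); rewrite nzc_part // nzvals // => h1 _ h3; split => // /h3.
exact: (ispart_perm_eq hn hm).
Qed.

Lemma pmn_diag mu : ispart n mu -> (pmn mu (size mu) (nth 0%N mu))%:R != 0 :> R.
Proof.
move=> hm; rewrite pnatr_eq0 -lt0n; have hm0 : all (leq 1) mu by case/and3P: hm.
by apply: pmn_gt0 => //; rewrite nzvals.
Qed.

(** The transition matrix from power sums to monomials is triangular by length with nonzero
    diagonal, so the coefficients are eliminated beginning with the longest partitions. *)
Lemma mcf_inj f : hom f -> (forall mu, mu \in parts -> mcf f mu = 0) -> f = 0.
Proof.
move=> hf h0; rewrite (hom_polE hf) /pol big1_seq // => nu /andP[_ hnu].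
suff -> : f@_(mono n nu) = 0 by rewrite scale0r.
elim/ltn_ind: {nu}(n - size nu)%N {-2}nu (erefl (n - size nu)%N) hnu => d IH nu hd hnu.
have hnp : ispart n nu by rewrite -mem_parts.
have := h0 nu hnu; rewrite /mcf (mcfE hf (size_ispart hnp)) (bigD1_seq nu) //= big1_seq.
  by rewrite addr0 => /eqP; rewrite mulf_eq0 (negbTE (pmn_diag hnp)) orbF => /eqP.
move=> nu' /andP[hne hnu']; have hnp' : ispart n nu' by rewrite -mem_parts.
case: (eqVneq (pmn nu' (size nu) (nth 0%N nu)) 0%N) => [->|/(pmn_part hnp' hnp)[h1 h2]].
  by rewrite mulr0.
have hlt : (size nu < size nu')%N.
  by rewrite ltn_neqAle h1 andbT; apply/eqP => /h2 E; rewrite E eqxx in hne.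
by rewrite (IH (n - size nu')%N) ?mul0r // -hd ltn_sub2l // (leq_trans hlt) // size_ispart.
Qed.

(** Inverts the same triangular matrix, by increasing length. *)
Lemma monomials_exist : exists m : seq nat -> Lam, forall mu, mu \in parts ->
  hom (m mu) /\ forall mu', mu' \in parts -> mcf (m mu) mu' = (mu' == mu)%:R.
Proof.
suff H k : exists m : seq nat -> Lam, forall mu, mu \in parts -> (size mu < k)%N ->
    hom (m mu) /\ forall mu', mu' \in parts -> mcf (m mu) mu' = (mu' == mu)%:R.
  have [m hm] := H n.+1; exists m => mu hmu; apply: hm => //.
  by rewrite ltnS size_ispart // -mem_parts.
elim: k => [|k [m IH]]; first by exists (fun=> 0).
pose X mu : Lam := 'X_[mono n mu].
exists (fun mu => if (size mu < k)%N then m mu else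
  ((pmn mu (size mu) (nth 0%N mu))%:R)^-1 *:
   (X mu - \sum_(rho <- parts | (size rho < k)%N) mcf (X mu) rho *: m rho)) => mu hmu hk.
case: ifP => hk'; first exact: IH.
have {hk hk'} hk : size mu = k by lia.
have hmp : ispart n mu by rewrite -mem_parts.
have XC mu' : mu' \in parts -> mcf (X mu) mu' = (pmn mu (size mu') (nth 0%N mu'))%:R.
  move=> hmu'; have hmp' : ispart n mu' by rewrite -mem_parts.
  rewrite /mcf (mcfE (hom_mono hmu) (size_ispart hmp')) (bigD1_seq mu) //= mcoeffX eqxx mul1r.
  rewrite big1_seq ?addr0 // => nu /andP[hne hnu]; rewrite mcoeffX.
  case: eqP => [E|_]; last by rewrite mul0r.
  by case/eqP: hne; apply/esym; apply: (@mono_inj n) => //; rewrite -mem_parts.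
split.
  apply: homZ; apply: homD; first exact: hom_mono.
  rewrite -sumrN big_seq_cond; apply: hom_sum => rho /andP[hr1 hr2].
  by rewrite -scaleNr; apply: homZ; case: (IH rho hr1 hr2).
move=> mu' hmu'; have hmp' : ispart n mu' by rewrite -mem_parts.
rewrite mcfZ mcfB mcf_sum.
have -> : \sum_(rho <- parts | (size rho < k)%N) mcf (mcf (X mu) rho *: m rho) mu' =
    if (size mu' < k)%N then mcf (X mu) mu' else 0.
  rewrite big_mkcond /= (bigD1_seq mu') //= [X in _ + X]big1_seq ?addr0; last first.
    move=> rho /andP[hne hr]; case: ifP => // hr2.
    by rewrite mcfZ (IH rho hr hr2).2 // eq_sym (negbTE hne) mulr0.
  by case: ifP => // h2; rewrite mcfZ (IH mu' hmu' h2).2 // eqxx mulr1.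
case: ifP => h2.
  rewrite subrr mulr0; case: eqP => // E; rewrite E in h2; lia.
rewrite subr0 XC //; case: (eqVneq mu' mu) => [->|hne].
  by rewrite mulVf // pmn_diag.
case: (eqVneq (pmn mu (size mu') (nth 0%N mu')) 0%N) => [->|/(pmn_part hmp hmp')[h3 h4]].
  by rewrite mulr0.
have E : size mu' = size mu by lia.
by rewrite (h4 E) eqxx in hne.
Qed.

Definition trl (t : nat) mu : nat := (\sum_(x <- mu) (x - t))%N.
(** The first argument is the dominating one. *)
Definition ldom la mu := forall t, (trl t mu <= trl t la)%N.

Lemma sum_la2m (G : nat -> nat) M mu : G 0%N = 0%N -> (size mu <= M)%N ->
  (\sum_(i < M) G (la2m M mu i) = \sum_(x <- mu) G x)%N.
Proof.
move=> G0 hs; rewrite (eq_bigr (fun i : 'I_M => G (nth 0%N mu i))) => [|i _]; last by rewrite mnmE.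
rewrite -(big_mkord xpredT (fun i => G (nth 0%N mu i))) (big_cat_nat (n := size mu)) //=.
rewrite [X in (_ + X)%N]big_nat [X in (_ + X)%N]big1 ?addn0.
  by rewrite [RHS](big_nth 0%N).
by move=> i /andP[hi _]; rewrite nth_default.
Qed.

Lemma trsum_la2m t M mu : (size mu <= M)%N -> trsum t (la2m M mu) = trl t mu.
Proof. by move=> hs; rewrite /trsum (sum_la2m (G := fun x => (x - t)%N)). Qed.
Lemma mdeg_la2m M mu : (size mu <= M)%N -> mdeg (la2m M mu) = sumn mu.
Proof. by move=> hs; rewrite mdegE (sum_la2m (G := fun x => x)) // sumnE. Qed.

Lemma val_la2m M mu : (size mu <= M)%N -> val (la2m M mu) = mu ++ nseq (M - size mu) 0%N :> seq nat.
Proof.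
move=> hs; apply: (@eq_from_nth _ 0%N).
  by rewrite size_tuple size_cat size_nseq subnKC.
move=> i; rewrite size_tuple => hi; have -> : nth 0%N (val (la2m M mu)) i = la2m M mu (Ordinal hi) by rewrite mnm_tnth (tnth_nth 0%N).
rewrite /la2m mnmE.
by rewrite nth_cat nth_nseq; case: ltnP => h //; rewrite nth_default //; case: ifP.
Qed.

Lemma ldom_antisym la mu : la \in parts -> mu \in parts -> ldom la mu -> ldom mu la -> la = mu.
Proof.
move=> hla hmu h1 h2; have hl : ispart n la by rewrite -mem_parts.
have hm : ispart n mu by rewrite -mem_parts.
have [s E] : exists s : 'S_n, la2m n mu = [multinom la2m n la (s i) | i < n].
  apply: trsum_perm => [t|]; last first.
    by rewrite !mdeg_la2m ?size_ispart //; move: hl hm => /and3P[_ _ /eqP ->] /and3P[_ _ /eqP ->].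
  by rewrite !trsum_la2m ?size_ispart //; apply/eqP; rewrite eqn_leq h1 h2.
have P : perm_eq (val (la2m n mu)) (val (la2m n la)).
  apply/tuple_permP; exists s; congr tval; apply: eq_from_tnth => i; rewrite tnth_mktuple.
  have : la2m n mu i = la2m n la (s i) by rewrite E mnmE.
  by rewrite !mnm_tnth.
apply: (ispart_perm_eq hl hm); rewrite perm_sym.
have F nu : ispart n nu -> filter (leq 1) (val (la2m n nu)) = nu.
  move=> hnu; rewrite val_la2m ?size_ispart // filter_cat.
  have -> : filter (leq 1) (nseq (n - size nu) 0%N) = [::] by elim: (n - size nu)%N.
  by rewrite cats0; apply/all_filterP; case/and3P: hnu.
by have := perm_filter (leq 1) P; rewrite !F.
Qed.

Lemma coef_sorted M f (eta : 'X_{1..M}) : hom f -> (ppi M f)@_eta != 0 ->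
  exists mu, [/\ mu \in parts, (size mu <= M)%N, (ppi M f)@_eta = mcf f mu, 
   mdeg eta = n & forall t, trsum t eta = trl t mu].
Proof.
move=> hf h; pose mu := sort geq (filter (leq 1) (val eta)).
have hsz : (size mu <= M)%N.
  by rewrite size_sort size_filter (leq_trans (count_size _ _)) // size_tuple.
have P : perm_eq (val eta) (val (la2m M mu)).
  rewrite val_la2m // perm_sym; apply: (@perm_trans _ (filter (leq 1) (val eta) ++ filter (predC (leq 1)) (val eta))).
    have -> : nseq (M - size mu) 0%N = filter (predC (leq 1)) (val eta).
      have sE : (M - size mu = size (filter (predC (leq 1)) (val eta)))%N.
        have H (m a b : nat) : (a + b = m -> m - a = b)%N by move=> <-; rewrite addKn.
        have hc := count_predC (leq 1) (val eta); rewrite size_tuple in hc.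
        by rewrite size_sort !size_filter; exact: H hc.
      rewrite sE; apply/esym/all_pred1P/allP => x; rewrite mem_filter /= -leqNgt leqn0.
      by case/andP.
    by rewrite perm_cat2r perm_sort.
  by rewrite perm_filterC.
have [s E] : exists s : 'S_M, eta = [multinom la2m M mu (s i) | i < M].
  case/tuple_permP: P => s Es; exists s; apply/mnmP => i; rewrite mnmE !mnm_tnth.
  by rewrite (val_inj Es : val eta = _) tnth_mktuple.
have E1 : (ppi M f)@_eta = (ppi M f)@_(la2m M mu) by rewrite E ppi_perm.
have mdE : mdeg eta = sumn mu.
  rewrite E -(mdeg_la2m hsz) !mdegE [RHS](reindex_inj (@perm_inj _ s)) /=.
  by apply: eq_bigr => i _; rewrite !mnmE.
have hmu0 : all (leq 1) mu by rewrite /mu all_sort filter_all.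
have hsum : sumn mu = n.
  rewrite E1 mcfE // in h; apply/eqP; apply: contraNT h => hne; rewrite big1_seq // => nu /andP[_].
  rewrite mem_parts => hnu; have h0 : all (leq 1) nu by case/and3P: hnu.
  case: (eqVneq (pmn nu (size mu) (nth 0%N mu)) 0%N) => [->|/(pmn_neq0 h0)[_ hs _]].
    by rewrite mulr0.
  case/eqP: hne; case/and3P: hnu => _ _ /eqP <-; rewrite hs.
  by rewrite -(big_mkord xpredT (nth 0%N mu)) -(big_nth 0%N xpredT id) sumnE.
have hmu : mu \in parts.
  rewrite mem_parts; apply/and3P; split => //; last by apply/eqP.
  by apply: sort_sorted => x y; exact: leq_total.
exists mu; split => //; first by rewrite E1 mcf_pad.
  by rewrite mdE.
move=> t; rewrite -(trsum_la2m t hsz) E /trsum [RHS](reindex_inj (@perm_inj _ s)) /=.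
by apply: eq_bigr => i _; rewrite !mnmE.
Qed.

Definition mtri la f := forall mu, mu \in parts -> mcf f mu != 0 -> ldom la mu.

Lemma mtri_tri M la f : hom f -> la \in parts -> (size la <= M)%N -> mtri la f ->
  tri (la2m M la) (ppi M f).
Proof.
move=> hf hla hs ht eta h; have [mu [h1 h2 h3 h4 h5]] := coef_sorted hf h.
rewrite h3 in h; split.
  by rewrite h4 mdeg_la2m //; move: hla; rewrite mem_parts => /and3P[_ _ /eqP].
by move=> t; rewrite h5 trsum_la2m //; apply: ht.
Qed.

Lemma tri_mtri la f : la \in parts -> tri (la2m n la) (ppi n f) -> mtri la f.
Proof.
move=> hla ht mu hmu /ht[_ h] t.
by have := h t; rewrite !trsum_la2m // size_ispart // -mem_parts.
Qed.

End MonomialBasis.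

(** * Jack polynomials as joint eigenvectors *)

Lemma ispart_nth n la : ispart n la -> forall i j, (i <= j)%N -> (nth 0 la j <= nth 0 la i)%N.
Proof.
case/and3P=> hs _ _ i j hij; case: (ltnP j (size la)) => hj; last by rewrite [nth 0%N la j]nth_default.
have tr : transitive geq by move=> y x z /= xy yz; exact: leq_trans yz xy.
have := @sorted_leq_nth _ geq tr (fun x => leqnn x) 0%N la hs i j.
by apply=> //; rewrite inE //; exact: leq_ltn_trans hij hj.
Qed.

Section AbstractJack.
Variables (R : realFieldType) (n : nat) (parts : seq (seq nat)) (theta : R).
Hypothesis parts_uniq : uniq parts.
Hypothesis mem_parts : forall nu, (nu \in parts) = ispart n nu.
Hypothesis theta_gt0 : 0 < theta.
Notation Lam := {mpoly R[n]}.
Implicit Types (f g : Lam) (mu nu la rho : seq nat).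
Notation ip := (@ip R n theta).

Definition kapn (j : nat) la : R := kapL theta (nth 0%N la) n j.

Lemma size_part la : la \in parts -> (size la <= n)%N.
Proof. by rewrite mem_parts; exact: size_ispart. Qed.

Lemma kap_kapn j la : la \in parts -> kap theta j (la2m n la) = kapn j la.
Proof. by rewrite mem_parts => h; apply: (kap_kapL theta_gt0); exact: (ispart_nth h). Qed.

Lemma kap_kapn_N N j la : la \in parts -> (size la <= N)%N -> kap theta j (la2m N la) = kapn j la.
Proof.
move=> h hN; have hp : ispart n la by rewrite -mem_parts.
rewrite (kap_kapL theta_gt0 (ispart_nth hp)).
by apply: kapL_indep => i hi; apply: nth_default; [exact: leq_trans hN hi | exact: leq_trans (size_part h) hi].
Qed.

Lemma kapn_inj la mu : la \in parts -> mu \in parts -> (forall j, kapn j la = kapn j mu) -> la = mu.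
Proof.
move=> hl hm h; have hlp : ispart n la by rewrite -mem_parts.
have hmp : ispart n mu by rewrite -mem_parts.
have E := kapL_inj theta_gt0 (ispart_nth hlp) (ispart_nth hmp) h.
have E2 : la2m n la = la2m n mu by apply/mnmP => i; rewrite !mnmE E.
apply: (ldom_antisym mem_parts) => // t.
  by rewrite -(trsum_la2m t (size_part hm)) -(trsum_la2m t (size_part hl)) E2.
by rewrite -(trsum_la2m t (size_part hm)) -(trsum_la2m t (size_part hl)) E2.
Qed.

Lemma mtri_Kop la f j : hom f -> la \in parts -> mtri parts la f -> mtri parts la (Kop theta j f).
Proof.
move=> hf hl ht; apply: (tri_mtri mem_parts) => //; apply: tri_Kop => //.
exact: (mtri_tri parts_uniq mem_parts hf hl (size_part hl) ht).
Qed.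

Lemma mcf_Kop la f j : hom f -> la \in parts -> mtri parts la f ->
  mcf (Kop theta j f) la = kapn j la * mcf f la.
Proof.
move=> hf hl ht; rewrite /mcf coef_Kop ?kap_kapn //.
exact: (mtri_tri parts_uniq mem_parts hf hl (size_part hl) ht).
Qed.

(** Projection onto a finite span. Linear dependence in [s] is allowed: a residual direction of norm
    zero is itself zero, by definiteness of the form. *)
Lemma gram_schmidt (s : seq Lam) (v : Lam) : exists w : Lam,
  (exists c : nat -> R, w = \sum_(i < size s) c i *: nth 0 s i) /\
  forall u, u \in s -> ip (v - w) u = 0.
Proof.
have ipBl f g h : ip (f - g) h = ip f h - ip g h by rewrite -[- g]scaleN1r ipDl ipZl mulN1r.
elim: s v => [|u s IH] v.
  by exists 0; split => //; exists (fun=> 0); rewrite big_ord0.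
have [wu [[cu Ecu] ou]] := IH u; have [wv [[cv Ecv] ov]] := IH v.
set uo := u - wu in ou; pose al := ip (v - wv) uo / ip uo uo.
exists (wv + al *: uo); split.
  exists (fun i => if i is i'.+1 then cv i' - al * cu i' else al).
  rewrite big_ord_recl /= /uo Ecu Ecv scalerBr addrCA; congr (_ + _).
  rewrite scaler_sumr -sumrB; apply: eq_bigr => i _.
  by rewrite scalerBl scalerA /bump.
have sp w : (exists c : nat -> R, w = \sum_(i < size s) c i *: nth 0 s i) ->
    forall x, (forall y, y \in s -> ip x y = 0) -> ip x w = 0.
  case=> c -> x hx; rewrite ip_sumr big1 // => i _.
  by rewrite ipZr hx ?mulr0 // mem_nth.
have o_s y : y \in s -> ip (v - (wv + al *: uo)) y = 0.
  by move=> hy; rewrite opprD addrA ipBl ipZl ov // ou // mulr0 subr0.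
have o_uo : ip (v - (wv + al *: uo)) uo = 0.
  rewrite opprD addrA ipBl ipZl /al.
  case: (eqVneq (ip uo uo) 0) => [E|hne]; last by rewrite divfK // subrr.
  by rewrite (ip_eq0 theta_gt0 E) !ip0r mulr0 subrr.
move=> y; rewrite inE => /orP[/eqP ->|]; last exact: o_s.
have -> : u = uo + wu by rewrite /uo subrK.
by rewrite ipDr o_uo (sp wu _ _ o_s) ?addr0 //; exists cu.
Qed.

Section WithMonomials.
Variable m : seq nat -> Lam.
Hypothesis m_hom : forall mu, mu \in parts -> hom (m mu).
Hypothesis m_mcf : forall mu mu', mu \in parts -> mu' \in parts -> mcf (m mu) mu' = (mu' == mu)%:R.

Lemma m_expand f : hom f -> f = \sum_(mu <- parts) mcf f mu *: m mu.
Proof.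
move=> hf; apply/eqP; rewrite -subr_eq0; apply/eqP; apply: (mcf_inj parts_uniq mem_parts).
  apply: homD => //; rewrite -sumrN big_seq_cond; apply: hom_sum => mu /andP[hmu _].
  by rewrite -scaleNr; apply: homZ; exact: m_hom.
move=> mu hmu; rewrite mcfB mcf_sum (bigD1_seq mu) //= mcfZ m_mcf // eqxx mulr1.
rewrite big1_seq ?addr0 ?subrr // => nu /andP[hne hnu].
by rewrite mcfZ m_mcf // eq_sym (negbTE hne) mulr0.
Qed.

Lemma mtri_m mu : mu \in parts -> mtri parts mu (m mu).
Proof.
move=> hmu nu hnu; rewrite m_mcf //; case: (eqVneq nu mu) => [-> _ t|_]; first exact: leqnn.
by rewrite eqxx.
Qed.

Lemma ldom_trans la mu nu : ldom la mu -> ldom mu nu -> ldom la nu.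
Proof. by move=> h1 h2 t; exact: leq_trans (h2 t) (h1 t). Qed.

(** The residual [r] lies strictly below [la], and by self-adjointness and triangularity it is
    orthogonal to everything strictly below [la]; so [ip r r = 0]. *)
Lemma eigen_of_orth la (P : Lam) : la \in parts -> hom P -> mtri parts la P -> mcf P la = 1 ->
  (forall mu, mu \in parts -> ldom la mu -> mu != la -> ip P (m mu) = 0) ->
  forall j, Kop theta j P = kapn j la *: P.
Proof.
move=> hla hP tP P1 oP j; pose r := Kop theta j P - kapn j la *: P.
have hr : hom r.
  by apply: homD; [exact: hom_Kop | rewrite -scaleNr; exact: homZ].
have rla : mcf r la = 0 by rewrite /r mcfB mcfZ mcf_Kop // subrr.
have tr mu : mu \in parts -> mcf r mu != 0 -> ldom la mu /\ mu != la.
  move=> hmu h; split; last by apply: contraNneq h => ->; rewrite rla.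
  move: h; rewrite /r mcfB mcfZ.
  case: (eqVneq (mcf P mu) 0) => [->|hp _]; last exact: tP.
  by rewrite mulr0 subr0; exact: (mtri_Kop hP hla tP).
have orth f : hom f -> (forall mu, mu \in parts -> mcf f mu != 0 -> ldom la mu /\ mu != la) -> ip P f = 0.
  move=> hf h; rewrite (m_expand hf) ip_sumr big1_seq // => mu /andP[_ hmu]; rewrite ipZr.
  by case: (eqVneq (mcf f mu) 0) => [->|/(h _ hmu)[h1 h2]]; rewrite ?mul0r // oP // mulr0.
suff : ip r r = 0 by move/(ip_eq0 theta_gt0)/eqP; rewrite subr_eq0 => /eqP.
rewrite {2}(m_expand hr) ip_sumr big1_seq // => mu /andP[_ hmu]; rewrite ipZr.
case: (eqVneq (mcf r mu) 0) => [->|/(tr _ hmu)[h1 h2]]; first by rewrite mul0r.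
have hKm : hom (Kop theta j (m mu)) by apply: (hom_Kop theta_gt0); exact: (m_hom hmu).
rewrite /r ipDl -scaleNr ipZl oP // mulr0 addr0 Kop_adj (orth _ hKm) ?mulr0 //.
move=> nu hnu /(mtri_Kop (m_hom hmu) hmu (mtri_m hmu) hnu) h3; split; first exact: ldom_trans h3.
apply: contraNneq h2 => E; rewrite E in h3; apply/eqP/esym.
exact: (ldom_antisym mem_parts).
Qed.

(** Orthogonalizing [m la] against the dominated monomials gives joint eigenvectors. For other
    pairs, orthogonality is that of eigenvectors of a self-adjoint operator with different
    eigenvalues, available by [kapn_inj]. *)
Lemma jack_exists : exists P : seq nat -> Lam,
  (forall la, la \in parts -> [/\ hom (P la), mtri parts la (P la) & mcf (P la) la = 1]) /\
  (forall la mu, la \in parts -> mu \in parts -> mu != la -> ip (P la) (P mu) = 0).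
Proof.
pose low la := [seq m mu | mu <- parts & `[< ldom la mu >] && (mu != la)].
have H la : exists w : Lam, (exists c : nat -> R, w = \sum_(i < size (low la)) c i *: nth 0 (low la) i) /\
  forall u, u \in low la -> ip (m la - w) u = 0 by exact: gram_schmidt.
have [w hw] := choice H; pose P la := m la - w la.
have lowP la x : x \in low la -> exists mu, [/\ mu \in parts, ldom la mu, mu != la & x = m mu].
  case/mapP => mu; rewrite mem_filter => /andP[/andP[/asboolP h1 h2] h3] ->.
  by exists mu.
have main la : la \in parts -> [/\ hom (P la), mtri parts la (P la) & mcf (P la) la = 1].
  move=> hla; have [[c Ec] _] := hw la.
  have nthP (i : 'I_(size (low la))) := lowP la _ (mem_nth 0 (ltn_ord i)).
  have mw mu : mcf (w la) mu = \sum_(i < size (low la)) c i * mcf (nth 0 (low la) i) mu.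
    by rewrite Ec mcf_sum; apply: eq_bigr => i _; rewrite mcfZ.
  split.
  - apply: homD; first exact: m_hom.
    rewrite -scaleN1r; apply: homZ; rewrite Ec; apply: hom_sum => i _; apply: homZ.
    by have [mu [h1 _ _ ->]] := nthP i; exact: m_hom.
  - move=> mu hmu h; apply: contrapT => nd; move/eqP: h; apply.
    rewrite mcfB m_mcf // mw big1 => [|i _].
      by case: eqP => [E|_]; rewrite subr0 //; case: nd; rewrite E => t; exact: leqnn.
    have [nu [h1 h2 _ ->]] := nthP i; rewrite m_mcf //; case: eqP => [E|_]; last by rewrite mulr0.
    by case: nd; rewrite E.
  - rewrite mcfB m_mcf // eqxx mw big1 ?subr0 // => i _.
    by have [nu [h1 _ h2 ->]] := nthP i; rewrite m_mcf // eq_sym (negbTE h2) mulr0.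
have eig la : la \in parts -> forall j, Kop theta j (P la) = kapn j la *: P la.
  move=> hla; have [h1 h2 h3] := main la hla; apply: eigen_of_orth => // mu hmu hd hne.
  have [_] := hw la; apply; apply/mapP; exists mu => //.
  by rewrite mem_filter hmu andbT hne andbT; apply/asboolP.
exists P; split => // la mu hla hmu hne; apply/eqP; apply: contraNT hne => hne.
apply/eqP/esym; apply: (kapn_inj hla hmu) => j; apply: (mulIf hne).
by rewrite -ipZl -eig // Kop_adj eig // ipZr.
Qed.

(** Orthogonality among the [P] is transferred to the dominated monomials by induction on the sum of
    squares, each [m mu] being [P mu] minus lower monomials. *)
Lemma jack_eigen (P : seq nat -> Lam) :
  (forall la, la \in parts -> [/\ hom (P la), mtri parts la (P la) & mcf (P la) la = 1]) ->
  (forall la mu, la \in parts -> mu \in parts -> mu != la -> ip (P la) (P mu) = 0) ->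
  forall la j, la \in parts -> Kop theta j (P la) = kapn j la *: P la.
Proof.
move=> hP oP la j hla; have [h1 h2 h3] := hP la hla; apply: eigen_of_orth => //.
have stlt mu nu : mu \in parts -> nu \in parts -> ldom mu nu -> nu != mu ->
    (sqs (la2m n nu) < sqs (la2m n mu))%N.
  move=> hmu hnu hd hne.
  have hsn (rho : seq nat) : rho \in parts -> sumn rho = n by rewrite mem_parts => /and3P[_ _ /eqP].
  have ad : adom (la2m n mu) (la2m n nu).
    split; first by rewrite !mdeg_la2m ?size_part // !hsn.
    by move=> t; rewrite !trsum_la2m ?size_part.
  rewrite ltnNge; apply: contraNN hne => /(adom_sqs_eq ad) E; apply/eqP.
  apply: (ldom_antisym mem_parts hnu hmu) => // t.
  by have := E t; rewrite !trsum_la2m ?size_part // => ->.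
move=> mu; elim/ltn_ind: {mu}(sqs (la2m n mu)) {-2}mu (erefl (sqs (la2m n mu))) => d IH mu Ed hmu hd hne.
have [g1 g2 g3] := hP mu hmu.
have E := m_expand g1; rewrite (bigD1_seq mu) //= g3 scale1r in E.
have -> : m mu = P mu - \sum_(i <- parts | i != mu) mcf (P mu) i *: m i by rewrite {1}E addrK.
rewrite ipDr oP // add0r -scaleN1r ipZr ip_sumr big1_seq ?mulr0 // => nu /andP[hn hnu]; rewrite ipZr.
case: (eqVneq (mcf (P mu) nu) 0) => [->|/(g2 _ hnu) hd2]; first by rewrite mul0r.
have hlt := stlt _ _ hmu hnu hd2 hn.
rewrite (IH _ _ nu erefl) ?mulr0 //; first by rewrite -Ed.
  exact: ldom_trans hd hd2.
apply/eqP => E2; have := stlt _ _ hla hmu hd hne; move: hlt; rewrite E2 => l1 l2.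
by have := ltn_trans l1 l2; rewrite ltnn.
Qed.

End WithMonomials.

(** Setting all power sums to [N] means setting [N] variables to one, where the value is the sum of
    the monomial coefficients: all are nonnegative and one of them is one. *)
Lemma jack_eval_pos N (P : Lam) la : la \in parts -> (size la <= N)%N -> hom P ->
  mtri parts la P -> mcf P la = 1 -> Kop theta 1 P = kapn 1 la *: P ->
  0 < P.@[fun=> N%:R].
Proof.
move=> hla hN hP tP P1 eP.
have E : P.@[fun=> N%:R] = (ppi N P).@[fun=> 1].
  rewrite /ppi comp_mpoly_meval; apply: meval_eq => i; rewrite tnth_mktuple /psx raddf_sum /=.
  rewrite (eq_bigr (fun=> 1)) => [|j _]; first by rewrite sumr_const card_ord.
  by rewrite rmorphXn /= mevalXU expr1n.
have pos := @Jack_positive R n N theta theta_gt0 (la2m N la) P hP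
   (mtri_tri parts_uniq mem_parts hP hla hN tP).
have h1 : (ppi N P)@_(la2m N la) = 1 by rewrite (mcf_pad parts_uniq mem_parts).
have {}pos := pos h1; rewrite kap_kapn_N // in pos; have {}pos := pos eP.
rewrite E mevalE; have hin : la2m N la \in msupp (ppi N P).
  by rewrite mcoeff_msupp h1 oner_neq0.
rewrite (bigD1_seq (la2m N la)) ?msupp_uniq //= h1 mul1r.
have p1 (mo : 'X_{1..N}) : \prod_(i < N) (1 : R) ^+ mo i = 1 by rewrite big1 // => i _; rewrite expr1n.
rewrite p1; apply: ltr_pwDl => //; apply: sumr_ge0 => mo _; rewrite p1 mulr1; exact: pos.
Qed.

End AbstractJack.

(** * Taylor coefficients at (1^N) *)

Lemma bin_hockey c m : (\sum_(a < m) 'C(a, c) = 'C(m, c.+1))%N.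
Proof. by elim: m => [|m IH]; rewrite ?big_ord0 // big_ord_recr /= IH binS addnC. Qed.

Lemma bin_convol b c m : (\sum_(a < m.+1) 'C(a, c) * 'C(m - a, b) = 'C(m.+1, b + c.+1))%N.
Proof.
elim: m b c => [|m IH] b c.
  rewrite big_ord_recl big_ord0 addn0 subn0 addnS.
  case: b => [|b]; case: c => [|c] //=; rewrite ?bin0n ?muln0 ?mul0n //= bin_small //; lia.
case: b => [|b].
  by rewrite add0n -bin_hockey; apply: eq_bigr => a _; rewrite bin0 muln1.
rewrite big_ord_recr /= subnn bin0n muln0 addn0.
under eq_bigr => a _ do rewrite (subSn (_ : a <= m)%N) -1?ltnS // binS mulnDr.
by rewrite big_split /= !IH addSn [RHS]binS addnC.
Qed.

Section FormalSeries.
Variable R : realFieldType.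
(* A formal power series in [q_1, q_2, ...] is given by its Taylor coefficients: the entry [j] of the list
   stands for one derivative in [q_(j+1)]. *)
Definition fser := seq nat -> R.
Implicit Types (T : fser) (G : nat -> fser).

Definition dF (k : nat) T : fser := fun ks => T (k :: ks).
(* [qs G] is [sum_j q_(j+1) * G j]. *)
Fixpoint qs G (ks : seq nat) : R :=
  if ks is k :: ks' then G k ks' + qs (fun l => dF k (G l)) ks' else 0.

Lemma qsD G G' ks : qs (fun k ks => G k ks + G' k ks) ks = qs G ks + qs G' ks.
Proof.
elim: ks G G' => [|k ks IH] G G' /=; first by rewrite addr0.
by rewrite -/(dF _ _) (IH (fun l => dF k (G l)) (fun l => dF k (G' l))) addrACA.
Qed.
Lemma qsZ c G ks : qs (fun k ks => c * G k ks) ks = c * qs G ks.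
Proof.
elim: ks G => [|k ks IH] G /=; first by rewrite mulr0.
by rewrite (IH (fun l => dF k (G l))) mulrDr.
Qed.
Lemma qs0 ks : qs (fun _ _ => 0) ks = 0.
Proof. by elim: ks => //= k ks IH; rewrite add0r. Qed.
Lemma qs_sum (I : Type) (r : seq I) (P : pred I) (H : I -> nat -> fser) ks :
  qs (fun k ks => \sum_(i <- r | P i) H i k ks) ks = \sum_(i <- r | P i) qs (H i) ks.
Proof.
elim: r => [|i r IH]; first by rewrite big_nil -[RHS](qs0 ks); congr qs; apply/funext => k; apply/funext => l; rewrite big_nil.
rewrite big_cons; case: ifP => Pi.
  rewrite -IH -qsD; congr qs; apply/funext => k; apply/funext => l; by rewrite big_cons Pi.
by rewrite -IH; congr qs; apply/funext => k; apply/funext => l; rewrite big_cons Pi.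
Qed.

(** Multiplication by the linear form [sum_k al k * q_(k+1)]. *)
Definition qF (al : nat -> R) T : fser := qs (fun k ks => al k * T ks).
Lemma qF_cons al T k ks : qF al T (k :: ks) = al k * T ks + qF al (dF k T) ks.
Proof. by []. Qed.
Lemma qF_nil al T : qF al T [::] = 0. Proof. by []. Qed.

Variables (theta : R) (N : R).

Definition Symz G : fser := fun ks => N * G 0%N ks + qs (fun k => G k.+1) ks.
Definition Qz G (a : nat) : fser := fun ks => N * G a.+1 ks + qs (fun k => G (a + k.+2)%N) ks.
Definition dhat G (c : nat) : fser := fun ks => \sum_(k < c.+1) k.+1%:R * dF k (G (c - k)%N) ks.
(** With [z = w - 1] and [p_b = N + sum_k C(b, k) q_k] this is [(1/theta - 1) d/dz + (N + sum_k q_k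
    z^-k) / z + theta^-1 sum_k k z^(k-1) d/dq_k], negative powers of [z] being discarded; the Lax
    operator is then [(1 + z) Ez - N]. *)
Definition Ez G (c : nat) : fser := fun ks =>
  (theta^-1 - 1) * c.+1%:R * G c.+1 ks + Qz G c ks + theta^-1 * dhat G c ks.
Definition Dz G (c : nat) : fser := fun ks =>
  Ez G c ks + (if c is c'.+1 then Ez G c' ks else 0) - N * G c ks.
Definition injz T : nat -> fser := fun c => if c == 0%N then T else fun=> 0.
Definition EEz (k : nat) T : fser := Symz (iter k Dz (injz T)).

End FormalSeries.

(** * The Lax operator in the variable z = w - 1 *)

Section Link.
Variables (R : realFieldType) (n : nat) (theta N : R).
Hypothesis theta_gt0 : 0 < theta.
Notation Lam := {mpoly R[n]}.
Implicit Types (f : Lam) (g : nat -> Lam).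

Definition dq (k : nat) f : Lam := \sum_(i < n.+1) 'C(i, k.+1)%:R *: dv i f.
Fixpoint tau_ (ks : seq nat) f : R :=
  if ks is k :: ks' then tau_ ks' (dq k f) else f.@[fun=> N].
Definition tau f : fser R := fun ks => tau_ ks f.

Lemma dqD k f f' : dq k (f + f') = dq k f + dq k f'.
Proof. by rewrite /dq -big_split; apply: eq_bigr => i _; rewrite dvD scalerDr. Qed.
Lemma dqZ k c f : dq k (c *: f) = c *: dq k f.
Proof. by rewrite /dq scaler_sumr; apply: eq_bigr => i _; rewrite dvZ !scalerA mulrC. Qed.
Lemma tauD f f' ks : tau (f + f') ks = tau f ks + tau f' ks.
Proof. by rewrite /tau; elim: ks f f' => [|k ks IH] f f' /=; rewrite ?mevalD // dqD IH. Qed.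
Lemma tauZ c f ks : tau (c *: f) ks = c * tau f ks.
Proof. by rewrite /tau; elim: ks f => [|k ks IH] f /=; rewrite ?mevalZ // dqZ IH. Qed.
Lemma tau0 ks : tau 0 ks = 0.
Proof. by rewrite -(scale0r (0 : Lam)) tauZ mul0r. Qed.
Lemma tau_sum I r (P : pred I) (F : I -> Lam) ks :
  tau (\sum_(i <- r | P i) F i) ks = \sum_(i <- r | P i) tau (F i) ks.
Proof.
by elim/big_rec2: _ => [|i y1 y2 _ <-]; rewrite ?tau0 // tauD.
Qed.
Lemma tau_dq k f : tau (dq k f) = dF k (tau f). Proof. by []. Qed.
Lemma dF_tau k f ks : dF k (tau f) ks = \sum_(i < n.+1) 'C(i, k.+1)%:R * tau (dv i f) ks.
Proof. by rewrite -tau_dq /dq tau_sum; apply: eq_bigr => i _; rewrite tauZ. Qed.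

(** In the new coordinates [p_b] is [N + sum_k C(b, k) q_k]. *)
Lemma tau_pv b f ks : (0 < b <= n)%N ->
  tau (pv R n b * f) ks = N * tau f ks + qF (fun k => 'C(b, k.+1)%:R) (tau f) ks.
Proof.
move=> hb; elim: ks f => [|k ks IH] f.
  rewrite /tau /= mevalM qF_nil addr0; congr (_ * _).
  by case/pidxP: hb => i -> _; rewrite pv_ord mevalXU.
rewrite -[LHS]/(tau (dq k (pv R n b * f)) ks).
have -> : dq k (pv R n b * f) = 'C(b, k.+1)%:R *: f + pv R n b * dq k f.
  rewrite /dq mulr_sumr; under eq_bigr do rewrite dvM scalerDr.
  rewrite big_split /=; congr (_ + _); last by apply: eq_bigr => i _; rewrite scalerAr.
  have hb' : (b < n.+1)%N by case/andP: hb.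
  rewrite (bigD1 (Ordinal hb')) //= dv_pv eqxx hb mul1r big1 ?addr0 // => i hi.
  rewrite dv_pv (_ : (i == b :> nat) = false) ?mul0r ?scaler0 //.
  by apply/negbTE; apply: contraNneq hi => E; apply/eqP/val_inj.
by rewrite tauD tauZ IH qF_cons addrCA.
Qed.

(** At [p = 1^N] the lowering part of [L] sends [w^m] to [N (w^m - w) / (w - 1)]. For [m = 0] this
    formula gives [- N]; prescribing that value on the vacuum makes the passage to [z] uniform in
    [m]. *)
Definition Dw g (a : nat) : Lam := if a == 0%N then - N *: g 0%N else Lop theta g a.
Definition Symw g : Lam := N *: g 0%N + Ssum g.
Definition EEw (k : nat) f : Lam := Symw (iter k Dw (inj0 f)).

Lemma homv_Dw g : homv g -> homv (Dw g).
Proof.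
move=> hg k m hk; rewrite /Dw; case: eqP hk => [->|_] hk.
  by rewrite mcoeffZ hg ?mulr0.
exact: (homv_Lop theta_gt0 hg hk).
Qed.

(* Expansion of [sum_m g m * w ^ m] in powers of [z = w - 1]. *)
Definition zh g (c : nat) : fser R := fun ks => \sum_(m < n.+1) 'C(m, c)%:R * tau (g m) ks.

Lemma Symw_z g ks : tau (Symw g) ks = Symz N (zh g) ks.
Proof.
rewrite /Symw tauD tauZ /Ssum tau_sum /Symz /zh.
rewrite [in RHS](qs_sum _ _ (fun (m : 'I_n.+1) k ks => 'C(m, k.+1)%:R * tau (g m) ks)).
rewrite big_ord_recl [X in _ + (X + _)](_ : _ = 0) ?add0r; last by rewrite mul0r tau0.
rewrite [X in _ = N * X + _]big_ord_recl [X in _ = _ + X]big_ord_recl.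
rewrite [X in _ = _ + (X + _)](_ : _ = 0) ?add0r; last first.
  by rewrite -[RHS](qs0 R ks); congr qs; apply/funext => k; apply/funext => l; rewrite mul0r.
rewrite bin0 mul1r mulrDr -addrA; congr (_ + _); rewrite mulr_sumr -big_split /=.
apply: eq_bigr => i _; rewrite tau_pv; last by have := ltn_ord i; rewrite /bump /=; lia.
by rewrite bin0 mul1r.
Qed.

Lemma zh_inj0 f c ks : zh (inj0 f) c ks = injz (tau f) c ks.
Proof.
rewrite /zh big_ord_recl big1 => [|i _]; last by rewrite /inj0 /= tau0 mulr0.
by rewrite /injz bin0n addr0; case: eqP => _; rewrite ?mul1r ?mul0r.
Qed.

Lemma qF_sum (I : Type) (r : seq I) (c : I -> R) (al : I -> nat -> R) T ks :
  qF (fun k => \sum_(i <- r) c i * al i k) T ks = \sum_(i <- r) c i * qF (al i) T ks.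
Proof.
rewrite /qF; transitivity (qs (fun k ks => \sum_(i <- r) (c i * (al i k * T ks))) ks).
  by congr qs; apply/funext => k; apply/funext => l; rewrite mulr_suml; apply: eq_bigr => i _; rewrite mulrA.
by rewrite qs_sum; apply: eq_bigr => i _; rewrite qsZ.
Qed.
Lemma qFD al be T ks : qF (fun k => al k + be k) T ks = qF al T ks + qF be T ks :> R.
Proof.
by rewrite /qF -qsD; congr qs; apply/funext => k; apply/funext => l; rewrite mulrDl.
Qed.
Lemma eq_qF al be T ks : (forall k, al k = be k :> R) -> qF al T ks = qF be T ks.
Proof. by move=> h; rewrite (funext h). Qed.

Section DwLink.
Variable g : nat -> Lam.
Hypothesis hg : homv g.
Let t m := tau (g m).
Let td i m := tau (dv i (g m)).
Variable ks : seq nat.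

Lemma Qz_zh a : Qz N (zh g) a ks =
  \sum_(m < n.+1) (N * 'C(m, a.+1)%:R * t m ks + qF (fun k => 'C(m, (a + k.+2)%N)%:R) (t m) ks).
Proof.
rewrite /Qz /zh [in LHS](qs_sum _ _ (fun (m : 'I_n.+1) k ks => 'C(m, (a + k.+2)%N)%:R * t m ks)).
rewrite mulr_sumr -big_split; apply: eq_bigr => m _ /=.
by rewrite mulrA.
Qed.

(** Vandermonde's identity, for the expansion in [z] of [w^m * d(w^i)/dw = i * w^(m+i-1)]. *)
Lemma dhat_zh a : dhat (zh g) a ks =
  \sum_(m < n.+1) \sum_(i < n.+1) (i * 'C(m + i.-1, a))%:R * td i m ks.
Proof.
rewrite /dhat /dF /zh.
transitivity (\sum_(k < a.+1) \sum_(m < n.+1) \sum_(i < n.+1)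
   (k.+1 * 'C(i, k.+1) * 'C(m, a - k))%:R * td i m ks).
  apply: eq_bigr => k _; rewrite mulr_sumr; apply: eq_bigr => m _.
  rewrite -[tau (g m) ((k : nat) :: ks)]/(dF k (tau (g m)) ks) dF_tau !mulr_sumr.
  by apply: eq_bigr => i _; rewrite !natrM /td; ring.
rewrite exchange_big; apply: eq_bigr => m _; rewrite exchange_big; apply: eq_bigr => i _ /=.
rewrite -mulr_suml -natr_sum; congr (_%:R * _).
case: (i : nat) => [|i']; first by rewrite mul0n big1 // => k _; rewrite bin0n muln0.
rewrite addnC -binomial.Vandermonde big_distrr /=; apply: eq_bigr => k _.
by rewrite -mul_bin_diag mulnA.
Qed.

Lemma Dz_zh c : Dz theta N (zh g) c ks = \sum_(m < n.+1)
  (((theta^-1 - 1) * (m * 'C(m, c))%:R + N * ('C(m, c.+1)%:R - (c == 0%N)%:R)) * t m ks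
   + qF (fun k => ('C(m, (c + k.+2)%N) + (c != 0%N) * 'C(m, (c + k.+1)%N))%:R) (t m) ks
   + theta^-1 * \sum_(i < n.+1) (i * 'C(m + i, c))%:R * td i m ks).
Proof.
have EE a : Ez theta N (zh g) a ks = \sum_(m < n.+1)
    (((theta^-1 - 1) * (a.+1 * 'C(m, a.+1))%:R + N * 'C(m, a.+1)%:R) * t m ks
   + qF (fun k => 'C(m, (a + k.+2)%N)%:R) (t m) ks
   + theta^-1 * \sum_(i < n.+1) (i * 'C(m + i.-1, a))%:R * td i m ks).
  rewrite /Ez Qz_zh dhat_zh {1}/zh !mulr_sumr -!big_split; apply: eq_bigr => m _ /=.
  rewrite natrM /t; ring.
rewrite /Dz EE {1}/zh mulr_sumr; case: c => [|c].
  rewrite addr0 -sumrB; apply: eq_bigr => m _.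
  rewrite bin0 bin1 !muln1 mul1n.
  have -> : \sum_(i < n.+1) (i * 'C(m + i.-1, 0))%:R * td i m ks =
     \sum_(i < n.+1) (i * 'C(m + i, 0))%:R * td i m ks.
    by apply: eq_bigr => i _; rewrite !bin0.
  have -> : qF (fun k => 'C(m, (0 + k.+2)%N)%:R) (t m) ks =
     qF (fun k => ('C(m, 0 + k.+2) + (0 != 0)%N * 'C(m, 0 + k.+1))%:R) (t m) ks.
    by apply: eq_qF => k; rewrite mul0n addn0.
  rewrite /= /t; ring.
rewrite EE -big_split -sumrB; apply: eq_bigr => m _ /=.
have -> : \sum_(i < n.+1) (i * 'C(m + i, c.+1))%:R * td i m ks =
    \sum_(i < n.+1) (i * 'C(m + i.-1, c.+1))%:R * td i m ks +
    \sum_(i < n.+1) (i * 'C(m + i.-1, c))%:R * td i m ks.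
  rewrite -big_split; apply: eq_bigr => i _ /=; rewrite -mulrDl -natrD -mulnDr.
  case: (i : nat) => [|i']; first by rewrite !mul0n.
  by rewrite addnS binS.
have -> : qF (fun k => ('C(m, c.+1 + k.+2) + 1 * 'C(m, c.+1 + k.+1))%:R) (t m) ks =
    qF (fun k => 'C(m, (c.+1 + k.+2)%N)%:R) (t m) ks + qF (fun k => 'C(m, (c + k.+2)%N)%:R) (t m) ks.
  by rewrite -qFD; apply: eq_qF => k; rewrite mul1n natrD -[(c + k.+2)%N]addSnnS.
have -> : (m * 'C(m, c.+1))%:R = (c.+2 * 'C(m, c.+2))%:R + (c.+1 * 'C(m, c.+1))%:R :> R.
  rewrite -natrD; congr (_%:R); rewrite (mul_bin_left m c.+1).
  case: (leqP c.+1 m) => h; last by rewrite !bin_small ?muln0.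
  by rewrite -mulnDl subnK.
rewrite /t; ring.
Qed.

Lemma zh_Dw_term c m : (m <= n)%N ->
  \sum_(1 <= a < n.+1) 'C(a, c)%:R * tau (Lterm theta g a m) ks =
  \sum_(1 <= a < m) 'C(a, c)%:R * (N * t m ks + qF (fun k => 'C(m - a, k.+1)%:R) (t m) ks)
  + (theta^-1 - 1) * (m * 'C(m, c))%:R * t m ks
  + theta^-1 * \sum_(i < n.+1) (i * 'C(m + i, c))%:R * td i m ks.
Proof.
move=> hm.
have up : \sum_(m.+1 <= a < n.+1) 'C(a, c)%:R * tau (Lterm theta g a m) ks =
   theta^-1 * \sum_(i < n.+1) (i * 'C(m + i, c))%:R * td i m ks.
  rewrite -(big_mkord xpredT (fun i => (i * 'C(m + i, c))%:R * td i m ks)).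
  have Z : \sum_(n.+1 - m <= b < n.+1) (b * 'C(m + b, c))%:R * td b m ks = 0.
    rewrite big_nat_cond big1 // => b /andP[/andP[hb _] _].
    suff E : dv b (g m) = 0 by rewrite /td E tau0 mulr0.
    apply/mpolyP => mo; rewrite mcoeff_dv mcoeff0; case: (pidxP n b) => [[j Ej ->]|hp].
      by rewrite hg ?mul0rn // mnmwgtD mnmwgt1; lia.
    by rewrite (_ : pidx _ _ = None) //; apply: pidx_none; apply/pidxP.
  rewrite [X in _ = _ * X](big_cat_nat (n := (n.+1 - m)%N)) //=; last by lia.
  rewrite Z addr0 [X in _ = _ * X](big_ltn (m := 0%N)); last by lia.
  rewrite mul0n mul0r add0r mulr_sumr -[m.+1]add1n big_addn.
  rewrite !big_nat; apply: eq_bigr => b hb.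
  have hlt : (m < b + m)%N by lia.
  by rewrite /Lterm hlt addnK tauZ /td [(b + m)%N]addnC natrM; ring.
case: (posnP m) => [m0|m0].
  by rewrite m0 in up *; rewrite up big_geq // mul0n mulr0 mul0r !add0r.
rewrite (big_cat_nat (n := m)) //=; last by lia.
rewrite (big_ltn (m := m)) ?ltnS // up addrA; congr (_ + _ + _); last first.
  by rewrite /Lterm ltnn tauZ natrM /t; ring.
rewrite !big_nat; apply: eq_bigr => a ha; rewrite /Lterm.
have -> : (m < a)%N = false by lia.
have -> : (a < m)%N by lia.
by rewrite tau_pv //; lia.
Qed.

Lemma Dw_z c : zh (Dw g) c ks = Dz theta N (zh g) c ks.
Proof.
rewrite Dz_zh.
have -> : zh (Dw g) c ks = \sum_(m < n.+1) (\sum_(1 <= a < n.+1) 'C(a, c)%:R * tau (Lterm theta g a m) ks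
     - (m == 0%N :> nat)%:R * (c == 0%N)%:R * N * t m ks).
  rewrite sumrB [X in _ = _ - X]big_ord_recl [X in _ = _ - (_ + X)]big1 => [|i _]; last first.
    by rewrite !mul0r.
  rewrite addr0 /zh -(big_mkord xpredT (fun m => 'C(m, c)%:R * tau (Dw g m) ks)) big_ltn //.
  rewrite {1}/Dw /= tauZ mul1r addrC bin0n; congr (_ + _); last by rewrite /t; ring.
  rewrite exchange_big /= !big_nat; apply: eq_bigr => a /andP[ha _].
  rewrite /Dw /Lop; have -> : (a == 0)%N = false by lia.
  by rewrite tau_sum mulr_sumr.
apply: eq_bigr => m _; have hm : (m <= n)%N by rewrite -ltnS.
rewrite (zh_Dw_term _ hm).
have -> : \sum_(1 <= a < m) 'C(a, c)%:R * (N * t m ks + qF (fun k => 'C(m - a, k.+1)%:R) (t m) ks) =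
   N * (\sum_(1 <= a < m) 'C(a, c)%:R) * t m ks +
   qF (fun k => \sum_(1 <= a < m) 'C(a, c)%:R * 'C(m - a, k.+1)%:R) (t m) ks.
  rewrite qF_sum mulr_sumr mulr_suml -big_split; apply: eq_bigr => a _ /=; ring.
(* The sum omits [a = 0], so the hockey-stick identity is corrected when [c = 0]. *)
have S1 : \sum_(1 <= a < m) 'C(a, c)%:R = 'C(m, c.+1)%:R - ((m != 0%N :> nat) && (c == 0%N))%:R :> R.
  rewrite -bin_hockey natr_sum; case: (nat_of_ord m) => [|m']; first by rewrite big_geq // big_ord0 subr0.
  rewrite big_ord_recl bin0n big_add1 /= big_mkord; ring.
have S2 k : \sum_(1 <= a < m) 'C(a, c)%:R * 'C(m - a, k.+1)%:R =
    ('C(m, (c + k.+2)%N) + (c != 0%N) * 'C(m, (c + k.+1)%N))%:R :> R.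
  case: (nat_of_ord m) => [|m']; first by rewrite big_geq // !bin0n addnS /= addnS muln0.
  have := bin_convol k.+1 c m'.+1; rewrite big_ord_recl big_ord_recr /=.
  have -> : bump 0 m' = m'.+1 by [].
  rewrite subnn [X in (_ + (_ + _ * X))%N]bin0n muln0 addn0 subn0 [X in (X * _ + _)%N]bin0n.
  move=> E; have -> : \sum_(1 <= a < m'.+1) 'C(a, c)%:R * 'C(m'.+1 - a, k.+1)%:R =
     (\sum_(i < m') 'C(bump 0 i, c) * 'C(m'.+1 - bump 0 i, k.+1))%:R :> R.
    by rewrite natr_sum big_add1 /= big_mkord; apply: eq_bigr => i _; rewrite natrM.
  congr (_%:R); move: E; rewrite addSn addnS [X in _ = X -> _]binS; case: (c) => [|c'] /=.
    by rewrite addn0 !mul1n mul0n addn0 [RHS in _ = RHS -> _]addnC => /addnI.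
  rewrite mul0n add0n mul1n => ->.
  have -> : (k + c'.+1).+1 = (c'.+1 + k.+1)%N by lia.
  by have -> : (c'.+1 + k.+2)%N = (c'.+1 + k.+1).+1 by lia.
rewrite S1 (eq_qF _ _ S2).
case: (eqVneq (nat_of_ord m) 0%N) => [E|hm0] /=; case: (eqVneq c 0%N) => [->|hc] /=; ring.
Qed.

End DwLink.

Lemma tau_EEw k f : hom f -> tau (EEw k f) = EEz theta N k (tau f).
Proof.
move=> hf; apply/funext => ks; rewrite /EEw /EEz Symw_z.
have H j : homv (iter j Dw (inj0 f)).
  by elim: j => [|j IH]; [exact: homv_inj0 | exact: homv_Dw].
have E j : zh (iter j Dw (inj0 f)) = iter j (Dz theta N) (injz (tau f)).
  elim: j => [|j IH]; apply/funext => c; apply/funext => l; first exact: zh_inj0.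
  by rewrite !iterS Dw_z // IH.
by rewrite E.
Qed.

(** The counterpart of [rowE_rec], so that [EEw k] acts on a Jack polynomial as [rowE k]. *)
Lemma EEw_rec k f : EEw k.+1 f = Kop theta k f - N *: EEw k f.
Proof.
have L j (u v w : nat -> Lam) : u 0%N = 0 -> (forall a, w a = u a - N *: v a) ->
    forall a, iter j Dw w a = iter j (Lop theta) u a - N *: iter j Dw v a.
  move=> u0 h; have ui i : iter i (Lop theta) u 0%N = 0 by case: i.
  elim: j => [|j IH] a //; rewrite !iterS /Dw; case: eqP => [->|/eqP ha].
    by rewrite {1}/Lop /= IH ui !sub0r ?scaleNr ?scalerN ?opprK.
  rewrite {1 3 5}/Lop (negbTE ha) scaler_sumr -sumrB; apply: eq_bigr => m _.
  rewrite /Lterm; case: ifP => _.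
    by rewrite IH -scaleN1r dvD !dvZ scalerDr scaleN1r !scalerN !scalerA; congr (_ - _ *: _); ring.
  case: ifP => _; first by rewrite IH mulrBr scalerAr.
  by rewrite IH scalerBr !scalerA [N * _]mulrC.
have h0 a : Dw (inj0 f) a = Lop theta (inj0 f) a - N *: inj0 f a.
  rewrite /Dw; case: eqP => [->|/eqP ha]; first by rewrite /Lop /= /inj0 /= sub0r scaleNr.
  by rewrite /inj0 (negbTE ha) scaler0 subr0.
rewrite /EEw /Symw /Kop iterSr [iter k.+1 _ _]iterSr.
have E := L k (Lop theta (inj0 f)) (inj0 f) (Dw (inj0 f)) erefl h0.
rewrite E (_ : iter k _ _ 0%N = 0); last by case: (k).
rewrite sub0r /Ssum; under eq_bigr do rewrite E mulrBr.
rewrite sumrB scalerDr opprD addrCA; congr (_ + (_ - _)); first by rewrite scalerN.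
by rewrite scaler_sumr; apply: eq_bigr => i _; rewrite scalerAr.
Qed.

Lemma EEw_0 f : EEw 0 f = N *: f.
Proof.
rewrite /EEw /Symw /Ssum big_ord_recl big1 /= => [|i _]; last by rewrite /inj0 /= mulr0.
by rewrite /inj0 /= mul0r !addr0.
Qed.

End Link.

(** * Moments and cumulants *)

Section Shuffle.
Variable R : realFieldType.
Notation FF := (fser R).
Implicit Types (F G H T U : FF) (ks : seq nat) (a : nat -> R).

(* The sum over all ways to split the list in two: [fmul] is Leibniz's rule. *)
Fixpoint splitsum (f : seq nat -> seq nat -> R) ks : R :=
  if ks is k :: ks' then splitsum (fun S C => f (k :: S) C) ks' + splitsum (fun S C => f S (k :: C)) ks'
  else f [::] [::].
Definition fmul F G : FF := splitsum (fun S C => F S * G C).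
Definition funit : FF := fun ks => (ks == [::])%:R.
Definition fadd F G : FF := fun ks => F ks + G ks.
Definition fscale c F : FF := fun ks => c * F ks.

Lemma splitsumD f g ks : splitsum (fun S C => f S C + g S C) ks = splitsum f ks + splitsum g ks.
Proof.
elim: ks f g => [|k ks IH] f g //=.
by rewrite (IH (fun S C => f (k :: S) C)) (IH (fun S C => f S (k :: C))) addrACA.
Qed.
Lemma splitsumZ c f ks : splitsum (fun S C => c * f S C) ks = c * splitsum f ks.
Proof.
elim: ks f => [|k ks IH] f //=.
by rewrite (IH (fun S C => f (k :: S) C)) (IH (fun S C => f S (k :: C))) mulrDr.
Qed.
Lemma splitsum0 ks : splitsum (fun _ _ => 0) ks = 0.
Proof. by elim: ks => //= k ks ->; rewrite addr0. Qed.
Lemma splitsum_sum (I : Type) (r : seq I) (f : I -> seq nat -> seq nat -> R) ks :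
  splitsum (fun S C => \sum_(i <- r) f i S C) ks = \sum_(i <- r) splitsum (f i) ks.
Proof.
elim: r => [|i r IH].
  by rewrite big_nil -[RHS](splitsum0 ks); congr splitsum; do 2 apply/funext => ?; rewrite big_nil.
by rewrite big_cons -IH -splitsumD; congr splitsum; do 2 apply/funext => ?; rewrite big_cons.
Qed.
Lemma eq_splitsum f g ks :
  (forall S C, (size S + size C = size ks)%N -> f S C = g S C) -> splitsum f ks = splitsum g ks.
Proof.
elim: ks f g => [|k ks IH] f g h /=; first exact: h.
by congr (_ + _); apply: IH => S C hs; apply: h; rewrite /= -hs ?addSn ?addnS.
Qed.

Lemma fmul_cons F G k ks : fmul F G (k :: ks) = fmul (dF k F) G ks + fmul F (dF k G) ks.
Proof. by []. Qed.
Lemma fmul_nil F G : fmul F G [::] = F [::] * G [::].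
Proof. by []. Qed.
Lemma dF_fmul k F G : dF k (fmul F G) = fadd (fmul (dF k F) G) (fmul F (dF k G)).
Proof. by []. Qed.
Lemma fmul_ext F F' G G' ks :
  (forall l, (size l <= size ks)%N -> F l = F' l) ->
  (forall l, (size l <= size ks)%N -> G l = G' l) -> fmul F G ks = fmul F' G' ks.
Proof.
by move=> hF hG; apply: eq_splitsum => S C h; rewrite hF ?hG // -h ?leq_addr ?leq_addl.
Qed.
Lemma fmulC F G : fmul F G = fmul G F.
Proof.
apply/funext => ks; elim: ks F G => [|k ks IH] F G; first by rewrite !fmul_nil mulrC.
by rewrite !fmul_cons IH [fmul F _ _]IH addrC.
Qed.
Lemma fmulDl F F' G ks : fmul (fadd F F') G ks = fmul F G ks + fmul F' G ks.
Proof. by rewrite -splitsumD; apply: eq_splitsum => S C _; rewrite mulrDl. Qed.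
Lemma fmulZl c F G ks : fmul (fscale c F) G ks = c * fmul F G ks.
Proof. by rewrite -splitsumZ; apply: eq_splitsum => S C _; rewrite mulrA. Qed.
Lemma fmulDr F G G' ks : fmul F (fadd G G') ks = fmul F G ks + fmul F G' ks.
Proof. by rewrite fmulC fmulDl ![fmul _ F]fmulC. Qed.
Lemma fmulZr c F G ks : fmul F (fscale c G) ks = c * fmul F G ks.
Proof. by rewrite fmulC fmulZl [fmul F _]fmulC. Qed.
Lemma fmul0l G ks : fmul (fun=> 0) G ks = 0.
Proof. by rewrite -[RHS](splitsum0 ks); apply: eq_splitsum => S C _; rewrite mul0r. Qed.
Lemma fmul_suml (I : Type) (r : seq I) (F : I -> FF) G ks :
  fmul (fun l => \sum_(i <- r) F i l) G ks = \sum_(i <- r) fmul (F i) G ks.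
Proof.
by rewrite -splitsum_sum; apply: eq_splitsum => S C _; rewrite mulr_suml.
Qed.
Lemma fmulA F G H : fmul F (fmul G H) = fmul (fmul F G) H.
Proof.
apply/funext => ks; elim: ks F G H => [|k ks IH] F G H; first by rewrite !fmul_nil mulrA.
by rewrite !fmul_cons !dF_fmul fmulDl fmulDr !IH addrA.
Qed.
Lemma fmul1l G : fmul funit G = G.
Proof.
apply/funext => ks; elim: ks G => [|k ks IH] G; first by rewrite fmul_nil mul1r.
by rewrite fmul_cons IH (_ : dF k funit = fun=> 0) ?fmul0l ?add0r.
Qed.

Lemma qs_fmul (G : nat -> FF) T ks : qs (fun k => fmul (G k) T) ks = fmul (qs G) T ks.
Proof.
elim: ks G T => [|k ks IH] G T; first by rewrite fmul_nil /= mul0r.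
rewrite /= fmul_cons -IH.
rewrite (_ : dF k (qs G) = fadd (G k) (qs (fun b => dF k (G b)))) //.
rewrite fmulDl -IH -addrA; congr (_ + _); rewrite -qsD.
by congr qs; apply/funext => b; apply/funext => m.
Qed.

Definition lone (al : nat -> R) : FF := fun ks => if ks is [:: k] then al k else 0.
Lemma dF_lone al k : dF k (lone al) = fscale (al k) funit.
Proof. by apply/funext => -[|b l]; rewrite /dF /fscale /funit /= ?mulr1 ?mulr0. Qed.
Lemma fmul_lone al F : fmul (lone al) F = qF al F.
Proof.
apply/funext => ks; elim: ks F => [|k ks IH] F; first by rewrite fmul_nil qF_nil mul0r.
by rewrite fmul_cons dF_lone fmulZl fmul1l IH qF_cons.
Qed.

End Shuffle.

(** * Faa di Bruno's formula over set partitions *)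

Section SetPartitions.
Variable R : realFieldType.
Notation FF := (fser R).
Implicit Types (F G H T U : FF) (ks : seq nat) (a : nat -> R) (pi : seq (seq nat)).

Definition spsum (g : seq (seq nat) -> R) ks : R := \sum_(pi <- Defs.setparts ks) g pi.
Definition inssum k (g : seq (seq nat) -> R) pi : R := \sum_(pi' <- Defs.insert_each k pi) g pi'.

Lemma spsum_nil g : spsum g [::] = g [::].
Proof. by rewrite /spsum /= big_seq1. Qed.
Lemma spsum_cons g k ks : spsum g (k :: ks) = spsum (fun pi => g ([:: k] :: pi) + inssum k g pi) ks.
Proof.
rewrite /spsum /=; elim: (Defs.setparts ks) => [|pi s IH] /=; first by rewrite !big_nil.
rewrite !big_cons -IH -[(_ ++ _)%list]/(_ ++ _)%SEQ big_cat addrA.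
by [].
Qed.
Lemma inssum_nil k g : inssum k g [::] = 0. Proof. by rewrite /inssum /= big_nil. Qed.
Lemma inssum_cons k g B pi :
  inssum k g (B :: pi) = g ((k :: B) :: pi) + inssum k (fun pi' => g (B :: pi')) pi.
Proof. by rewrite /inssum /= big_cons; congr (_ + _); rewrite -[List.map _ _]/(map _ _) big_map. Qed.

(** Sums over the choice of one block, keeping the remaining blocks in order. *)
Fixpoint picksum (f : seq nat -> seq (seq nat) -> R) pi : R :=
  if pi is B :: pi' then f B pi' + picksum (fun B' rest => f B' (B :: rest)) pi' else 0.

Lemma picksumD f g pi : picksum (fun B r => f B r + g B r) pi = picksum f pi + picksum g pi.
Proof.
elim: pi f g => [|B pi IH] f g /=; first by rewrite addr0.
by rewrite (IH (fun B' r => f B' (B :: r))) addrACA.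
Qed.

Lemma inssumD k f g pi : inssum k (fun p => f p + g p) pi = inssum k f pi + inssum k g pi.
Proof. by rewrite /inssum big_split. Qed.

Lemma inssum_pick k f pi :
  inssum k (picksum f) pi = picksum (fun B r => f (k :: B) r + inssum k (f B) r) pi.
Proof.
elim: pi f => [|B pi IH] f; first by rewrite inssum_nil.
rewrite inssum_cons /= inssumD (IH (fun B' r => f B' (B :: r))).
have -> : picksum (fun B' r => f (k :: B') (B :: r) + inssum k (f B') (B :: r)) pi =
   picksum (fun B' r => f B' ((k :: B) :: r)) pi +
   picksum (fun B' r => f (k :: B') (B :: r) + inssum k (fun r' => f B' (B :: r')) r) pi.
  rewrite -picksumD; congr picksum; apply/funext => B'; apply/funext => r.
  by rewrite inssum_cons addrCA.
by rewrite !addrA; congr (_ + _); rewrite addrAC.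
Qed.

Lemma spsumD f g ks : spsum (fun p => f p + g p) ks = spsum f ks + spsum g ks.
Proof. by rewrite /spsum big_split. Qed.

(* Either side enumerates a block [B] (possibly empty) together with a set partition of the rest. *)
Lemma spsum_pick (f : seq nat -> seq (seq nat) -> R) ks :
  spsum (fun pi => f [::] pi + picksum f pi) ks = splitsum (fun S C => spsum (f S) C) ks.
Proof.
elim: ks f => [|x ks IH] f; first by rewrite /= !spsum_nil /= addr0.
rewrite spsum_cons /=.
rewrite -(IH (fun B r => f (x :: B) r)).
pose f2 B p := f B ([:: x] :: p) + inssum x (f B) p.
have -> : splitsum (fun S C => spsum (f S) (x :: C)) ks = splitsum (fun S C => spsum (f2 S) C) ks.
  by apply: eq_splitsum => S C _; rewrite spsum_cons.
rewrite -IH -spsumD; apply: eq_bigr => pi _.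
rewrite inssumD inssum_pick /f2 !picksumD; ring.
Qed.

Definition pprod F pi : R := \prod_(B <- pi) F B.
(** Faa di Bruno's formula for a composition [h (F)], where [a m] is the [m]-th derivative of [h] at
    the constant term of [F]. *)
Definition spmom a F : FF := spsum (fun pi => a (size pi) * pprod F pi).

Lemma inssum_pprod k (c : R) F pi :
  inssum k (fun p => c * pprod F p) pi = picksum (fun B r => c * (F (k :: B) * pprod F r)) pi.
Proof.
elim: pi c => [|B pi IH] c; first by rewrite inssum_nil.
rewrite inssum_cons /= /pprod big_cons; congr (_ + _).
have -> : (fun pi' => c * \prod_(B0 <- (B :: pi')) F B0) = (fun pi' => (c * F B) * pprod F pi').
  by apply/funext => p; rewrite big_cons mulrA.
rewrite IH; congr picksum; apply/funext => B'; apply/funext => r.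
by rewrite /pprod big_cons; ring.
Qed.

Lemma size_insert k pi pi' : pi' \in Defs.insert_each k pi -> size pi' = size pi.
Proof.
elim: pi pi' => [|B pi IH] pi' //=; rewrite inE => /orP[/eqP -> //|].
by rewrite -[List.map _ _]/(map _ _) => /mapP[p hp ->] /=; rewrite IH.
Qed.

(** The chain rule [d h(F) = dF * h'(F)]: the block containing the new element is singled out by
    [spsum_pick], and the shift of [a] differentiates [h]. *)
Lemma spmom_cons a F k ks :
  spmom a F (k :: ks) = fmul (dF k F) (spmom (fun m => a m.+1) F) ks.
Proof.
rewrite /spmom spsum_cons.
pose f B p := a (size p).+1 * (F (k :: B) * pprod F p).
transitivity (spsum (fun pi => f [::] pi + picksum f pi) ks).
  apply: eq_bigr => pi _; rewrite /f /pprod big_cons; congr (_ + _).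
  rewrite /inssum big_seq (eq_bigr (fun p => a (size pi) * pprod F p)) => [|p hp]; last first.
    by rewrite (size_insert hp).
  rewrite -big_seq -/(inssum k (fun p => a (size pi) * pprod F p) pi) inssum_pprod.
  suff H : forall (P : seq (seq nat) -> R) s pi0 c, s = (size pi0 + c)%N ->
    picksum (fun B r => a s * (F (k :: B) * P r)) pi0 =
    picksum (fun B r => a ((size r).+1 + c)%N * (F (k :: B) * P r)) pi0.
    rewrite (H (pprod F) _ pi 0%N) ?addn0 //; congr picksum; do 2 apply/funext => ?.
    by rewrite addn0.
  move=> P s pi0; elim: pi0 P => [|B pi0 IH] P c hs //=; congr (_ + _); first by rewrite hs.
  rewrite (IH (fun r => P (B :: r)) c.+1) ?hs ?addnS //; congr picksum; do 2 apply/funext => ?.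
  by rewrite addnS.
rewrite spsum_pick; apply: eq_splitsum => S C _.
rewrite /spsum mulr_sumr; apply: eq_bigr => p _; rewrite /f /dF; ring.
Qed.

Lemma spmom_nil a F : spmom a F [::] = a 0%N.
Proof. by rewrite /spmom spsum_nil /pprod big_nil mulr1. Qed.

(* [spmom (rising j) F] is the power [F ^ (-j)] and [spmom mob F] is [ln F] when [F] has constant term 1. *)
Definition rising (j m : nat) : R := (-1) ^+ m * (\prod_(i < m) (j + i)%N)%:R.
Definition mob (m : nat) : R := (-1) ^+ m.-1 * (m.-1)`!%:R.

Lemma risingS j m : rising j m.+1 = - j%:R * rising j.+1 m.
Proof.
rewrite /rising exprS big_ord_recl addn0 natrM.
rewrite (eq_bigr (fun i : 'I_m => (j.+1 + i)%N)) => [|i _]; last by rewrite /= addSnnS.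
ring.
Qed.
Lemma mobS m : mob m.+1 = rising 1 m.
Proof.
rewrite /mob /rising /=; congr (_ * _%:R).
by elim: m => [|m IH]; rewrite ?big_ord0 // big_ord_recr factS -IH /= mulnC.
Qed.

Lemma spmom_ext_coef a b F ks : a =1 b -> spmom a F ks = spmom b F ks.
Proof. by move=> h; apply: eq_bigr => p _; rewrite h. Qed.

Lemma spmom_Z c a F ks : spmom (fun m => c * a m) F ks = c * spmom a F ks.
Proof. by rewrite /spmom /spsum mulr_sumr; apply: eq_bigr => p _; rewrite mulrA. Qed.

Lemma rising_cons j F k ks :
  spmom (rising j) F (k :: ks) = - j%:R * fmul (dF k F) (spmom (rising j.+1) F) ks.
Proof.
rewrite spmom_cons -fmulZr; congr fmul; apply/funext => l.
by rewrite /fscale -spmom_Z; apply: spmom_ext_coef => m; rewrite risingS.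
Qed.

(** The power law [F^(-j-1) * F = F^(-j)], obtained by differentiating both sides and induction on
    the order. *)
Lemma rising_fmul j F ks : F [::] = 1 -> fmul (spmom (rising j.+1) F) F ks = spmom (rising j) F ks.
Proof.
move=> F1; have [n] := ubnP (size ks); elim: n ks j => // n IH [|k ks] j hs.
  by rewrite fmul_nil F1 !spmom_nil /rising !big_ord0 !mulr1.
rewrite fmul_cons rising_cons.
have -> : dF k (spmom (rising j.+1) F) = fscale (- j.+1%:R) (fmul (dF k F) (spmom (rising j.+2) F)).
  by apply/funext => l; rewrite /dF rising_cons.
rewrite fmulZl -fmulA.
have -> : fmul (dF k F) (fmul (spmom (rising j.+2) F) F) ks = fmul (dF k F) (spmom (rising j.+1) F) ks.
  by apply: fmul_ext => // l hl; apply: IH; exact: leq_ltn_trans hl hs.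
by rewrite [fmul _ (dF k F)]fmulC -natr1; ring.
Qed.

Lemma rising0 F : spmom (rising 0) F = funit R.
Proof.
apply/funext => -[|k ks]; first by rewrite spmom_nil /rising big_ord0 mulr1.
by rewrite rising_cons oppr0 mul0r.
Qed.

Definition cumul F : FF := spmom mob F.

Lemma dF_cumul F k : dF k (cumul F) = fmul (dF k F) (spmom (rising 1) F).
Proof.
apply/funext => ks; rewrite /dF /cumul spmom_cons; congr fmul; apply/funext => l.
by apply: spmom_ext_coef => m; rewrite mobS.
Qed.

Lemma rising1_inv F : F [::] = 1 -> fmul (spmom (rising 1) F) F = funit R.
Proof. by move=> F1; apply/funext => ks; rewrite rising_fmul // rising0. Qed.

Lemma cumul_dF F k : F [::] = 1 -> fmul (dF k (cumul F)) F = dF k F.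
Proof.
by move=> F1; rewrite dF_cumul -fmulA rising1_inv // fmulC fmul1l.
Qed.

Lemma cumul_unique F H k : F [::] = 1 -> fmul H F = dF k F -> dF k (cumul F) = H.
Proof. by move=> F1 E; rewrite dF_cumul -E -fmulA [fmul F _]fmulC rising1_inv // fmulC fmul1l. Qed.

Lemma cumul1 F k : F [::] = 1 -> cumul F [:: k] = F [:: k].
Proof. by move=> F1; rewrite -[RHS]/(dF k F [::]) -cumul_dF // fmul_nil F1 mulr1. Qed.
Lemma cumul2 F k l : F [::] = 1 -> cumul F [:: k; l] = F [:: k; l] - F [:: k] * F [:: l].
Proof.
move=> F1; apply/esym/eqP; rewrite subr_eq; apply/eqP.
rewrite -[LHS]/(dF k F [:: l]) -cumul_dF // fmul_cons !fmul_nil F1 mulr1.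
by rewrite /dF cumul1.
Qed.

(* Wick's formula: a moment sequence obeying the Gaussian integration by parts has only second cumulants. *)
Lemma cumul_gauss (C : nat -> nat -> R) F k l m ks : F [::] = 1 ->
  (forall i s, F (i :: s) = qF (C i) F s) -> cumul F [:: k, l, m & ks] = 0.
Proof.
move=> F1 HF; rewrite -[LHS]/(dF k (cumul F) [:: l, m & ks]).
rewrite (@cumul_unique F (lone (C k)) k F1) // fmul_lone.
by apply/funext => s; rewrite -HF.
Qed.

(** Iterates the derivatives [sum_(i < K) w i k * d_i]; for binomial weights these are the truncated
    [d/dq] whose sums over boxes occur in Assumption C. *)
Fixpoint boxsum (w : nat -> nat -> R) (K : nat) F ks : R :=
  if ks is k :: ks' then \sum_(i < K) w i k * boxsum w K (dF i F) ks' else F [::].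

Lemma boxsumD w K F G ks : boxsum w K (fadd F G) ks = boxsum w K F ks + boxsum w K G ks.
Proof.
elim: ks F G => [|k ks IH] F G //=; rewrite -big_split; apply: eq_bigr => i _.
by rewrite /= -mulrDr -IH.
Qed.
Lemma boxsum_fmul w K F G : boxsum w K (fmul F G) = fmul (boxsum w K F) (boxsum w K G).
Proof.
apply/funext => ks; elim: ks F G => [|k ks IH] F G; first by rewrite fmul_nil.
have H E : dF k (boxsum w K E) = fun l => \sum_(i <- index_enum 'I_K) fscale (w i k) (boxsum w K (dF i E)) l.
  by apply/funext => l.
rewrite fmul_cons [fmul _ (dF k _)]fmulC !H !fmul_suml /= -big_split; apply: eq_bigr => i _.
by rewrite !fmulZl dF_fmul boxsumD !IH mulrDr [fmul _ (boxsum w K F)]fmulC.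
Qed.
(** A linear change of coordinates commutes with composition by a function of one variable, so box
    sums of the derivatives of [ln F] become logarithms of box sums, and the limit in [K] can be
    taken on [F] itself. *)
Lemma boxsum_spmom w K a F ks : boxsum w K (spmom a F) ks = spmom a (boxsum w K F) ks.
Proof.
have [n] := ubnP (size ks); elim: n ks a => // n IH [|k ks] a hs; first by rewrite !spmom_nil /= spmom_nil.
rewrite spmom_cons /=.
transitivity (\sum_(i < K) fmul (fscale (w i k) (boxsum w K (dF i F))) (spmom (fun m => a m.+1) (boxsum w K F)) ks).
  apply: eq_bigr => i _; rewrite fmulZl; congr (_ * _).
  have -> : dF i (spmom a F) = fmul (dF i F) (spmom (fun m => a m.+1) F).
    by apply/funext => l; rewrite /dF spmom_cons.
  rewrite boxsum_fmul; apply: fmul_ext => // l hl; apply: IH; exact: leq_ltn_trans hl hs.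
by rewrite -fmul_suml.
Qed.

End SetPartitions.

(** * Operators with a leading term of order N *)

Definition cv (u : nat -> R) (l : R) := Un_cv u l.

Lemma cv_ext u v l : u =1 v -> cv u l -> cv v l.
Proof. by move=> h; rewrite (_ : v = u) //; apply/funext => n; rewrite h. Qed.
Lemma cv_const l : cv (fun=> l) l.
Proof. by move=> e he; exists 0%N => n _; rewrite /R_dist RminusE subrr Rabs_R0. Qed.
Lemma cvD u v a b : cv u a -> cv v b -> cv (fun n => u n + v n) (a + b).
Proof. exact: CV_plus. Qed.
Lemma cvM u v a b : cv u a -> cv v b -> cv (fun n => u n * v n) (a * b).
Proof. exact: CV_mult. Qed.
Lemma cvZ c u a : cv u a -> cv (fun n => c * u n) (c * a).
Proof. by apply: cvM; exact: cv_const. Qed.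
Lemma cvN u a : cv u a -> cv (fun n => - u n) (- a).
Proof. exact: CV_opp. Qed.
Lemma cvB u v a b : cv u a -> cv v b -> cv (fun n => u n - v n) (a - b).
Proof. by move=> h1 h2; apply: cvD => //; exact: cvN. Qed.
Lemma cv_sum (I : Type) (r : seq I) (P : pred I) (u : I -> nat -> R) l :
  (forall i, P i -> cv (u i) (l i)) -> cv (fun n => \sum_(i <- r | P i) u i n) (\sum_(i <- r | P i) l i).
Proof.
move=> h; elim: r => [|i r IH].
  by apply: cv_ext (cv_const _) => n; rewrite !big_nil.
rewrite big_cons; case: ifP => Pi; last by apply: cv_ext IH => n; rewrite big_cons Pi.
by apply: cv_ext (cvD (h _ Pi) IH) => n; rewrite big_cons Pi.
Qed.
Lemma cv_prod (I : Type) (r : seq I) (u : I -> nat -> R) l :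
  (forall i, cv (u i) (l i)) -> cv (fun n => \prod_(i <- r) u i n) (\prod_(i <- r) l i).
Proof.
move=> h; elim: r => [|i r IH].
  by apply: cv_ext (cv_const _) => n; rewrite !big_nil.
by rewrite big_cons; apply: cv_ext (cvM (h i) IH) => n; rewrite big_cons.
Qed.
Lemma cv_unique u a b : cv u a -> cv u b -> a = b.
Proof. exact: UL_sequence. Qed.
Lemma cv_inv : cv (fun n => n.+1%:R^-1) 0.
Proof.
move=> e he; have [m [hm hm0]] := archimed_cor1 e he.
exists m => n hn; rewrite /R_dist RminusE subr0 -INRE -RinvE.
rewrite Rabs_pos_eq; last by apply/Rlt_le/Rinv_0_lt_compat/lt_0_INR; lia.
apply: Rle_lt_trans hm; apply: Rinv_le_contravar; first exact: lt_0_INR.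
by apply: le_INR; lia.
Qed.
Lemma cv_inv_exp j : cv (fun n => n.+1%:R^-1 ^+ j) (j == 0%N)%:R.
Proof.
elim: j => [|j IH]; first by apply: cv_ext (cv_const _) => n.
rewrite (_ : (j.+1 == 0)%:R = 0 * (j == 0%N)%:R :> R); last by rewrite mul0r.
by apply: cv_ext (cvM cv_inv IH) => n; rewrite exprS.
Qed.

Notation FF := (fser R).

Lemma cv_qs (G : nat -> nat -> FF) (H : nat -> FF) ks :
  (forall k l, cv (fun n => G n k l) (H k l)) -> cv (fun n => qs (G n) ks) (qs H ks).
Proof.
elim: ks G H => [|k ks IH] G H h /=; first exact: cv_const.
by apply: cvD => //; apply: IH => b l; exact: h.
Qed.
Lemma cv_fmul (F G : nat -> FF) (F' G' : FF) ks :
  (forall l, cv (fun n => F n l) (F' l)) -> (forall l, cv (fun n => G n l) (G' l)) ->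
  cv (fun n => fmul (F n) (G n) ks) (fmul F' G' ks).
Proof.
elim: ks F G F' G' => [|k ks IH] F G F' G' hF hG; first exact: cvM.
rewrite fmul_cons; apply: (cv_ext (u := fun n => fmul (dF k (F n)) (G n) ks + fmul (F n) (dF k (G n)) ks)) => //.
by apply: cvD; apply: IH => // l; [apply: hF | apply: hG].
Qed.

Section AsyCalculus.

Definition fcv (F : nat -> FF) (F0 : FF) := forall ks, cv (fun n => F n ks) (F0 ks).
Definition flin (X : FF -> FF) :=
  forall c F G ks, X (fun l => c * F l + G l) ks = c * X F ks + X G ks.
(* [X n = n.+1 * t n + phi + o(1)]; here and below the index [n] stands for [N = n.+1]. *)
Definition Asy (X : nat -> FF -> FF) (t : nat -> R) (phi : FF -> FF) :=
  forall F F0, fcv F F0 ->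
    fcv (fun n ks => X n (F n) ks - n.+1%:R * t n * F n ks) (phi F0).

Variables (X X' : nat -> FF -> FF) (t t' : nat -> R) (phi phi' : FF -> FF).

Lemma Asy_ext : (forall n F ks, X n F ks = X' n F ks) -> t =1 t' ->
  (forall F ks, phi F ks = phi' F ks) -> Asy X t phi -> Asy X' t' phi'.
Proof.
move=> h1 h2 h3 h F F0 hF ks; rewrite -h3.
by apply: cv_ext (h F F0 hF ks) => n; rewrite h1 h2.
Qed.

Lemma AsyD : Asy X t phi -> Asy X' t' phi' ->
  Asy (fun n F ks => X n F ks + X' n F ks) (fun n => t n + t' n) (fun F ks => phi F ks + phi' F ks).
Proof.
move=> h h' F F0 hF ks; apply: cv_ext (cvD (h F F0 hF ks) (h' F F0 hF ks)) => n; ring.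
Qed.

Lemma AsyZ c c0 : cv c c0 -> Asy X t phi ->
  Asy (fun n F ks => c n * X n F ks) (fun n => c n * t n) (fun F ks => c0 * phi F ks).
Proof.
move=> hc h F F0 hF ks; apply: cv_ext (cvM hc (h F F0 hF ks)) => n; ring.
Qed.

Lemma Asy0 : Asy (fun n F ks => 0) (fun n => 0) (fun F ks => 0).
Proof. by move=> F F0 hF ks; apply: cv_ext (cv_const 0) => n; rewrite mulr0 mul0r subr0. Qed.

(** After division by [N] only the leading scalar is left. *)
Lemma Asy_div (t0 : R) : cv t t0 -> Asy X t phi ->
  Asy (fun n F ks => n.+1%:R^-1 * X n F ks) (fun n => 0) (fun F ks => t0 * F ks).
Proof.
move=> ht h F F0 hF ks; rewrite -[t0 * _]add0r -[X in X + _](mul0r (phi F0 ks)).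
apply: cv_ext (cvD (cvM cv_inv (h F F0 hF ks)) (cvM ht (hF ks))) => n.
have N0 : n.+1%:R != 0 :> R by rewrite pnatr_eq0.
by field; rewrite ?nat1r ?natr1.
Qed.

(** Expansion of [(N t + phi) (N t' + phi') / N]: the term [phi phi' / N] vanishes in the limit. The
    product [t n * t' n] stays exact, since it is multiplied by [N] and its rate of convergence is
    unknown. *)
Lemma AsyM (t0 t0' : R) : (forall n, flin (X n)) -> cv t t0 -> cv t' t0' ->
  Asy X t phi -> Asy X' t' phi' ->
  Asy (fun n F ks => n.+1%:R^-1 * X n (X' n F) ks) (fun n => t n * t' n)
      (fun F ks => t0' * phi F ks + t0 * phi' F ks).
Proof.
move=> lX ht ht' h h' F F0 hF ks.
pose F' n ks := X' n (F n) ks - n.+1%:R * t' n * F n ks.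
have hF' : fcv F' (phi' F0) by exact: h'.
rewrite -[t0 * _]add0r -[X in _ + (X + _)](mul0r (phi (phi' F0) ks)).
apply: cv_ext (cvD (cvM ht' (h F F0 hF ks))
  (cvD (cvM cv_inv (h _ _ hF' ks)) (cvM ht (hF' ks)))) => n /=.
have -> : X' n (F n) = fun l => (n.+1%:R * t' n) * F n l + F' n l.
  by apply/funext => l; rewrite /F' addrC subrK.
rewrite lX.
have N0 : n.+1%:R != 0 :> R by rewrite pnatr_eq0.
by field; rewrite ?nat1r ?natr1.
Qed.

End AsyCalculus.

Lemma Asy_sum (I : Type) (r : seq I) (X : I -> nat -> FF -> FF) t phi :
  (forall i, Asy (X i) (t i) (phi i)) ->
  Asy (fun n F ks => \sum_(i <- r) X i n F ks) (fun n => \sum_(i <- r) t i n)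
      (fun F ks => \sum_(i <- r) phi i F ks).
Proof.
move=> h; elim: r => [|i r IH].
  by apply: Asy_ext Asy0 => [n F ks|n|F ks]; rewrite big_nil.
by apply: Asy_ext (AsyD (h i) IH) => [n F ks|n|F ks]; rewrite big_cons.
Qed.

(** * Conjugation by the generating function *)

Section Conjugation.
Variables (K : realFieldType) (theta N : K) (ell : nat -> fser K).
Notation FF := (fser K).
Implicit Types (G H : nat -> FF).

(* Conjugation by [T] replaces each derivative [d] by [d + d ln T]. *)
Definition dhatc G (c : nat) : FF := fun ks =>
  \sum_(k < c.+1) k.+1%:R * (dF k (G (c - k)%N) ks + fmul (ell k) (G (c - k)%N) ks).
Definition Ezc G (c : nat) : FF := fun ks =>
  (theta^-1 - 1) * c.+1%:R * G c.+1 ks + Qz N G c ks + theta^-1 * dhatc G c ks.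
Definition Dzc G (c : nat) : FF := fun ks =>
  Ezc G c ks + (if c is c'.+1 then Ezc G c' ks else 0) - N * G c ks.
Definition EEzc (k : nat) F : FF := Symz N (iter k Dzc (injz F)).

Section Conj.
Variable T : FF.
Hypothesis hT : forall k, dF k T = fmul (ell k) T.

Lemma Ezc_conj G c ks : Ez theta N (fun c => fmul (G c) T) c ks = fmul (Ezc G c) T ks.
Proof.
rewrite (_ : Ezc G c = fadd (fadd (fscale ((theta^-1 - 1) * c.+1%:R) (G c.+1)) (Qz N G c))
  (fscale theta^-1 (dhatc G c))) //.
rewrite (fmulDl (fadd _ _)) (fmulDl (fscale _ _)) 2!(fmulZl _ (G _), fmulZl _ (dhatc _ _)).
rewrite (_ : Qz N G c = fadd (fscale N (G c.+1)) (qs (fun k => G (c + k.+2)%N))) //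
  (fmulDl (fscale _ _)) fmulZl.
rewrite -qs_fmul /Ez /Qz; congr (_ + _ * _).
rewrite /dhat (_ : dhatc G c = fun l => \sum_(k <- index_enum 'I_c.+1)
  fscale k.+1%:R (fadd (dF k (G (c - k)%N)) (fmul (ell k) (G (c - k)%N))) l) //.
rewrite fmul_suml; apply: eq_bigr => k _; rewrite fmulZl dF_fmul hT fmulDl; congr (_ * (_ + _)).
by rewrite -fmulA [fmul (ell k) (fmul _ _)]fmulC -fmulA [fmul T _]fmulC.
Qed.

Lemma Dzc_conj G c ks : Dz theta N (fun c => fmul (G c) T) c ks = fmul (Dzc G c) T ks.
Proof.
rewrite (_ : Dzc G c = fadd (fadd (Ezc G c) (if c is c'.+1 then Ezc G c' else fun=> 0))
  (fscale (- N) (G c))); last first.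
  by apply/funext => l; rewrite /fadd /fscale /Dzc mulNr; case: c.
rewrite (fmulDl (fadd _ _)) (fmulDl (Ezc _ _)) fmulZl -Ezc_conj mulNr; case: c => [|c]; first by rewrite fmul0l.
by rewrite -Ezc_conj.
Qed.

Lemma EEzc_conj k F : EEz theta N k (fmul F T) = fmul (EEzc k F) T.
Proof.
have -> : EEz theta N k (fmul F T) = Symz N (fun c => fmul (iter k Dzc (injz F) c) T).
  rewrite /EEz; congr Symz; elim: k => [|k IH].
    by apply/funext => -[|c] //; apply/funext => l; rewrite /injz /= fmul0l.
  by rewrite !iterS IH; apply/funext => c; apply/funext => l; rewrite Dzc_conj.
apply/funext => ks; rewrite /Symz (qs_fmul (fun a => iter k Dzc (injz F) a.+1)).
by rewrite /EEzc /Symz (fmulDl (fscale N _)) fmulZl.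
Qed.

End Conj.

Lemma Ezc_lin a G H c ks :
  Ezc (fun c l => a * G c l + H c l) c ks = a * Ezc G c ks + Ezc H c ks.
Proof.
rewrite /Ezc /Qz.
have -> : qs (fun k l => a * G (c + k.+2)%N l + H (c + k.+2)%N l) ks =
   a * qs (fun k => G (c + k.+2)%N) ks + qs (fun k => H (c + k.+2)%N) ks.
  by rewrite -qsZ -qsD.
have -> : dhatc (fun c l => a * G c l + H c l) c ks = a * dhatc G c ks + dhatc H c ks.
  rewrite /dhatc mulr_sumr -big_split; apply: eq_bigr => k _ /=.
  rewrite (_ : (fun l => a * G (c - k)%N l + H (c - k)%N l) =
     fadd (fscale a (G (c - k)%N)) (H (c - k)%N)) // fmulDr fmulZr /dF /fadd /fscale; ring.
ring.
Qed.

Lemma Dzc_lin a G H c ks :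
  Dzc (fun c l => a * G c l + H c l) c ks = a * Dzc G c ks + Dzc H c ks.
Proof.
rewrite /Dzc Ezc_lin; case: c => [|c]; first by ring.
by rewrite Ezc_lin; ring.
Qed.

Lemma iter_Dzc_lin a k G H : iter k Dzc (fun c l => a * G c l + H c l) =
  fun c l => a * iter k Dzc G c l + iter k Dzc H c l.
Proof.
elim: k => [|k IH] //; rewrite !iterS IH.
by apply/funext => c; apply/funext => l; rewrite Dzc_lin.
Qed.

Lemma EEzc_lin k a F F' ks : EEzc k (fun l => a * F l + F' l) ks = a * EEzc k F ks + EEzc k F' ks.
Proof.
have E : injz (fun l => a * F l + F' l) = fun c l => a * injz F c l + injz F' c l.
  by apply/funext => -[|c] //; apply/funext => l; rewrite /injz /= mulr0 addr0.
rewrite /EEzc E iter_Dzc_lin /Symz (qsD (fun k l => a * _)) qsZ; ring.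
Qed.

End Conjugation.

(** On a fixed list the linear form acts as a finite sum, so that linear operators can be moved
    through it. *)
Lemma qF_nth (K : realFieldType) (al : nat -> K) (F : fser K) ks :
  qF al F ks = \sum_(i < size ks) al (nth 0%N ks i) * F (take i ks ++ drop i.+1 ks).
Proof.
elim: ks F => [|k ks IH] F; first by rewrite qF_nil big_ord0.
rewrite qF_cons big_ord_recl /= drop0 IH; congr (_ + _).
Qed.

Section ToepLinear.
Variable K : realFieldType.
Implicit Types (u g h : fps K).

Lemma toep_lin u a g h c : toep u (fun c => a * g c + h c) c = a * toep u g c + toep u h c.
Proof.
have E b : toepE u (fun c => a * g c + h c) b = a * toepE u g b + toepE u h b.
  rewrite /toepE !fpsM; set S := \sum_(i < _) _.
  have -> : S = a * (\sum_(i < b.+1) u i * g (b - i)%N) + \sum_(i < b.+1) u i * h (b - i)%N.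
    by rewrite mulr_sumr -big_split; apply: eq_bigr => i _ /=; ring.
  ring.
rewrite /toep E; case: c => [|c]; first by ring.
by rewrite E; ring.
Qed.
Lemma toep_zero u c : toep u (fun=> 0) c = 0.
Proof.
have := toep_lin u (-1) (fun=> 0) (fun=> 0) c.
have -> : (fun c : nat => -1 * 0 + 0 : K) = (fun=> 0) by apply/funext => b; rewrite mulr0 addr0.
by move=> ->; ring.
Qed.
Lemma toep_sum (I : Type) (r : seq I) u (a : I -> K) (g : I -> fps K) c :
  toep u (fun c => \sum_(i <- r) a i * g i c) c = \sum_(i <- r) a i * toep u (g i) c.
Proof.
elim: r => [|i r IH].
  rewrite big_nil -[RHS](toep_zero u c); congr toep.
  by apply/funext => b; rewrite big_nil.
rewrite big_cons -IH -toep_lin; congr toep; apply/funext => b; exact: big_cons.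
Qed.

End ToepLinear.

Lemma cv_toep (u : nat -> fps R) (v : fps R) (g : nat -> fps R) (h : fps R) c :
  (forall i, cv (fun n => u n i) (v i)) ->
  (forall i, (i <= c.+1)%N -> cv (fun n => g n i) (h i)) ->
  cv (fun n => toep (u n) (g n) c) (toep v h c).
Proof.
move=> hu hg.
have E b : (b <= c)%N -> cv (fun n => toepE (u n) (g n) b) (toepE v h b).
  move=> hb; apply: cvD; first exact: hg.
  apply: cv_sum => i _; apply: cvM; first exact: hu.
  by apply: hg; lia.
apply: cvB; last by apply: hg; lia.
apply: cvD; first exact: E.
by case: c E {hg} => [|c] E; [exact: cv_const | apply: E].
Qed.

(** * First order expansion of powers of the Lax operator *)

Section OperatorAsymptotics.
Variables (theta : R) (ell : nat -> nat -> FF).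
Variables (v : fps R) (dh : nat -> nat -> R).
Let u n : fps R := fun i => theta^-1 * i.+1%:R * ell n i [::] / n.+1%:R.
Hypothesis cv_u : forall i, cv (fun n => u n i) (v i).
Hypothesis cv_ell1 : forall i b, cv (fun n => ell n i [:: b]) (dh i b).
Hypothesis cv_ell2 : forall i a b ks, cv (fun n => ell n i [:: a, b & ks]) 0.

Let ello n i : FF := fun ks => if ks == [::] then 0 else ell n i ks.
(** What remains of [Ezc] once its part of order [N], the Toeplitz operator [N * toepE (u n)], has
    been split off. *)
Let Edel n (G : nat -> FF) (c : nat) : FF := fun ks =>
  (theta^-1 - 1) * c.+1%:R * G c.+1 ks + qs (fun k => G (c + k.+2)%N) ks
  + theta^-1 * \sum_(i < c.+1) i.+1%:R * (dF i (G (c - i)%N) ks + fmul (ello n i) (G (c - i)%N) ks).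
Let Del n G c : FF := fun ks => Edel n G c ks + (if c is c'.+1 then Edel n G c' ks else 0).
Let DN n (G : nat -> FF) (c : nat) : FF := fun ks => n.+1%:R^-1 * Dzc theta n.+1%:R (ell n) G c ks.

Let N0 n : n.+1%:R != 0 :> R. Proof. by rewrite pnatr_eq0. Qed.

Let EzcE n G c ks : n.+1%:R^-1 * Ezc theta n.+1%:R (ell n) G c ks =
  toepE (u n) (fun c => G c ks) c + n.+1%:R^-1 * Edel n G c ks.
Proof.
rewrite /Ezc /Qz /toepE /Edel fpsM.
have -> : dhatc (ell n) G c ks = \sum_(i < c.+1) i.+1%:R * (ell n i [::] * G (c - i)%N ks) +
   \sum_(i < c.+1) i.+1%:R * (dF i (G (c - i)%N) ks + fmul (ello n i) (G (c - i)%N) ks).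
  rewrite -big_split; apply: eq_bigr => i _ /=.
  have -> : fmul (ell n i) (G (c - i)%N) ks =
     ell n i [::] * G (c - i)%N ks + fmul (ello n i) (G (c - i)%N) ks.
    rewrite -[G _ ks in RHS](congr1 (fun f : FF => f ks) (fmul1l (G (c - i)%N))) -fmulZl -fmulDl.
    congr fmul; apply/funext => l; rewrite /fadd /fscale /funit /ello.
    by case: eqP => [->|_]; rewrite ?mulr1 ?addr0 // mulr0 add0r.
  ring.
have -> : \sum_(i < c.+1) u n i * G (c - i)%N ks =
  theta^-1 / n.+1%:R * \sum_(i < c.+1) i.+1%:R * (ell n i [::] * G (c - i)%N ks).
  by rewrite mulr_sumr; apply: eq_bigr => i _; rewrite /u; ring.
set A := \sum_(i < _) _; set B := \sum_(i < _) _; move: (theta^-1) => t.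
have hN := N0 n; field; rewrite ?nat1r ?natr1; exact: hN.
Qed.

Let DNE n G c ks : DN n G c ks = toep (u n) (fun c => G c ks) c + n.+1%:R^-1 * Del n G c ks.
Proof.
rewrite /DN /Dzc mulrBr mulrDr EzcE /toep /Del mulKf ?N0 //.
case: c => [|c]; first by rewrite mulr0 !addr0; ring.
by rewrite EzcE; ring.
Qed.

Let sh (f : nat -> R) c := f c + (if c is c'.+1 then f c' else 0).
Let Elim (H : nat -> FF) ks c :=
  (theta^-1 - 1) * c.+1%:R * H c.+1 ks + qs (fun k => H (c + k.+2)%N) ks
  + theta^-1 * \sum_(i < c.+1) i.+1%:R * (dF i (H (c - i)%N) ks + qF (dh i) (H (c - i)%N) ks).
Let cv_Del (G : nat -> nat -> FF) (H : nat -> FF) c ks :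
  (forall b l, cv (fun n => G n b l) (H b l)) ->
  cv (fun n => Del n (G n) c ks)
   (sh (Elim H ks) c).
Proof.
move=> hG.
have E b : cv (fun n => Edel n (G n) b ks) (Elim H ks b).
  apply: cvD; first apply: cvD.
  - by apply: cvZ.
  - by apply: cv_qs => k l; exact: hG.
  apply: cvZ; apply: cv_sum => i _; apply: cvZ; apply: cvD; first exact: hG.
  rewrite -fmul_lone; apply: cv_fmul => [l|l]; last exact: hG.
  case: l => [|b1 [|b2 l]]; rewrite /ello /=; [exact: cv_const | exact: cv_ell1 | exact: cv_ell2].
apply: cvD; first exact: E.
by case: c => [|c]; [exact: cv_const | exact: E].
Qed.

Variables (F : nat -> FF) (F0 : FF).
Hypothesis hF : fcv F F0.
Let G n j := iter j (DN n) (injz (F n)).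

Let G_cv j c ks : cv (fun n => G n j c ks) (toepg v j c * F0 ks).
Proof.
elim: j c ks => [|j IH] c ks.
  case: c => [|c]; first by rewrite /toepg /= fps1 mul1r; exact: hF.
  by rewrite /toepg /= fps1 mul0r; exact: cv_const.
have -> : toepg v j.+1 c * F0 ks = toep v (fun c => toepg v j c * F0 ks) c +
   0 * sh (Elim (fun c ks => toepg v j c * F0 ks) ks) c.
  rewrite mul0r addr0 mulrC -[LHS]addr0 -(toep_zero v c) -toep_lin.
  by congr toep; apply/funext => b; rewrite addr0 mulrC.
apply: cv_ext (cvD (cv_toep cv_u (fun i _ => IH i ks)) (cvM cv_inv (cv_Del c ks IH))) => n.
by rewrite /= -DNE.
Qed.

(** The deviation of the [j]-th iterate from its Toeplitz approximation, magnified by [N]. The exact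
    symbol [u n] is subtracted, not its limit. *)
Let rho n j c ks : R := n.+1%:R * (G n j c ks - toepg (u n) j c * F n ks).

Let rhoS n j c ks :
  rho n j.+1 c ks = toep (u n) (fun c => rho n j c ks) c + Del n (G n j) c ks.
Proof.
rewrite {1}/rho /G iterS -/(G n j) DNE {1}/toepg iterS -/(toepg (u n) j).
have -> : (fun c => rho n j c ks) = fun c => (- n.+1%:R * F n ks) * toepg (u n) j c +
   (n.+1%:R * G n j c ks + 0).
  by apply/funext => b; rewrite /rho; ring.
rewrite toep_lin toep_lin toep_zero.
have hN := N0 n; move: (Del _ _ _ _) => D; move: (toep _ _ _) => A; move: (toep _ _ _) => B.
by field; rewrite ?nat1r ?natr1.
Qed.

(** The limiting perturbation has three components: this scalar one, [opd] for the coefficient of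
    [d/dq_(a+1)], and [opq] for that of [q_(b+1)], where the second logarithmic derivatives [dh]
    enter. *)
Definition opm (g : fps R) : fps R := fun c => (theta^-1 - 1) * c.+1%:R * g c.+1.
Definition opd (a : nat) (g : fps R) : fps R := fun c => theta^-1 * a.+1%:R * (if (a <= c)%N then g (c - a)%N else 0).
Definition opq (b : nat) (g : fps R) : fps R := fun c =>
  g (c + b.+2)%N + \sum_(i < c.+1) (theta^-1 * i.+1%:R * dh i b) * g (c - i)%N.

Variable B : nat.
(** A derivative of index [a] enters coefficient [c] only if [a <= c], and each step reaches one
    order further; under [c + j <= B] the cutoff at [B] omits nothing. *)
Definition rhol j c (H : FF) : FF := fun ks =>
  toepd v opm j c * H ks + qF (fun b => toepd v (opq b) j c) H ks
  + \sum_(a < B) toepd v (opd a) j c * dF a H ks.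

Let rholS j c ks : (c < B)%N -> rhol j.+1 c F0 ks = toep v (fun c => rhol j c F0 ks) c +
   sh (Elim (fun c ks => toepg v j c * F0 ks) ks) c.
Proof.
move=> hc.
have dS P c0 : toepd v P j.+1 c0 = toep v (toepd v P j) c0 + sh (P (toepg v j)) c0.
  rewrite /= fpsD; congr (_ + _); rewrite /sh; case: c0 => [|c0]; last exact: fps_z1M.
  by rewrite mulrDl mul1r fpsD fpsXM.
set H := fun (c : nat) ks => toepg v j c * F0 ks.
set E := Elim H ks.
have EE b : (b < B)%N -> E b = opm (toepg v j) b * F0 ks + qF (fun b' => opq b' (toepg v j) b) F0 ks
    + \sum_(a < B) opd a (toepg v j) b * dF a F0 ks.
  move=> hb; rewrite /E /Elim.
  have -> : \sum_(a < B) opd a (toepg v j) b * dF a F0 ks =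
      theta^-1 * \sum_(i < b.+1) i.+1%:R * dF i (H (b - i)%N) ks.
    rewrite (big_ord_widen_cond B (fun _ => true) (fun i => i.+1%:R * dF i (H (b - i)%N) ks)) //.
    rewrite mulr_sumr [RHS]big_mkcond; apply: eq_bigr => a _.
    by rewrite /opd ltnS /=; case: ifP => _; rewrite /H /dF; ring.
  have -> : qF (fun b' => opq b' (toepg v j) b) F0 ks = qs (fun k => H (b + k.+2)%N) ks +
      theta^-1 * \sum_(i < b.+1) i.+1%:R * qF (dh i) (H (b - i)%N) ks.
    rewrite /opq qFD; congr (_ + _).
    rewrite (_ : (fun k => _) = fun k => \sum_(i < b.+1) (theta^-1 * i.+1%:R * toepg v j (b - i)%N) * dh i k); last first.
      by apply/funext => k; apply: eq_bigr => i _; ring.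
    rewrite qF_sum mulr_sumr; apply: eq_bigr => i _; rewrite -!mulrA; congr (_ * (_ * _)).
    rewrite /qF -qsZ; congr qs; apply/funext => k; apply/funext => l; rewrite /H; ring.
  have -> : \sum_(i < b.+1) i.+1%:R * (dF i (H (b - i)%N) ks + qF (dh i) (H (b - i)%N) ks) =
     \sum_(i < b.+1) i.+1%:R * dF i (H (b - i)%N) ks + \sum_(i < b.+1) i.+1%:R * qF (dh i) (H (b - i)%N) ks.
    by rewrite -big_split; apply: eq_bigr => i _; rewrite mulrDr.
  rewrite /opm /H; ring.
have -> : sh E c = sh (opm (toepg v j)) c * F0 ks +
    qF (fun b => sh (opq b (toepg v j)) c) F0 ks + \sum_(a < B) sh (opd a (toepg v j)) c * dF a F0 ks.
  rewrite /sh; case: c hc => [|c] hc.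
    rewrite !addr0 EE //; congr (_ + _ + _); last by apply: eq_bigr => a _; rewrite addr0.
    by apply: eq_qF => b; rewrite addr0.
  rewrite !EE //; last by lia.
  rewrite (qFD (fun b => opq b (toepg v j) c.+1) (fun b => opq b (toepg v j) c)) [X in _ = _ + X](eq_bigr (fun a : 'I_B => opd a (toepg v j) c.+1 * dF a F0 ks +
     opd a (toepg v j) c * dF a F0 ks)) => [|a _]; last by rewrite mulrDl.
  rewrite big_split /=; ring.
rewrite {1}/rhol dS (eq_qF _ _ (fun b => dS (opq b) c)) qFD.
rewrite (eq_bigr (fun a : 'I_B => toep v (toepd v (opd a) j) c * dF a F0 ks + sh (opd a (toepg v j)) c * dF a F0 ks)) => [|a _]; last first.
  by rewrite dS mulrDl.
rewrite big_split /=.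
have -> : toep v (fun c => rhol j c F0 ks) c = toep v (toepd v opm j) c * F0 ks +
   qF (fun b => toep v (toepd v (opq b) j) c) F0 ks + \sum_(a < B) toep v (toepd v (opd a) j) c * dF a F0 ks.
  rewrite qF_nth.
  have -> : (fun c => rhol j c F0 ks) = fun c => F0 ks * toepd v opm j c +
     (1 * (\sum_(i < size ks) F0 (take i ks ++ drop i.+1 ks) * toepd v (opq (nth 0%N ks i)) j c)
      + (\sum_(a < B) dF a F0 ks * toepd v (opd a) j c)).
    apply/funext => b; rewrite /rhol qF_nth mul1r addrA mulrC; congr (_ + _ + _).
      by apply: eq_bigr => i _; rewrite mulrC.
    by apply: eq_bigr => i _; rewrite mulrC.
  rewrite toep_lin toep_lin !toep_sum mul1r addrA [_ * F0 ks]mulrC; congr (_ + _ + _).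
    by apply: eq_bigr => i _; rewrite mulrC.
  by apply: eq_bigr => i _; rewrite mulrC.
rewrite mulrDl; ring.
Qed.

Let rho_cv j c ks : (c + j <= B)%N -> cv (fun n => rho n j c ks) (rhol j c F0 ks).
Proof.
elim: j c => [|j IH] c hc.
  have -> : rhol 0 c F0 ks = 0.
    have d0 P c0 : toepd v P 0 c0 = 0 by [].
    rewrite /rhol d0 mul0r add0r big1 => [|a _]; last by rewrite d0 mul0r.
    by rewrite qF_nth big1 ?addr0 // => i _; rewrite d0 mul0r.
  apply: cv_ext (cv_const 0) => n; rewrite /rho /G /injz; case: c {hc} => [|c].
    by rewrite /toepg /= fps1 mul1r subrr mulr0.
  by rewrite /toepg /= fps1 mul0r subrr mulr0.
rewrite rholS; last by lia.
apply: cv_ext (cvD (cv_toep cv_u (fun i hi => IH i _)) (cv_Del c ks (@G_cv j))) => [n|]; last by lia.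
by rewrite /= rhoS.
Qed.

Let iterG n k : iter k (Dzc theta n.+1%:R (ell n)) (injz (F n)) =
  fun c ks => n.+1%:R ^+ k * G n k c ks.
Proof.
elim: k => [|k IH]; first by apply/funext => c; apply/funext => ks; rewrite expr0 mul1r.
rewrite iterS IH; apply/funext => c; apply/funext => ks.
have E b : b = 0 -> Dzc theta n.+1%:R (ell n) (fun c ks => n.+1%:R ^+ k * G n k c ks) c ks =
  n.+1%:R ^+ k * Dzc theta n.+1%:R (ell n) (G n k) c ks + b.
  move=> ->; have Z : Dzc theta n.+1%:R (ell n) (fun _ _ => 0) c ks = 0.
    have := Dzc_lin theta n.+1%:R (ell n) (-1) (fun _ _ => 0) (fun _ _ => 0) c ks.
    have -> : (fun (c : nat) (l : seq nat) => -1 * 0 + 0 : R) = (fun _ _ => 0).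
      by apply/funext => b'; apply/funext => l; rewrite mulr0 addr0.
    by move=> ->; ring.
  rewrite -[X in _ + X]Z -Dzc_lin; congr (Dzc _ _ _ _ _ _).
  by apply/funext => b'; apply/funext => l; rewrite addr0.
rewrite (E 0) // addr0 /G iterS /DN -/(G n k) exprS.
by rewrite mulrCA -!mulrA mulKf ?N0 // mulrC.
Qed.

(** The additional [toepg v k b.+1] is the contribution of the variables [q] in the final pairing
    [Symz]. *)
Definition phiX k (H : FF) : FF := fun ks =>
  toepd v opm k 0%N * H ks + qF (fun b => toepd v (opq b) k 0%N + toepg v k b.+1) H ks
  + \sum_(a < B) toepd v (opd a) k 0%N * dF a H ks.

Lemma EEzc_cv k ks : (k <= B)%N ->
  cv (fun n => n.+1%:R^-1 ^+ k * EEzc theta n.+1%:R (ell n) k (F n) ks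
               - n.+1%:R * toept (u n) k * F n ks) (phiX k F0 ks).
Proof.
move=> hk.
have -> : phiX k F0 ks = rhol k 0%N F0 ks + qs (fun b l => toepg v k b.+1 * F0 l) ks.
  by rewrite /phiX qFD /rhol -/(qF (fun b => toepg v k b.+1) F0 ks); ring.
apply: cv_ext (cvD (rho_cv ks (_ : 0 + k <= B)%N) (cv_qs ks (fun b l => G_cv k b.+1 l))) => [n|//].
rewrite /EEzc iterG /Symz /= qsZ /rho /toept.
have hN : n.+1%:R ^+ k != 0 :> R by rewrite expf_neq0 ?N0.
by rewrite exprVn; field.
Qed.

End OperatorAsymptotics.

(** * Power sums of the coordinates *)

Section StrongRecursion.
Variables (A : Type) (x0 : A) (Phi : nat -> (nat -> A) -> A).
Fixpoint strong_approx n : nat -> A := if n is m.+1 then fun k => Phi k (strong_approx m) else fun=> x0.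
Definition strong_rec k := strong_approx k.+1 k.
Hypothesis Phi_ext : forall k f g, (forall i, (i < k)%N -> f i = g i) -> Phi k f = Phi k g.
Lemma strong_recE k : strong_rec k = Phi k strong_rec.
Proof.
have H m : forall n j, (j < n)%N -> (j < m)%N -> strong_approx n j = strong_approx m j.
  elim: m => [|m IH] [|n] j //= hn hm; apply: Phi_ext => i hi.
  by apply: IH; [exact: leq_trans hi hn | exact: leq_trans hi hm].
by rewrite /strong_rec /=; apply: Phi_ext => i hi; rewrite -[RHS]/(strong_approx i.+1 i); by apply: H.
Qed.
End StrongRecursion.

Section PowerSumOperators.
Variables (K : realFieldType) (N : K) (X : nat -> fser K -> fser K).
Notation FF := (fser K).
Hypothesis X_lin : forall k a F G ks, X k (fun l => a * F l + G l) ks = a * X k F ks + X k G ks.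

(* The recursions mirror [rowE_logder] and [psum_rec], rescaled by powers of [N]. *)
Definition Vop : nat -> FF -> FF := strong_rec (fun F ks => 0) (fun k V F ks =>
  if k is k'.+1 then k'.+1%:R * X k' F ks + \sum_(i < k'.+1) N^-1 * X i (V (k' - i)%N F) ks else 0).
Definition Yop : nat -> FF -> FF := strong_rec (fun F ks => 0) (fun k Y F ks =>
  k.+1%:R^-1 * Vop k.+1 F ks + \sum_(j < k) k.+1%:R^-1 * ((-1) ^+ j * 'C(k.+1, j.+2)%:R * N^-1 ^+ j)
     * (N^-1 * Y (k.-1 - j)%N F ks)).

Lemma Vop0 F ks : Vop 0 F ks = 0. Proof. by []. Qed.
Lemma VopS k F ks : Vop k.+1 F ks =
  k.+1%:R * X k F ks + \sum_(i < k.+1) N^-1 * X i (Vop (k - i)%N F) ks.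
Proof.
rewrite /Vop strong_recE // => -[|k'] f g h //; apply/funext => H; apply/funext => l.
by congr (_ + _); apply: eq_bigr => i _; rewrite h // ltnS leq_subr.
Qed.
Lemma YopE k F ks : Yop k F ks =
  k.+1%:R^-1 * Vop k.+1 F ks + \sum_(j < k) k.+1%:R^-1 * ((-1) ^+ j * 'C(k.+1, j.+2)%:R * N^-1 ^+ j)
     * (N^-1 * Yop (k.-1 - j)%N F ks).
Proof.
rewrite {1}/Yop strong_recE // => k' f g h; apply/funext => H; apply/funext => l.
by congr (_ + _); apply: eq_bigr => i _; rewrite h //; have := ltn_ord i; lia.
Qed.

Lemma Vop_ind (P : nat -> (FF -> FF) -> Prop) :
  P 0%N (fun F ks => 0) ->
  (forall k V, (forall i, (i <= k)%N -> P i (V i)) ->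
     P k.+1 (fun F ks => k.+1%:R * X k F ks + \sum_(i < k.+1) N^-1 * X i (V (k - i)%N F) ks)) ->
  forall k, P k (Vop k).
Proof.
move=> P0 PS; elim/ltn_ind => -[|k] IH; first exact: P0.
have -> : Vop k.+1 = fun F ks => k.+1%:R * X k F ks + \sum_(i < k.+1) N^-1 * X i (Vop (k - i)%N F) ks.
  by apply/funext => F; apply/funext => ks; rewrite VopS.
by apply: PS => i hi; apply: IH.
Qed.

Lemma Yop_ind (P : nat -> (FF -> FF) -> Prop) :
  (forall k Y, (forall i, (i < k)%N -> P i (Y i)) ->
     P k (fun F ks => k.+1%:R^-1 * Vop k.+1 F ks
       + \sum_(j < k) k.+1%:R^-1 * ((-1) ^+ j * 'C(k.+1, j.+2)%:R * N^-1 ^+ j) * (N^-1 * Y (k.-1 - j)%N F ks))) ->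
  forall k, P k (Yop k).
Proof.
move=> PS; elim/ltn_ind => k IH.
have -> : Yop k = fun F ks => k.+1%:R^-1 * Vop k.+1 F ks
       + \sum_(j < k) k.+1%:R^-1 * ((-1) ^+ j * 'C(k.+1, j.+2)%:R * N^-1 ^+ j) * (N^-1 * Yop (k.-1 - j)%N F ks).
  by apply/funext => F; apply/funext => ks; rewrite YopE.
exact: PS.
Qed.

Definition fflin (Z : FF -> FF) := forall a F G ks, Z (fun l => a * F l + G l) ks = a * Z F ks + Z G ks.

Lemma fflin0 Z F ks : fflin Z -> (forall l, F l = 0) -> Z F ks = 0.
Proof.
move=> lZ F0; have -> : F = (fun l => (-1) * F l + F l) by apply/funext => l; rewrite F0 mulr0 addr0.
have -> : F = (fun=> 0) by apply/funext.
by rewrite lZ; ring.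
Qed.
Lemma fflinZ Z a F ks : fflin Z -> Z (fun l => a * F l) ks = a * Z F ks.
Proof.
move=> lZ; rewrite -[RHS]addr0 -(@fflin0 Z (fun=> 0) ks lZ) // -lZ.
by congr Z; apply/funext => l; rewrite addr0.
Qed.
Lemma fflin_sum (I : Type) (r : seq I) Z (a : I -> K) (F : I -> FF) ks : fflin Z ->
  Z (fun l => \sum_(i <- r) a i * F i l) ks = \sum_(i <- r) a i * Z (F i) ks.
Proof.
move=> lZ; elim: r => [|i r IH]; first by rewrite big_nil fflin0 // => l; rewrite big_nil.
rewrite big_cons -IH -lZ; congr Z; apply/funext => l; exact: big_cons.
Qed.

Lemma Vop_lin k : fflin (Vop k).
Proof.
move: k; apply: (@Vop_ind (fun _ V => fflin V)) => [|k V IH] a F G ks; first by rewrite mulr0 addr0.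
rewrite X_lin mulrDr [a * (_ + _)]mulrDr mulr_sumr addrACA -big_split; congr (_ + _); first by ring.
apply: eq_bigr => i _ /=.
rewrite (_ : V (k - i)%N _ = fun l => a * V (k - i)%N F l + V (k - i)%N G l) ?X_lin; last first.
  by apply/funext => l; rewrite IH ?leq_subr.
ring.
Qed.

Lemma Yop_lin k : fflin (Yop k).
Proof.
move: k; apply: (@Yop_ind (fun _ V => fflin V)) => k V IH a F G ks.
rewrite Vop_lin; move: (Vop k.+1 F ks) (Vop k.+1 G ks) => v w.
rewrite mulrDr [a * (_ + _)]mulrDr mulr_sumr addrACA -big_split; congr (_ + _); first by ring.
apply: eq_bigr => i _ /=; rewrite IH; last by have := ltn_ord i; lia.
ring.
Qed.


Section Eigen.
Variables (F : FF) (e : nat -> K).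
Hypothesis F_eigen : forall k ks, X k F ks = e k * F ks.

Lemma Vop_eigen (w : nat -> K) : w 0%N = 0 ->
  (forall k, w k.+1 = k.+1%:R * e k + \sum_(i < k.+1) N^-1 * (e i * w (k - i)%N)) ->
  forall k ks, Vop k F ks = w k * F ks.
Proof.
move=> w0 wS k; move: k; apply: (@Vop_ind (fun k V => forall ks, V F ks = w k * F ks)) => [|k V IH] ks.
  by rewrite w0 mul0r.
rewrite wS mulrDl F_eigen mulrA mulr_suml; congr (_ + _); apply: eq_bigr => i _.
rewrite (_ : V (k - i)%N F = fun l => w (k - i)%N * F l); last first.
  by apply/funext => l; rewrite IH ?leq_subr.
by rewrite fflinZ ?F_eigen; [ring | exact: X_lin].
Qed.

Lemma Yop_eigen (w y : nat -> K) : (forall k ks, Vop k F ks = w k * F ks) ->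
  (forall k, y k = k.+1%:R^-1 * w k.+1 + \sum_(j < k) k.+1%:R^-1 * ((-1) ^+ j * 'C(k.+1, j.+2)%:R * N^-1 ^+ j)
     * (N^-1 * y (k.-1 - j)%N)) ->
  forall k ks, Yop k F ks = y k * F ks.
Proof.
move=> hw hy k; move: k; apply: (@Yop_ind (fun k V => forall ks, V F ks = y k * F ks)) => k V IH ks.
rewrite hy mulrDl hw mulrA mulr_suml; congr (_ + _); apply: eq_bigr => i _.
by rewrite IH; [ring | have := ltn_ord i; lia].
Qed.
End Eigen.

End PowerSumOperators.

Section ConjugatePowerSums.
Variables (K : realFieldType) (N : K) (X X' : nat -> fser K -> fser K) (T : fser K).
Hypothesis XT : forall k F, X k (fmul F T) = fmul (X' k F) T.

Lemma fmul_comb (I : Type) (r : seq I) (a c : K) (A B : fser K) (b : I -> K) (F : I -> fser K) ks :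
  fmul (fun l => a * A l + \sum_(i <- r) b i * F i l) T ks =
  a * fmul A T ks + \sum_(i <- r) b i * fmul (F i) T ks.
Proof.
rewrite (fmulDl (fscale a A)) fmulZl; congr (_ + _).
by rewrite (fmul_suml r (fun i => fscale (b i) (F i))); apply: eq_bigr => i _; rewrite fmulZl.
Qed.

Lemma Vop_conj k F : Vop N X k (fmul F T) = fmul (Vop N X' k F) T.
Proof.
apply/funext => ks; elim/ltn_ind: k F ks => -[|k] IH F ks; first by rewrite Vop0 fmul0l.
have -> : Vop N X' k.+1 F = fun l => k.+1%:R * X' k F l + \sum_(i <- index_enum 'I_k.+1) N^-1 * X' i (Vop N X' (k - i)%N F) l.
  by apply/funext => l; rewrite VopS.
rewrite fmul_comb // VopS XT; congr (_ + _); apply: eq_bigr => i _.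
rewrite -XT; congr (_ * X _ _ _); apply/funext => l; apply: IH; lia.
Qed.

Lemma Yop_conj k F : Yop N X k (fmul F T) = fmul (Yop N X' k F) T.
Proof.
apply/funext => ks; elim/ltn_ind: k F ks => k IH F ks.
have -> : Yop N X' k F = fun l => k.+1%:R^-1 * Vop N X' k.+1 F l
       + \sum_(j <- index_enum 'I_k) (k.+1%:R^-1 * ((-1) ^+ j * 'C(k.+1, j.+2)%:R * N^-1 ^+ j) * N^-1) * Yop N X' (k.-1 - j)%N F l.
  by apply/funext => l; rewrite YopE; congr (_ + _); apply: eq_bigr => j _; rewrite mulrA.
rewrite fmul_comb // YopE Vop_conj; congr (_ + _); apply: eq_bigr => i _.
by rewrite IH ?mulrA //; have := ltn_ord i; lia.
Qed.

End ConjugatePowerSums.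

Section ContinuousPowerSums.
Variables (N : R) (X : nat -> FF -> FF).
Definition fcont (Z : FF -> FF) := forall F F0, fcv F F0 -> fcv (fun n => Z (F n)) (Z F0).
Hypothesis X_cont : forall k, fcont (X k).

Lemma Vop_cont k : fcont (Vop N X k).
Proof.
move: k; apply: (@Vop_ind R N X (fun _ V => fcont V)) => [|k V IH] F F0 hF ks; first exact: cv_const.
apply: cvD; first by apply: cvZ; exact: X_cont.
apply: cv_sum => i _; apply: cvZ; apply: X_cont => l; apply: IH => //; exact: leq_subr.
Qed.

Lemma Yop_cont k : fcont (Yop N X k).
Proof.
move: k; apply: (@Yop_ind R N X (fun _ V => fcont V)) => k V IH F F0 hF ks.
apply: cvD; first by apply: cvZ; exact: Vop_cont.
apply: cv_sum => i _; apply: cvZ; apply: cvZ; apply: IH => //; have := ltn_ord i; lia.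
Qed.
End ContinuousPowerSums.

Section Fields.
Variable B : nat.
(** First order operators [m + sum_b al b * q_(b+1) + sum_a be a * d/dq_(a+1)], the shape of every
    limit below. *)
Definition fld (m : R) (al be : nat -> R) (H : FF) : FF := fun ks =>
  m * H ks + qF al H ks + \sum_(a < B) be a * dF a H ks.

Lemma fld_comb (I : Type) (r : seq I) (c : I -> R) m al be H ks :
  fld (\sum_(i <- r) c i * m i) (fun b => \sum_(i <- r) c i * al i b) (fun a => \sum_(i <- r) c i * be i a) H ks =
  \sum_(i <- r) c i * fld (m i) (al i) (be i) H ks.
Proof.
rewrite /fld qF_sum mulr_suml.
have -> : \sum_(a < B) (\sum_(i <- r) c i * be i a) * dF a H ks =
  \sum_(i <- r) c i * \sum_(a < B) be i a * dF a H ks.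
  under eq_bigr do rewrite mulr_suml.
  rewrite exchange_big /=; apply: eq_bigr => i _; rewrite mulr_sumr.
  by apply: eq_bigr => a _; rewrite mulrA.
by rewrite -!big_split /=; apply: eq_bigr => i _; ring.
Qed.
Lemma fld_ext m m' al al' be be' H ks : m = m' -> al =1 al' -> (forall a, (a < B)%N -> be a = be' a) ->
  fld m al be H ks = fld m' al' be' H ks.
Proof.
move=> -> ha hb; rewrite /fld (eq_qF _ _ ha); congr (_ + _).
by apply: eq_bigr => a _; rewrite hb.
Qed.
Lemma fldD c d m m' al al' be be' H ks :
  c * fld m al be H ks + d * fld m' al' be' H ks =
  fld (c * m + d * m') (fun b => c * al b + d * al' b) (fun a => c * be a + d * be' a) H ks.
Proof.
have := fld_comb [:: true; false] (fun i => if i then c else d) (fun i => if i then m else m')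
  (fun i => if i then al else al') (fun i => if i then be else be') H ks.
rewrite !big_cons !big_nil !addr0 => <-.
by apply: fld_ext => [|b|a _]; rewrite ?big_cons ?big_nil ?addr0.
Qed.
Lemma fld0 H ks : fld 0 (fun=> 0) (fun=> 0) H ks = 0.
Proof.
rewrite /fld mul0r add0r big1 => [|a _]; last by rewrite mul0r.
by rewrite qF_nth big1 ?addr0 // => i _; rewrite mul0r.
Qed.
Lemma fld_mean m H ks : fld m (fun=> 0) (fun=> 0) H ks = m * H ks.
Proof.
have := fldD m 0 1 0 (fun=> 0) (fun=> 0) (fun=> 0) (fun=> 0) H ks.
rewrite {1}/fld !mul0r addr0 mul1r big1 => [|a _]; last by rewrite mul0r.
rewrite qF_nth big1 => [|i _]; last by rewrite mul0r.
by rewrite !addr0 mulr1 => ->; apply: fld_ext => // [b|a _]; rewrite mulr0.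
Qed.
End Fields.

Section PowerSumFields.
Variables (theta : R) (ell : nat -> nat -> FF) (v : fps R) (dh : nat -> nat -> R).
Let u n : fps R := fun i => theta^-1 * i.+1%:R * ell n i [::] / n.+1%:R.
Hypothesis cv_u : forall i, cv (fun n => u n i) (v i).
Hypothesis cv_ell1 : forall i b, cv (fun n => ell n i [:: b]) (dh i b).
Hypothesis cv_ell2 : forall i a b ks, cv (fun n => ell n i [:: a, b & ks]) 0.
Variable B : nat.

Let A : fps R := symbA v.
(* The coefficients of [d/dq_(a+1)] and of [q_(b+1)] in the limit of [Y_k]. *)
Definition psid (a k : nat) : R := theta^-1 * a.+1%:R * (if (a < k)%N then (A ^+ k) (k - a.+1)%N else 0).
Definition psiq (b k : nat) : R :=
  (A ^+ k) (b.+1 + k)%N + \sum_(j < k) (theta^-1 * j.+1%:R * dh j b) * (A ^+ k) (k - j.+1)%N.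

Let phid a k : R := toepd v (opd theta a) k 0%N.
Let phiq b k : R := toepd v (opq theta dh b) k 0%N + toepg v k b.+1.

(** [opd a] multiplies by [theta^-1 (a+1) z^a]; written as [b / z] it needs no truncation, whence
    [e = 1] and [w = 0]. *)
Lemma phidE a k : phid a k = psid a k - \sum_(i < k) toept v i * psid a (k - i.+1).
Proof.
pose b : fps R := fpsC (theta^-1 * a.+1%:R) * fpsX R ^+ a.+1.
have PW g : fpsX R ^+ 1 * opd theta a g = b * g - ((fun=> 0) : fps R).
  apply: fpsP => c; rewrite expr1 fpsXM fpsB subr0 /b -mulrA fpsCM fpsXnM.
  case: c => [|c]; first by rewrite ltn0 mulr0.
  by rewrite /opd subSS ltnS.
have E k' : toepPsi v 1 b k' = psid a k'.
  rewrite /toepPsi /b -mulrA fpsCM fpsXnM /psid add1n /=; congr (_ * _).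
have := @toepPhiE _ v 1 b (opd theta a) (fun _ => (fun=> 0) : fps R) isT PW (fun _ _ _ => erefl) k.
rewrite /toepPhi addr0 /phid => ->; rewrite E; congr (_ - _).
by apply: eq_bigr => i _; rewrite E.
Qed.

(** [opq b] is multiplication by [z^-(b+2) + h] with the negative powers removed, whence [e = b.+2].
    The highest removed coefficient is [toepg v k b.+1], exactly the term supplied by [Symz]. *)
Lemma phiqE b k : phiq b k = psiq b k - \sum_(i < k) toept v i * psiq b (k - i.+1).
Proof.
pose h : fps R := fun j => theta^-1 * j.+1%:R * dh j b.
pose w (g : fps R) : fps R := fun i => if (i < b.+2)%N then g i else 0.
have PW g : fpsX R ^+ b.+2 * opq theta dh b g = (1 + fpsX R ^+ b.+2 * h) * g - w g.
  rewrite mulrDl mul1r -mulrA; apply: fpsP => c; rewrite fpsB fpsD !fpsXnM /w.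
  case: ltnP => hc; last by rewrite ltnS hc addr0 subrr.
  by rewrite ltnNge hc subr0 /opq fpsM subnK.
have E k' : toepPsi v b.+2 (1 + fpsX R ^+ b.+2 * h) k' = psiq b k'.
  rewrite /toepPsi mulrDl mul1r -mulrA fpsD fpsXnM /psiq.
  have -> : (b.+2 + k').-1 = (b.+1 + k')%N by lia.
  congr (_ + _); case: k' => [|k']; first by rewrite addn0 ltnn big_ord0.
  rewrite ifT; last by lia.
  have -> : (b.+1 + k'.+1 - b.+2 = k')%N by lia.
  by rewrite fpsM; apply: eq_bigr => i _; rewrite subSS.
have ws g i : (b.+2 <= i)%N -> w g i = 0 by rewrite /w leqNgt => /negbTE ->.
have := @toepPhiE _ v b.+2 _ (opq theta dh b) w isT PW ws k.
rewrite /toepPhi /w /= ltnSn -/(phiq b k) => ->; rewrite E; congr (_ - _).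
by apply: eq_bigr => i _; rewrite E.
Qed.

Definition Xc n k (F : FF) : FF := fun ks => n.+1%:R^-1 ^+ k * EEzc theta n.+1%:R (ell n) k F ks.

Lemma Xc_lin n k a F G ks : Xc n k (fun l => a * F l + G l) ks = a * Xc n k F ks + Xc n k G ks.
Proof. rewrite /Xc EEzc_lin; ring. Qed.

Lemma cv_toept k : cv (fun n => toept (u n) k) (toept v k).
Proof.
rewrite /toept; move: 0%N; elim: k => [|k IH] c; first exact: cv_const.
by apply: cv_toep => // i _; exact: IH.
Qed.

Let mX k : R := toepd v (opm theta) k 0%N.

Lemma Xc_asy k : (k <= B)%N ->
  Asy (fun n => Xc n k) (fun n => toept (u n) k) (fld B (mX k) (fun b => phiq b k) (fun a => phid a k)).
Proof. by move=> hk F F0 hF ks; exact: (EEzc_cv cv_u cv_ell1 cv_ell2 hF ks hk). Qed.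

(* Leading terms of the operators [Vop]. *)
Definition tV (t : nat -> R) : nat -> R := strong_rec 0 (fun k w =>
  if k is k'.+1 then k'.+1%:R * t k' + \sum_(i < k'.+1) t i * w (k' - i)%N else 0).
Lemma tVS t k : tV t k.+1 = k.+1%:R * t k + \sum_(i < k.+1) t i * tV t (k - i)%N.
Proof.
rewrite /tV strong_recE // => -[|k'] f g h //.
by congr (_ + _); apply: eq_bigr => i _; rewrite h // ltnS leq_subr.
Qed.
Lemma cv_tV k : cv (fun n => tV (toept (u n)) k) (tV (toept v) k).
Proof.
elim/ltn_ind: k => -[|k] IH; first exact: cv_const.
rewrite tVS; apply: cv_ext (cvD (cvZ k.+1%:R (cv_toept k)) (cv_sum _ (fun (i : 'I_k.+1) _ => cvM (cv_toept i) (IH (k - i)%N _)))) => [n|i].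
  by rewrite tVS.
by rewrite ltnS leq_subr.
Qed.

Lemma tV_logder t : logder_rec t (tV t).
Proof. by split=> // k; rewrite tVS mulr_natl. Qed.

Let mV : nat -> R := strong_rec 0 (fun k w =>
  if k is k'.+1 then k'.+1%:R * mX k' + \sum_(i < k'.+1) (toept v i * w (k' - i)%N + tV (toept v) (k' - i) * mX i) else 0).
Let mVS k : mV k.+1 = k.+1%:R * mX k + \sum_(i < k.+1) (toept v i * mV (k - i)%N + tV (toept v) (k - i) * mX i).
Proof.
rewrite /mV strong_recE // => -[|k'] f g h //.
by congr (_ + _); apply: eq_bigr => i _; rewrite h // ltnS leq_subr.
Qed.

Let dpsi (psi : nat -> R) k : R := if k is k'.+1 then k'.+1%:R * psi k' else 0.
(** The first order part of [Vop] obeys the linearized logarithmic derivative, so [logder_linear]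
    solves its recursion by [k.+1 * psi k]. *)
Let dpsi_rec (phi psi : nat -> R) :
  (forall k, phi k = psi k - \sum_(i < k) toept v i * psi (k - i.+1)%N) ->
  forall k, dpsi psi k.+1 = k.+1%:R * phi k +
    \sum_(i < k.+1) (toept v i * dpsi psi (k - i) + tV (toept v) (k - i) * phi i).
Proof.
move=> hphi; pose w : nat -> R := strong_rec 0 (fun k w =>
  if k is k'.+1 then k'.+1%:R * phi k' + \sum_(i < k'.+1) (toept v i * w (k' - i)%N + tV (toept v) (k' - i) * phi i) else 0).
have wS k : w k.+1 = k.+1%:R * phi k + \sum_(i < k.+1) (toept v i * w (k - i)%N + tV (toept v) (k - i) * phi i).
  rewrite /w strong_recE // => -[|k'] f g h //.
  by congr (_ + _); apply: eq_bigr => i _; rewrite h // ltnS leq_subr.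
have E k : w k = dpsi psi k.
  case: k => [|k] //; rewrite (@logder_linear _ (toept v) (tV (toept v)) phi psi w) ?mulr_natl //.
  - by rewrite /dpsi mulr_natl.
  - exact: tV_logder.
- by move=> k'; rewrite wS mulr_natl.
by move=> k; rewrite -E wS; congr (_ + _); apply: eq_bigr => i _; rewrite E.
Qed.

Lemma V_asy k : (k <= B.+1)%N ->
  Asy (fun n => Vop n.+1%:R (Xc n) k) (fun n => tV (toept (u n)) k)
    (fld B (mV k) (fun b => dpsi (psiq b) k) (fun a => dpsi (psid a) k)).
Proof.
elim/ltn_ind: k => -[|k] IH hk.
  by apply: Asy_ext (Asy0) => // F ks; rewrite fld0.
pose ph k := fld B (mX k) (fun b => phiq b k) (fun a => phid a k).
pose pv k := fld B (mV k) (fun b => dpsi (psiq b) k) (fun a => dpsi (psid a) k).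
have H := AsyD (AsyZ (cv_const k.+1%:R) (Xc_asy (hk : (k <= B)%N)))
  (Asy_sum (index_enum 'I_k.+1) (fun i => AsyM (fun n => @Xc_lin n i) (cv_toept i) (cv_tV (k - i))
     (Xc_asy (_ : i <= B)%N) (IH (k - i)%N _ _))).
have {}H := H (fun i => ltac:(by have := ltn_ord i; lia)) (fun i => ltac:(by rewrite ltnS leq_subr))
  (fun i => ltac:(by have := ltn_ord i; lia)).
apply: Asy_ext H => [n F ks|n|F ks].
- by rewrite VopS.
- by rewrite tVS.
rewrite -/(ph k).
have -> : \sum_(i < k.+1) (tV (toept v) (k - i) * fld B (mX i) (phiq^~ i) (phid^~ i) F ks +
   toept v i * fld B (mV (k - i)) (fun b => dpsi (psiq b) (k - i)) (fun a => dpsi (psid a) (k - i)) F ks) =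
   fld B (\sum_(i < k.+1) 1 * (toept v i * mV (k - i)%N + tV (toept v) (k - i) * mX i))
    (fun b => \sum_(i < k.+1) 1 * (toept v i * dpsi (psiq b) (k - i) + tV (toept v) (k - i) * phiq b i))
    (fun a => \sum_(i < k.+1) 1 * (toept v i * dpsi (psid a) (k - i) + tV (toept v) (k - i) * phid a i)) F ks.
  rewrite (fld_comb B (index_enum 'I_k.+1) (fun=> 1) (fun i => toept v i * mV (k - i)%N + tV (toept v) (k - i) * mX i)
    (fun i b => toept v i * dpsi (psiq b) (k - i) + tV (toept v) (k - i) * phiq b i)
    (fun i a => toept v i * dpsi (psid a) (k - i) + tV (toept v) (k - i) * phid a i)).
  by apply: eq_bigr => i _; rewrite mul1r -fldD addrC.
rewrite -[X in _ + X]mul1r fldD; apply: fld_ext => [|b|a _].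
- by rewrite mVS mul1r; congr (_ + _); apply: eq_bigr => i _; rewrite mul1r.
- by rewrite (dpsi_rec (phiqE b)) mul1r; congr (_ + _); apply: eq_bigr => i _; rewrite mul1r.
- by rewrite (dpsi_rec (phidE a)) mul1r; congr (_ + _); apply: eq_bigr => i _; rewrite mul1r.
Qed.

Definition tY (t : nat -> R) k : R := k.+1%:R^-1 * tV t k.+1.

Lemma cv_tY k : cv (fun n => tY (toept (u n)) k) (tY (toept v) k).
Proof. by apply: cvZ; exact: cv_tV. Qed.

(** Every term of [Yop k] other than [Vop k.+1 / (k+1)] carries a further [1/N] and leaves only a
    scalar; the coefficients of [q] and [d/dq] are therefore those of [psi]. *)
Lemma Y_asy k : (k <= B)%N -> exists m,
  Asy (fun n => Yop n.+1%:R (Xc n) k) (fun n => tY (toept (u n)) k)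
    (fld B m (fun b => psiq b k) (fun a => psid a k)).
Proof.
elim/ltn_ind: k => k IH hk.
have IH' (j : 'I_k) : exists m, Asy (fun n => Yop n.+1%:R (Xc n) (k.-1 - j)) (fun n => tY (toept (u n)) (k.-1 - j))
    (fld B m (fun b => psiq b (k.-1 - j)) (fun a => psid a (k.-1 - j))).
  by apply: IH; have := ltn_ord j; lia.
have [m hm] := choice IH'.
pose c (j : 'I_k) n : R := k.+1%:R^-1 * ((-1) ^+ j * 'C(k.+1, j.+2)%:R * n.+1%:R^-1 ^+ j).
pose c0 (j : 'I_k) : R := k.+1%:R^-1 * ((-1) ^+ j * 'C(k.+1, j.+2)%:R * (j == 0%N :> nat)%:R).
have hc j : cv (c j) (c0 j) by do 2 apply: cvZ; exact: cv_inv_exp.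
have H := AsyD (AsyZ (cv_const k.+1%:R^-1) (V_asy (hk : (k.+1 <= B.+1)%N)))
  (Asy_sum (index_enum 'I_k) (fun j => AsyZ (hc j) (Asy_div (cv_tY (k.-1 - j)) (hm j)))).
exists (k.+1%:R^-1 * mV k.+1 + \sum_(j < k) c0 j * tY (toept v) (k.-1 - j)).
apply: Asy_ext H => [n F ks|n|F ks].
- by rewrite YopE.
- by rewrite big1 ?addr0 // => j _; rewrite mulr0.
have -> : \sum_(i < k) c0 i * (tY (toept v) (k.-1 - i) * F ks) =
   fld B (\sum_(j < k) c0 j * tY (toept v) (k.-1 - j)) (fun=> 0) (fun=> 0) F ks.
  by rewrite fld_mean mulr_suml; apply: eq_bigr => j _; rewrite mulrA.
have k0 : k.+1%:R != 0 :> R by rewrite pnatr_eq0.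
rewrite -[X in _ + X]mul1r fldD; apply: fld_ext => [|b|a _].
- by rewrite mul1r.
- by rewrite mulr0 addr0 /= mulKf.
- by rewrite mulr0 addr0 /= mulKf.
Qed.

End PowerSumFields.

(** * Wick's formula *)

Lemma cv_spmom a (F : nat -> FF) F0 ks : fcv F F0 -> cv (fun n => spmom a (F n) ks) (spmom a F0 ks).
Proof.
move=> hF; rewrite /spmom /spsum; apply: cv_sum => p _; apply: cvZ.
by apply: cv_prod => l; exact: hF.
Qed.

Section Wick.
Variable B : nat.
Definition fsym (H : FF) := forall p a b l, H (p ++ a :: b :: l) = H (p ++ b :: a :: l).

Lemma fsym_dF a H : fsym H -> fsym (dF a H).
Proof. by move=> h p; exact: (h (a :: p)). Qed.
Lemma dF_comm a b H : fsym H -> dF a (dF b H) = dF b (dF a H).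
Proof. by move=> h; apply/funext => l; exact: (h [::] b a l). Qed.
Lemma fsym_qF al H : fsym H -> fsym (qF al H).
Proof.
move=> hH p a b l; elim: p H hH => [|k p IH] H hH /=.
  rewrite !qF_cons [dF b _]dF_comm //; rewrite /dF; ring.
by rewrite !qF_cons (hH p a b l) IH //; exact: fsym_dF.
Qed.
Lemma fsym_funit : fsym (funit R). Proof. by move=> [|k p] a b l. Qed.

Definition dop (be : nat -> R) (H : FF) : FF := fun ks => \sum_(a < B) be a * dF a H ks.
Definition gop (al be : nat -> R) : FF -> FF := fld B 0 al be.

Lemma gopE al be H ks : gop al be H ks = qF al H ks + dop be H ks.
Proof. by rewrite /gop /fld mul0r add0r. Qed.
Lemma fsym_dop be H : fsym H -> fsym (dop be H).
Proof. by move=> hH p a b l; apply: eq_bigr => i _; congr (_ * _); exact: (fsym_dF _ hH). Qed.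
Lemma fsym_gop al be H : fsym H -> fsym (gop al be H).
Proof. by move=> hH p a b l; rewrite !gopE fsym_qF // fsym_dop. Qed.

(** Derivatives commute with each other, and the commutator of [d/dq] with a linear form is a
    scalar. *)
Lemma dop_gop be al be' H ks : fsym H ->
  dop be (gop al be' H) ks = gop al be' (dop be H) ks + (\sum_(a < B) be a * al a) * H ks.
Proof.
move=> hH; rewrite gopE.
have -> : qF al (dop be H) ks = \sum_(a < B) be a * qF al (dF a H) ks.
  rewrite qF_nth /dop; under eq_bigr do rewrite mulr_sumr.
  rewrite exchange_big /=; apply: eq_bigr => a _; rewrite qF_nth mulr_sumr.
  by apply: eq_bigr => i _; rewrite mulrCA.
have -> : dop be' (dop be H) ks = \sum_(a < B) be a * dop be' (dF a H) ks.
  rewrite /dop; under eq_bigr do rewrite {1}/dF mulr_sumr.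
  rewrite exchange_big /=; apply: eq_bigr => a _; rewrite mulr_sumr.
  by apply: eq_bigr => i _; rewrite mulrCA.
rewrite mulr_suml -!big_split /=; apply: eq_bigr => a _.
rewrite {1}/dF gopE qF_cons.
rewrite (_ : dop be' H (nat_of_ord a :: ks) = dop be' (dF a H) ks); first by ring.
by apply: eq_bigr => i _; congr (_ * _); exact: (hH [::] i a ks).
Qed.

Lemma gop_lin al be (c : R) F G ks : gop al be (fun l => c * F l + G l) ks = c * gop al be F ks + gop al be G ks.
Proof.
rewrite !gopE !qF_nth /dop !mulrDr !mulr_sumr addrACA -!big_split /=.
by congr (_ + _); apply: eq_bigr => i _; rewrite /dF; ring.
Qed.

Variables (al be : nat -> nat -> R).
Definition wickop (ks : seq nat) : FF := foldr (fun k H => gop (al k) (be k) H) (funit R) ks.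
Definition wick : FF := fun ks => wickop ks [::].
Definition wickC k l : R := \sum_(a < B) be k a * al l a.

Lemma fsym_wickop ks : fsym (wickop ks).
Proof. by elim: ks => [|k ks IH]; [exact: fsym_funit | exact: fsym_gop]. Qed.

(** The derivation kills the unit, and moving it past the other factors leaves one contraction for
    each of them. *)
Lemma dop_wickop k ks l : dop (be k) (wickop ks) l = qF (wickC k) (fun ks' => wickop ks' l) ks.
Proof.
elim: ks l => [|m ks IH] l; first by rewrite qF_nil /dop big1 // => a _; rewrite mulr0.
rewrite qF_cons /= dop_gop; last exact: fsym_wickop.
rewrite addrC; congr (_ + _).
rewrite (_ : dop (be k) (wickop ks) = fun l => \sum_(i < size ks) wickC k (nth 0%N ks i) * wickop (take i ks ++ drop i.+1 ks) l).
  rewrite (fflin_sum _ _ _ _ (gop_lin (al m) (be m))) qF_nth.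
  by apply: eq_bigr.
by apply/funext => l'; rewrite IH qF_nth.
Qed.

Lemma wick_nil : wick [::] = 1. Proof. by []. Qed.
(** At [q = 0] multiplication by the linear form vanishes, so the first operator contributes through
    its derivative part alone. *)
Lemma wick_cons k ks : wick (k :: ks) = qF (wickC k) wick ks.
Proof. by rewrite /wick /= gopE qF_nil add0r dop_wickop. Qed.

Lemma wick1 k : wick [:: k] = 0. Proof. by rewrite wick_cons qF_nil. Qed.
Lemma wick2 k l : wick [:: k; l] = wickC k l.
Proof. by rewrite wick_cons qF_cons qF_nil addr0 wick_nil mulr1. Qed.
Lemma cumul_wick k l m ks : cumul wick [:: k, l, m & ks] = 0.
Proof. by apply: (cumul_gauss _ _ _ _ wick_nil wick_cons). Qed.

End Wick.

Section MomentLimits.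
Variables (theta : R) (ell : nat -> nat -> FF) (v : fps R) (dh : nat -> nat -> R).
Let u n : fps R := fun i => theta^-1 * i.+1%:R * ell n i [::] / n.+1%:R.
Hypothesis cv_u : forall i, cv (fun n => u n i) (v i).
Hypothesis cv_ell1 : forall i b, cv (fun n => ell n i [:: b]) (dh i b).
Hypothesis cv_ell2 : forall i a b ks, cv (fun n => ell n i [:: a, b & ks]) 0.

Let Y n k : FF -> FF := Yop n.+1%:R (Xc theta ell n) k.
Definition ymean n k : R := Y n k (funit R) [::].
Definition Xiop n k (F : FF) : FF := fun ks => Y n k F ks - ymean n k * F ks.

(** The mean is the same operator applied to the unit and read at [q = 0]; subtracting it removes
    the term of order [N] together with the scalar part [m]. *)
Lemma Xiop_asy B k : (k <= B)%N ->
  Asy (fun n => Xiop n k) (fun n => 0) (gop B (fun b => psiq theta v dh b k) (fun a => psid theta v a k)).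
Proof.
move=> hk; have [m hm] := Y_asy cv_u cv_ell1 cv_ell2 hk.
have hc : cv (fun n => ymean n k - n.+1%:R * tY (toept (u n)) k) m.
  have H := hm (fun=> funit R) (funit R) (fun ks => cv_const _) [::].
  rewrite /fld qF_nil addr0 big1 in H; last by move=> a _; rewrite mulr0.
  rewrite addr0 mulr1 in H.
  by apply: cv_ext H => n; rewrite mulr1.
move=> F F0 hF ks.
have -> : gop B (fun b => psiq theta v dh b k) (fun a => psid theta v a k) F0 ks =
   fld B m (fun b => psiq theta v dh b k) (fun a => psid theta v a k) F0 ks - m * F0 ks.
  by rewrite /gop /fld; ring.
apply: cv_ext (cvB (hm F F0 hF ks) (cvM hc (hF ks))) => n.
rewrite /Xiop /Y; ring.
Qed.

Section Labels.
Variables (B : nat) (kap : nat -> nat).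
Hypothesis kapB : forall s, (kap s <= B)%N.
(** The entries of [ss] are labels sent to exponents by [kap], as joint cumulants partition the
    positions of a list and not its values. *)
Definition ximom n : FF := fun ss => foldr (fun s H => Xiop n (kap s) H) (funit R) ss [::].
Definition xilim : FF := wick B (fun s b => psiq theta v dh b (kap s)) (fun s a => psid theta v a (kap s)).

Lemma ximom_cv : fcv ximom xilim.
Proof.
move=> ss; rewrite /ximom /xilim /wick.
suff H : fcv (fun n => foldr (fun s H => Xiop n (kap s) H) (funit R) ss)
    (wickop B (fun s b => psiq theta v dh b (kap s)) (fun s a => psid theta v a (kap s)) ss) by exact: H.
elim: ss => [|s ss IH] ks; first exact: cv_const.
apply: cv_ext (Xiop_asy (kapB s) IH ks) => n /=; ring.
Qed.

Lemma ximom_cumul s t w ss : cv (fun n => cumul (ximom n) [:: s, t, w & ss]) 0.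
Proof.
rewrite -(cumul_wick B (fun s b => psiq theta v dh b (kap s)) (fun s a => psid theta v a (kap s)) s t w ss).
by apply: cv_spmom; exact: ximom_cv.
Qed.

Lemma ximom_cov s t : cv (fun n => ximom n [:: s; t])
  (\sum_(a < B) psid theta v a (kap s) * psiq theta v dh a (kap t)).
Proof.
rewrite -[X in cv _ X](wick2 B (fun s b => psiq theta v dh b (kap s)) (fun s a => psid theta v a (kap s)) s t).
exact: ximom_cv.
Qed.
End Labels.

(** The law of large numbers: divided by [N], every operator tends to a scalar, so limits of joint
    moments factorize. *)
Lemma ymom_cv (ks : seq nat) :
  cv (fun n => foldr (fun k H l => n.+1%:R^-1 * Y n k H l) (funit R) ks [::]) (\prod_(k <- ks) tY (toept v) k).
Proof.
suff H : fcv (fun n => foldr (fun k H l => n.+1%:R^-1 * Y n k H l) (funit R) ks)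
     (fun l => (\prod_(k <- ks) tY (toept v) k) * funit R l).
  by have := H [::]; rewrite /= mulr1.
elim: ks => [|k ks IH] l.
  by rewrite big_nil mul1r; exact: cv_const.
have [m hm] := Y_asy cv_u cv_ell1 cv_ell2 (leqnn k).
rewrite big_cons -mulrA.
apply: cv_ext (Asy_div (cv_tY cv_u k) hm IH l) => n /=; by rewrite mulr0 mul0r subr0.
Qed.

End MomentLimits.

(** * Translation of the combinatorial definitions *)

Section ListBridge.
Lemma lsumE (A : Type) (f : A -> R) l : Defs.lsum f l = \sum_(x <- l) f x.
Proof. by elim: l => [|x l IH]; rewrite ?big_nil // big_cons -IH. Qed.
Lemma lprodE (A : Type) (f : A -> R) l : Defs.lprod f l = \prod_(x <- l) f x.
Proof. by elim: l => [|x l IH]; rewrite ?big_nil // big_cons -IH. Qed.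
Lemma lengthE (A : Type) (l : seq A) : List.length l = size l.
Proof. by elim: l => //= x l ->. Qed.
Lemma list_sumE l : List.list_sum l = sumn l.
Proof. by elim: l => //= x l ->. Qed.
Lemma List_seqE m n : List.seq m n = iota m n.
Proof. by elim: n m => //= n IH m; rewrite IH. Qed.
Lemma List_nthE (A : Type) (x : A) l i : List.nth i l x = nth x l i.
Proof. by elim: l i => [|y l IH] [|i] /=. Qed.
Lemma List_mapE (A B : Type) (f : A -> B) l : List.map f l = map f l.
Proof. by []. Qed.
Lemma flat_mapE (A B : Type) (f : A -> list B) l : List.flat_map f l = flatten (map f l).
Proof. by elim: l => //= x l ->. Qed.
Lemma List_filterE (A : Type) (f : A -> bool) l : List.filter f l = filter f l.
Proof. by []. Qed.
Lemma forallbE (A : Type) (f : A -> bool) l : List.forallb f l = all f l.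
Proof. by elim: l => //= x l ->. Qed.
Lemma firstnE (A : Type) i (l : seq A) : List.firstn i l = take i l.
Proof. by elim: l i => [|y l IH] [|i] //=; rewrite IH. Qed.
Lemma eqbE (m n : nat) : Nat.eqb m n = (m == n).
Proof. by apply/idP/eqP => [/PeanoNat.Nat.eqb_eq|/PeanoNat.Nat.eqb_eq]. Qed.
Lemma multE l j : Defs.mult l j = count_mem j l.
Proof.
rewrite /Defs.mult; elim: l => //= x l IH; case: PeanoNat.Nat.eq_dec => [->|/eqP/negbTE ->]; by rewrite ?eqxx IH.
Qed.
Lemma InP (A : eqType) (x : A) l : List.In x l <-> x \in l.
Proof.
elim: l => //= y l IH; rewrite inE; split.
  by case=> [->|/IH ->]; rewrite ?eqxx ?orbT.
by case/orP=> [/eqP ->|/IH]; [left|right].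
Qed.
Lemma INRn n : INR n = n%:R :> R.
Proof. exact: INRE. Qed.
Lemma powE (x : R) n : Rpow_def.pow x n = x ^+ n.
Proof. by elim: n => //= n ->; rewrite exprS. Qed.
Lemma factE n : Factorial.fact n = n`!.
Proof. by elim: n => //= n ->; rewrite factS; lia. Qed.
End ListBridge.

Section PartitionBridge.
Implicit Types (nu mu la : seq nat).

Lemma mem_partsF f n m nu : (n <= f)%N ->
  (nu \in Defs.partsF f n m) = [&& path geq m nu, all (leq 1) nu & sumn nu == n].
Proof.
elim: f n m nu => [|f IH] n m nu hn.
  have -> : n = 0%N by lia.
  by rewrite /= inE; case: nu => [|[|b] nu] //=; rewrite ?andbF.
rewrite /= eqbE; case: eqP => [->|/eqP n0].
  by rewrite inE; case: nu => [|[|b] nu] //=; rewrite ?andbF.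
rewrite flat_mapE List_seqE; apply/idP/idP.
  case/flatten_mapP=> k; rewrite mem_iota List_mapE => hk /mapP[nu' hnu' ->].
  move: hnu'; rewrite IH; last by lia.
  case/and3P=> h1 h2 /eqP h3 /=; rewrite h1 h2 h3 !andbT.
  by apply/and3P; split; [lia | lia | apply/eqP; lia].
case: nu => [|b nu] /=; first by rewrite eq_sym (negbTE n0).
case/and3P=> /andP[h1 h2] /andP[h3 h4] /eqP h5; apply/flatten_mapP; exists b.
  by rewrite mem_iota; lia.
rewrite List_mapE; apply/mapP; exists nu => //; rewrite IH; last by lia.
by rewrite h2 h4; apply/eqP; lia.
Qed.

Lemma uniq_partsF f n m : uniq (Defs.partsF f n m).
Proof.
elim: f n m => [|f IH] n m /=; rewrite eqbE; case: eqP => // _.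
rewrite flat_mapE List_seqE.
have : uniq (iota 1 (Nat.min n m)) by exact: iota_uniq.
elim: (iota _ _) => //= k s IHs /andP[h1 h2]; rewrite List_mapE cat_uniq IHs // andbT.
rewrite map_inj_uniq ?IH /= => [|x y []] //.
apply/hasPn => x /flatten_mapP[k' hk']; rewrite List_mapE => /mapP[y hy ->].
by apply/mapP => -[z _ [E]]; move: h1; rewrite -E hk'.
Qed.

Lemma parts_uniq n : uniq (Defs.partitions n). Proof. exact: uniq_partsF. Qed.
Lemma mem_partsE n nu : (nu \in Defs.partitions n) = ispart n nu.
Proof.
rewrite /Defs.partitions mem_partsF // /ispart.
case: nu => [|b nu] //=; case E : (b + sumn nu == n)%N; rewrite ?andbF //.
by rewrite (_ : (b <= n)%N) //; lia.
Qed.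

Lemma psizeE nu : Defs.psize nu = sumn nu. Proof. exact: list_sumE. Qed.

Lemma is_partitionP la : Defs.is_partition la <-> ispart (sumn la) la.
Proof.
rewrite /Defs.is_partition /ispart eqxx andbT !lengthE; split.
  case=> h1 h2; apply/andP; split.
    case: la h1 h2 => // b la _ h2; apply/(pathP 0%N) => i hi /=.
    by have := h2 i; rewrite !List_nthE /= => h; rewrite /geq /=; apply/ssrnat.leP; apply: h; lia.
  by apply/(all_nthP 0%N) => i /ssrnat.ltP /h1; rewrite List_nthE => /ssrnat.ltP.
case/andP=> hs /(all_nthP 0%N) h0; split=> i /ssrnat.ltP hi; rewrite !List_nthE.
  exact/ssrnat.ltP/h0.
case: la hs hi {h0} => // b la /(pathP 0%N) h hi.
by apply/ssrnat.leP; exact: (h i).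
Qed.

Lemma big_iota1 (A : Type) (idx : A) (op : A -> A -> A) n (F : nat -> A) :
  \big[op/idx]_(j <- iota 1 n) F j = \big[op/idx]_(i < n) F i.+1.
Proof. by rewrite -[n in iota _ n]subn0 -subSS -/(index_iota 1 n.+1) big_add1 /= big_mkord. Qed.

Lemma size_count n nu : all (fun b => 0 < b <= n)%N nu -> size nu = (\sum_(i < n) count_mem i.+1 nu)%N.
Proof.
elim: nu => [|b nu IH] /=; first by rewrite big1.
case/andP=> /andP[b0 bn] /IH ->; rewrite big_split /= -add1n; congr (_ + _)%N.
have hb : (b.-1 < n)%N by lia.
rewrite (bigD1 (Ordinal hb)) //= prednK // eqxx big1 ?addn0 // => i hi.
by case: eqP => // E; case/eqP: hi; apply/val_inj => /=; lia.
Qed.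

Lemma zeeE n (theta : R) nu : 0 < theta -> ispart n nu ->
  Defs.zee nu / theta ^+ size nu = zet theta (mono n nu).
Proof.
move=> th0 hp; have hn : sumn nu = n by case/and3P: hp => _ _ /eqP.
rewrite /Defs.zee lprodE List_seqE psizeE hn /zet big_iota1.
rewrite (size_count (ispart_bound hp)) expr_sum -prodfV -big_split; apply: eq_bigr => i _.
by rewrite multE powE factE !INRn mnmE expr_div_n mulrAC.
Qed.

Lemma jinnerE n (theta : R) f g : 0 < theta ->
  Defs.jinner theta n f g =
  ip theta (pol n (Defs.partitions n) f) (pol n (Defs.partitions n) g).
Proof.
move=> th0; rewrite /Defs.jinner lsumE {1}/pol ip_suml !big_seq; apply: eq_bigr => nu hnu.
rewrite ipZl ipX mcoeff_pol ?parts_uniq //; last exact: mem_partsE.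
rewrite -zeeE -?mem_partsE // lengthE powE /Rdiv !RmultE RinvE; ring.
Qed.

Definition fibs nu phi j := Defs.fiber_sum nu phi j.
Lemma fibs_cons b nu j0 phi j : fibs (b :: nu) (j0 :: phi) j = ((j0 == j) * b + fibs nu phi j)%N.
Proof.
rewrite /fibs /Defs.fiber_sum /= eqbE; case: eqP => _ /=; lia.
Qed.

Lemma pm_coefE nu mu : Defs.pm_coef nu mu = (pmn nu (size mu) (nth 0%N mu))%:R.
Proof.
rewrite /Defs.pm_coef INRn; congr (_%:R); rewrite !lengthE List_seqE.
have H m h : forall nu, size [seq phi <- Defs.maps (size nu) m | all (fun j => fibs nu phi j == h j) (iota 0 m)] = pmn nu m h.
  move=> nu'; elim: nu' h => [|b nu' IH] h.
    rewrite /= -(eq_all (a1 := fun j => h j == 0%N)); last by move=> j; rewrite eq_sym.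
    by case: all.
  rewrite /= flat_mapE List_seqE -[X in flatten (map _ X)]val_enum_ord.
  rewrite -map_comp filter_flatten size_flatten /shape -!map_comp sumnE big_map -enumT big_enum /=.
  apply: eq_bigr => j0 _ /=; rewrite List_mapE filter_map size_map.
  case: ifP => hb.
    rewrite -IH; congr size; apply: eq_filter => phi /=; apply: eq_in_all => j _.
    rewrite fibs_cons [j == _]eq_sym; case: (nat_of_ord j0 =P j) => [E|_] /=; last by rewrite mul0n add0n.
    by rewrite mul1n -E; apply/eqP/eqP; lia.
  rewrite (eq_filter (a2 := pred0)) ?filter_pred0 // => phi /=; apply/negbTE/allPn.
  exists (nat_of_ord j0); first by rewrite mem_iota /=.
  by rewrite fibs_cons eqxx mul1n; lia.
rewrite -H List_filterE; congr size; apply: eq_filter => phi.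
by rewrite forallbE; apply: eq_all => j; rewrite eqbE List_nthE.
Qed.

Lemma mon_coefE n f mu : mu \in Defs.partitions n ->
  Defs.mon_coef n f mu = mcf (pol n (Defs.partitions n) f) mu.
Proof.
move=> hmu; have hp : ispart n mu by rewrite -mem_partsE.
rewrite /mcf (mcfE (parts_uniq n) (mem_partsE n) (hom_pol (mem_partsE n) f) (size_ispart hp)).
rewrite /Defs.mon_coef lsumE !big_seq; apply: eq_bigr => nu hnu.
by rewrite pm_coefE mcoeff_pol ?parts_uniq //; exact: mem_partsE.
Qed.

End PartitionBridge.

Notation parts := Defs.partitions.

(** * Dominance by partial sums and by hinge sums *)

Section Dominance.
Implicit Types (nu mu la : seq nat).

Lemma prefix_le_trl t i mu : (sumn (take i mu) <= i * t + trl t mu)%N.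
Proof.
rewrite /trl; elim: mu i => [|x mu IH] [|i] //=; rewrite big_cons.
by have := IH i; rewrite mulSn; lia.
Qed.

Lemma trl_sorted_eq i la : sorted geq la ->
  sumn (take i la) = (minn i (size la) * nth 0 la i + trl (nth 0%N la i) la)%N.
Proof.
elim: la i => [|x la IH] [|i] hs /=; rewrite ?big_nil ?nth_nil //.
- by rewrite /trl big_nil min0n.
- by rewrite /trl big_nil minn0.
- rewrite min0n mul0n add0n /trl big1_seq // => y /andP[_].
  rewrite inE => /orP[/eqP ->|hy]; first by rewrite subnn.
  have := order_path_min (fun b a c (h1 : geq a b) (h2 : geq b c) => leq_trans h2 h1 : geq a c) hs.
  by move/allP/(_ _ hy) => /= h; apply/eqP; rewrite subn_eq0.
have hs' := path_sorted hs.
rewrite (IH i hs') /trl big_cons minnSS mulSn.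
have hx : (nth 0 la i <= x)%N.
  case: (ltnP i (size la)) => hi; last by rewrite nth_default.
  have := order_path_min (fun b a c (h1 : geq a b) (h2 : geq b c) => leq_trans h2 h1 : geq a c) hs.
  by move/allP/(_ _ (mem_nth 0%N hi)).
by lia.
Qed.

Lemma trl_prefix t mu : sorted geq mu -> exists i, (trl t mu + i * t = sumn (take i mu))%N /\ (i <= size mu)%N.
Proof.
elim: mu => [|x mu IH] hs; first by exists 0%N; rewrite /trl big_nil.
case: (leqP x t) => hx.
  exists 0%N; rewrite take0 mul0n addn0 /trl big1_seq // => y /andP[_].
  rewrite inE => /orP[/eqP ->|hy]; first by apply/eqP; rewrite subn_eq0.
  have := order_path_min (fun b a c (h1 : geq a b) (h2 : geq b c) => leq_trans h2 h1 : geq a c) hs.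
  move/allP/(_ _ hy) => /= h; apply/eqP; rewrite subn_eq0; exact: leq_trans h hx.
have [i [h1 h2]] := IH (path_sorted hs).
exists i.+1; rewrite /= /trl big_cons -/(trl t mu) -h1 mulSn; split; lia.
Qed.

(** Partial sums and hinge sums are dual: the first [i] parts sum to at most [i t + trl t], with
    equality at [t = la_i] while [i <= size la], and conversely every hinge sum is attained by a
    prefix. *)
Lemma dominatedP n mu la : ispart n mu -> ispart n la -> Defs.dominated mu la <-> ldom la mu.
Proof.
move=> hm hl; have [sm _ /eqP em] := and3P hm; have [sl _ /eqP el] := and3P hl.
rewrite /Defs.dominated !psizeE em el; split.
  case=> _ h t; have [i [h1 h2]] := trl_prefix t sm.
  have := h i; rewrite !firstnE !list_sumE => /ssrnat.leP hi.
  by have := prefix_le_trl t i la; lia.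
move=> h; split=> // i; rewrite !firstnE !list_sumE; apply/ssrnat.leP.
case: (leqP i (size la)) => hi.
  have := trl_sorted_eq i sl; rewrite (minn_idPl hi) => ->.
  by have := prefix_le_trl (nth 0%N la i) i mu; have := h (nth 0%N la i); lia.
have -> : take i la = la by rewrite take_oversize // ltnW.
rewrite el -em -{2}(cat_take_drop i mu) sumn_cat; lia.
Qed.
End Dominance.

(** * The Jack polynomials selected by the definition *)

Section JackBridge.
Variable theta : R.
Hypothesis theta_gt0 : 0 < theta.
Implicit Types (nu mu la : seq nat).

Definition Jpol n la : {mpoly R[n]} := pol n (parts n) (Defs.Jack theta la).

(** [Jack] is picked by [epsilon], so its defining properties become available only through this
    existence. *)
Lemma jack_family_exists : exists P, Defs.JackFamily theta P.
Proof.
have H n := jack_exists (parts_uniq n) (mem_partsE n) theta_gt0.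
have H' n : exists P : seq nat -> {mpoly R[n]},
  (forall la, la \in parts n -> [/\ hom (P la), mtri (parts n) la (P la) & mcf (P la) la = 1]) /\
  (forall la mu, la \in parts n -> mu \in parts n -> mu != la -> ip theta (P la) (P mu) = 0).
  have [m hm] := @monomials_exist R n (parts n) (parts_uniq n) (mem_partsE n).
  by apply: (H n m) => [mu hmu|mu mu' hmu]; have [h1 h2] := hm mu hmu; [exact: h1 | exact: h2].
pose P n := projT1 (cid (H' n)).
have hP n := projT2 (cid (H' n)); rewrite -/(P _) in hP.
pose c la nu := (P (sumn la) la)@_(mono (sumn la) nu).
have E n la : la \in parts n -> pol n (parts n) (c la) = P n la.
  move=> hla; have hs : sumn la = n by move: hla; rewrite mem_partsE => /and3P[_ _ /eqP].
  rewrite /c hs [RHS](hom_polE (parts_uniq n) (mem_partsE n)) //.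
  by have [h _] := hP n; case: (h la hla).
exists c => la /is_partitionP hla; rewrite psizeE; set n := sumn la in hla *.
have hl : la \in parts n by rewrite mem_partsE.
have [h1 h2] := hP n; have [g1 g2 g3] := h1 la hl.
split; last split.
- by rewrite mon_coefE // E.
- move=> mu /InP hmu; rewrite mon_coefE // E // => /eqP /(g2 _ hmu) hd.
  by apply/(dominatedP (n := n)) => //; rewrite -mem_partsE.
- move=> mu /InP hmu hne; rewrite jinnerE // !E // h2 //; exact/eqP.
Qed.

Lemma Jack_spec : Defs.JackFamily theta (Defs.Jack theta).
Proof. exact: (ClassicalEpsilon.epsilon_spec _ _ jack_family_exists). Qed.

Lemma Jpol_hom n la : hom (Jpol n la).
Proof. exact: (hom_pol (mem_partsE n)). Qed.

Lemma Jpol_spec n la : la \in parts n ->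
  [/\ hom (Jpol n la), mtri (parts n) la (Jpol n la) & mcf (Jpol n la) la = 1].
Proof.
move=> hl; have hp : ispart n la by rewrite -mem_partsE.
have hs : sumn la = n by case/and3P: hp => _ _ /eqP.
have [] := Jack_spec (proj2 (is_partitionP la) (eq_ind_r (fun k => ispart k la) hp hs)).
rewrite psizeE hs => j1 [j2 _]; split; first exact: Jpol_hom.
  move=> mu hmu hne; apply/(dominatedP (n := n)); rewrite -?mem_partsE //.
  by apply: j2; [exact/InP | rewrite mon_coefE //; exact/eqP].
by rewrite -mon_coefE.
Qed.

Lemma Jpol_orth n la mu : la \in parts n -> mu \in parts n -> mu != la ->
  ip theta (Jpol n la) (Jpol n mu) = 0.
Proof.
move=> hl hm hne; have hp : ispart n la by rewrite -mem_partsE.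
have hs : sumn la = n by case/and3P: hp => _ _ /eqP.
have [] := Jack_spec (proj2 (is_partitionP la) (eq_ind_r (fun k => ispart k la) hp hs)).
rewrite psizeE hs => j1 [_ j3]; rewrite -jinnerE //; apply: j3; [exact/InP | exact/eqP].
Qed.

Lemma Jpol_eigen n la j : la \in parts n ->
  Kop theta j (Jpol n la) = kapn n theta j la *: Jpol n la.
Proof.
have [m hm] := @monomials_exist R n (parts n) (parts_uniq n) (mem_partsE n).
apply: (jack_eigen (parts_uniq n) (mem_partsE n) theta_gt0 (m := m)).
- by move=> mu hmu; have [] := hm mu hmu.
- by move=> mu mu' hmu; have [_] := hm mu hmu; apply.
- exact: Jpol_spec.
- exact: Jpol_orth.
Qed.

Lemma meval_mono n (N : R) nu : nu \in parts n ->
  ('X_[mono n nu] : {mpoly R[n]}).@[fun=> N] = N ^+ size nu.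
Proof.
rewrite mem_partsE => hp; rewrite mevalX (size_count (ispart_bound hp)) expr_sum.
by apply: eq_bigr => i _; rewrite mnmE.
Qed.

Lemma Jack1E N n la : la \in parts n -> Defs.Jack1 theta N la = (Jpol n la).@[fun=> N%:R].
Proof.
move=> hl; have hp : ispart n la by rewrite -mem_partsE.
have hs : sumn la = n by case/and3P: hp => _ _ /eqP.
rewrite /Defs.Jack1 lsumE psizeE hs /Jpol /pol raddf_sum !big_seq; apply: eq_bigr => nu hnu /=.
by rewrite mevalZ meval_mono // lengthE powE INRn.
Qed.

Lemma Jack1_gt0 N n la : la \in parts n -> (size la <= N)%N -> 0 < Defs.Jack1 theta N la.
Proof.
move=> hl hN; rewrite (Jack1E N hl); have [h1 h2 h3] := Jpol_spec hl.
by apply: (jack_eval_pos (parts_uniq n) (mem_partsE n) theta_gt0 hl hN h1 h2 h3); exact: Jpol_eigen.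
Qed.

Definition tauJ N la : FF := let n := sumn la in tau N%:R (Jpol n la).

Lemma tauJ_eigen N la k ks : ispart (sumn la) la -> (size la <= N)%N ->
  EEz theta N%:R k (tauJ N la) ks = rowE N (srow theta (nth 0%N la)) k * tauJ N la ks.
Proof.
move=> hp hN; rewrite /tauJ; set n := sumn la in hp *; have hl : la \in parts n by rewrite mem_partsE.
rewrite -tau_EEw //; last exact: Jpol_hom.
suff -> : EEw theta N%:R k (Jpol n la) = rowE N (srow theta (nth 0%N la)) k *: Jpol n la.
  by rewrite tauZ.
elim: k => [|k IH]; first by rewrite EEw_0 rowE_0.
rewrite EEw_rec IH Jpol_eigen // rowE_rec scalerBl scalerA; congr (_ *: _ - _).
rewrite /kapn; apply: kapL_indep => i hi; apply: nth_default.
  exact: leq_trans (size_ispart hp) hi.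
exact: leq_trans hN hi.
Qed.

End JackBridge.

(** * Series *)

Section Series.
Definition sums (u : nat -> R) (l : R) := cv (fun K => \sum_(i < K.+1) u i) l.

Lemma sum_f_R0E u K : sum_f_R0 u K = \sum_(i < K.+1) u i.
Proof. by elim: K => [|K IH] /=; rewrite big_ord_recr /= ?big_ord0 ?add0r -?IH. Qed.
Lemma sumsP u l : sums u l <-> Un_cv (fun K => sum_f_R0 u K) l.
Proof. by rewrite /sums; split; apply: cv_ext => K; rewrite sum_f_R0E. Qed.
Lemma series_valE u l : sums u l -> Defs.series_val u = l.
Proof.
move=> /sumsP h; apply: UL_sequence (h).
by apply: (ClassicalEpsilon.epsilon_spec (inhabits _) (fun l => Un_cv (fun K => sum_f_R0 u K) l)); exists l.
Qed.
Lemma lim_valE u l : cv u l -> Defs.lim_val u = l.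
Proof.
move=> h; apply: UL_sequence (h).
by apply: (ClassicalEpsilon.epsilon_spec (inhabits _) (fun l => Un_cv u l)); exists l.
Qed.

Lemma sums_lin (I : Type) (r : seq I) (c : I -> R) u l :
  (forall i, sums (u i) (l i)) -> sums (fun n => \sum_(i <- r) c i * u i n) (\sum_(i <- r) c i * l i).
Proof.
move=> h; apply: cv_ext (cv_sum r (fun i _ => cvZ (c i) (h i))) => K.
by rewrite exchange_big; apply: eq_bigr => i _; rewrite mulr_sumr.
Qed.

Lemma sums_comp u v S : (forall n, `|u n| <= v n) -> sums v S -> exists l, sums u l.
Proof.
move=> h /sumsP hv.
have [l hl] : {l | Un_cv (fun N => sum_f_R0 (fun n => Rabs (u n)) N) l}.
  apply: (@Rseries_CV_comp _ v); last by exists S.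
  move=> n; split; first exact: Rabs_pos.
  by apply/RleP; rewrite RabsE; exact: h.
have [l' hl'] : {l | Un_cv (fun N => sum_f_R0 u N) l}.
  by apply: cv_cauchy_2; apply: cauchy_abs; apply: cv_cauchy_1; exists l.
by exists l'; apply/sumsP.
Qed.

Lemma cv_le u v a b : (forall n, u n <= v n) -> cv u a -> cv v b -> a <= b.
Proof.
move=> h ha hb; apply/RleP; apply: (@Rle_cv_lim u v) => //.
by move=> n; apply/RleP.
Qed.

Lemma cv_squeeze u v e l : (forall n, `|u n - v n| <= e n) -> cv e 0 -> cv v l -> cv u l.
Proof.
move=> h he hv.
have h0 : cv (fun n => u n - v n) 0.
  move=> eps heps; have [m hm] := he eps heps; exists m => n hn.
  rewrite /R_dist RminusE subr0; apply: Rle_lt_trans (hm n hn).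
  rewrite /R_dist RminusE subr0; apply: Rle_trans (Rle_abs _).
  by apply/RleP; rewrite RabsE; exact: h.
by have := cvD h0 hv; rewrite add0r; apply: cv_ext => n; rewrite subrK.
Qed.

(** Dominated convergence for series whose term [n] is stationary once [n <= K]; the error is at
    most the tail of [v] beyond [K]. *)
Lemma cv_sums_dominated (u : nat -> nat -> R) s c v S l :
  (forall K n, `|u K n| <= v n) -> sums v S -> (forall K n, (n <= K)%N -> u K n = c n) ->
  (forall K, sums (u K) (s K)) -> sums c l -> cv s l.
Proof.
move=> huv hv huc hs hc; pose V K := \sum_(i < K.+1) v i.
apply: (cv_squeeze (v := fun K => \sum_(i < K.+1) c i) (e := fun K => S - V K)) => [K||//]; last first.
  by rewrite -(subrr S); apply: cvB => //; exact: cv_const.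
have E m : (K <= m)%N -> `|\sum_(i < m.+1) u K i - \sum_(i < K.+1) c i| <= V m - V K.
  move=> hm; rewrite /V -!(big_mkord xpredT).
  rewrite !(@big_cat_nat _ _ _ K.+1 0 m.+1) //=.
  rewrite [X in `|X + _ - _|](_ : _ = \sum_(0 <= i < K.+1) c i); last first.
    by apply: eq_big_nat => i hi; apply: huc.
  rewrite addrAC subrr add0r [X in _ <= X]addrAC subrr add0r.
  by apply: le_trans (ler_norm_sum _ _ _) _; apply: ler_sum.
have hcv : cv (fun m => `|\sum_(i < (m + K).+1) u K i - \sum_(i < K.+1) c i|) `|s K - \sum_(i < K.+1) c i|.
  have h1 : cv (fun m => \sum_(i < (m + K).+1) u K i - \sum_(i < K.+1) c i) (s K - \sum_(i < K.+1) c i).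
    by apply: cvB (cv_const _); exact: (CV_shift' _ K _ (hs K)).
  by have := cv_cvabs _ _ h1; rewrite RabsE; apply: cv_ext => m; rewrite RabsE.
apply: (cv_le _ hcv (b := S - V K) (v := fun m => V (m + K)%N - V K)) => [m|].
  by apply: E; exact: leq_addl.
by apply: cvB (cv_const _); exact: (CV_shift' _ K _ hv).
Qed.

(** Induction on the exponent with [x] replaced by its square root [y]: one factor [y ^+ n] absorbs
    the induction hypothesis, the other one linear factor, by Bernoulli's inequality. *)
Lemma poly_le_exp (E : nat) (x : R) : 1 < x -> exists2 C : R, 0 <= C & forall n, n.+1%:R ^+ E <= C * x ^+ n.
Proof.
elim: E x => [|E IH] x hx.
  by exists 1 => // n; rewrite mul1r expr0 exprn_ege1 // ltW.
pose y := Num.sqrt x.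
have x0 : 0 <= x by apply: le_trans (ltW hx).
have hy : 1 < y by rewrite -[1]sqrtr1 ltr_sqrt // (lt_trans ltr01).
have yy : y * y = x by rewrite -expr2 sqr_sqrtr.
have [C C0 hC] := IH y hy.
have y1 : 0 < y - 1 by rewrite subr_gt0.
have bern n : n%:R * (y - 1) <= y ^+ n - 1.
  elim: n => [|n IHn]; first by rewrite mul0r expr0 subrr.
  rewrite exprS -natr1; have := ler_wpM2l (ltW (lt_trans ltr01 hy)) IHn.
  have hn : 0 <= n%:R * ((y - 1) * (y - 1)) :> R by rewrite mulr_ge0 ?ler0n // mulr_ge0 // ltW.
  move: (y ^+ n) (n%:R : R) hn => a b hn; lra.
exists (C * (y * (y - 1)^-1)) => [|n]; first by rewrite !mulr_ge0 ?invr_ge0 // ltW // (lt_trans ltr01).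
rewrite exprSr -yy exprMn.
have h1 : n.+1%:R <= y * (y - 1)^-1 * y ^+ n :> R.
  rewrite mulrAC -exprS ler_pdivlMr //; apply: le_trans (bern n.+1) _; lra.
have := ler_pM _ _ (hC n) h1; rewrite !exprn_ge0 ?ler0n // => /(_ isT isT) h.
by apply: le_trans h _; rewrite le_eqVlt; apply/orP; left; apply/eqP; ring.
Qed.

End Series.

(** * Derivatives of the generating function *)

Section SetPartitionBridge.
Lemma insert_map (f : nat -> nat) x pi :
  Defs.insert_each (f x) (map (map f) pi) = map (map (map f)) (Defs.insert_each x pi).
Proof.
elim: pi => //= B pi IH; rewrite !List_mapE IH -!map_comp; congr (_ :: _).
Qed.
Lemma setparts_map (f : nat -> nat) l : Defs.setparts (map f l) = map (map (map f)) (Defs.setparts l).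
Proof.
elim: l => //= x l ->; rewrite !flat_mapE map_flatten -!map_comp; congr flatten.
by apply: eq_map => pi /=; rewrite insert_map.
Qed.

Lemma mobius_coefE pi : Defs.mobius_coef pi = mob R (size pi).
Proof.
by rewrite /Defs.mobius_coef /mob RmultE powE INRn factE !lengthE; congr (_ ^+ _ * _`!%:R); lia.
Qed.


Lemma cumul_setparts (F G : FF) l :
  (forall B, G B = F (map (fun s => nth 0%N l s) B)) ->
  Defs.lsum (fun pi => Defs.mobius_coef pi * Defs.lprod G pi) (Defs.setparts (List.seq 0 (List.length l)))
  = cumul F l.
Proof.
move=> hG; rewrite lsumE List_seqE lengthE /cumul /spmom /spsum.
have E : l = map (nth 0%N l) (iota 0 (size l)) by rewrite -/(mkseq _ _) mkseq_nth.
rewrite [in RHS]E setparts_map big_map; apply: eq_bigr => pi _.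
rewrite mobius_coefE size_map lprodE /pprod big_map; congr (_ * _).
by apply: eq_bigr => B _; exact: hG.
Qed.

Lemma maps_cons k m : Defs.maps k.+1 m = flatten [seq map (cons j) (Defs.maps k m) | j <- iota 0 m].
Proof. by rewrite /= flat_mapE List_seqE. Qed.

Lemma box_sumE (w : nat -> nat -> R) K (G : FF) ks (f : seq nat -> R) :
  (forall s, size s = size ks ->
     f (map S s) = (\prod_(j <- iota 0 (size ks)) w (nth 0%N s j) (nth 0%N ks j)) * G s) ->
  Defs.lsum f (Defs.box (size ks) K) = boxsum w K G ks.
Proof.
move=> hf; rewrite lsumE /Defs.box List_mapE big_map.
have sz : forall k s, s \in Defs.maps k K -> size s = k.
  elim=> [|k IH] s; first by rewrite inE => /eqP ->.
  rewrite maps_cons => /flatten_mapP[j _ /mapP[s' hs' ->]] /=; by rewrite (IH _ hs').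
transitivity (\sum_(s <- Defs.maps (size ks) K) (\prod_(j <- iota 0 (size ks)) w (nth 0%N s j) (nth 0%N ks j)) * G s).
  by rewrite !big_seq; apply: eq_bigr => s hs; rewrite -hf ?(sz _ _ hs).
elim: ks G {f hf} => [|k ks IH] G; first by rewrite /= big_seq1 big_nil mul1r.
rewrite [size _]/= maps_cons big_flatten big_map -[K in iota 0 K]subn0 -/(index_iota 0 K) big_mkord /=.
apply: eq_bigr => i _; rewrite -IH big_map mulr_sumr; apply: eq_bigr => s _.
by rewrite big_cons -[1%N]addn0 iotaDl big_map /= mulrA.
Qed.
End SetPartitionBridge.

(** * Derivatives in p, box sums and derivatives in q *)

Section BoxDerivative.
Variables (n : nat) (N : R).
Notation Lam := {mpoly R[n]}.
Hypothesis N_ge0 : 0 <= N.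
Implicit Types (f : Lam).

Definition wbin (i k : nat) : R := 'C(i.+1, k.+1)%:R.
Definition dvs f : FF := fun s => (foldl (fun g i => dv i.+1 g) f s).@[fun=> N].
Definition mpos f := forall m, 0 <= f@_m.

Lemma mpos_dv i f : mpos f -> mpos (dv i f).
Proof.
by move=> h m; rewrite mcoeff_dv; case: pidx => [j|] //; rewrite mulrn_wge0.
Qed.
Lemma mpos_X m : mpos 'X_[m]. Proof. by move=> m'; rewrite mcoeffX ler0n. Qed.
Lemma mpos_meval f : mpos f -> 0 <= f.@[fun=> N].
Proof.
move=> h; rewrite mevalE; apply: sumr_ge0 => m _; apply: mulr_ge0 => //.
by apply: prodr_ge0 => i _; rewrite exprn_ge0.
Qed.

Lemma tau_consE k f ks : tau N f (k :: ks) = \sum_(i < n) wbin i k * tau N (dv i.+1 f) ks.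
Proof.
rewrite -[LHS]/(dF k (tau N f) ks) dF_tau big_ord_recl dv_idx0 tau0 mulr0 add0r.
by apply: eq_bigr.
Qed.

Lemma dv_big i f : (n <= i)%N -> dv i.+1 f = 0.
Proof.
move=> h; apply/mpolyP => m; rewrite mcoeff_dv mcoeff0 pidx_none //; lia.
Qed.

Lemma dvs0 s : dvs 0 s = 0.
Proof.
rewrite /dvs; suff -> : foldl (fun g i => dv i.+1 g) (0 : Lam) s = 0 by rewrite meval0.
by elim: s => //= i s; rewrite dv0.
Qed.

Lemma boxsum_dvs0 K ks : boxsum wbin K (dvs 0) ks = 0.
Proof.
elim: ks => [|k ks IH] /=; first exact: dvs0.
rewrite big1 // => i _; have -> : dF i (dvs 0) = dvs 0.
  by apply/funext => s; rewrite dvs0 -[LHS]/(dvs (dv i.+1 0) s) dv0 dvs0.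
by rewrite IH mulr0.
Qed.

(** Only [p_1, ..., p_n] occur in [f], so its box sums are stationary from [K = n] on. *)
Lemma tau_boxsum K f ks : (n <= K)%N -> tau N f ks = boxsum wbin K (dvs f) ks.
Proof.
move=> hK; elim: ks f => [|k ks IH] f //.
rewrite tau_consE /= -!(big_mkord xpredT (fun i => wbin i k * boxsum wbin K (dF i (dvs f)) ks)).
rewrite (big_cat_nat (n := n)) //= [X in _ = _ + X]big_nat_cond [X in _ = _ + X]big1 ?addr0.
  by rewrite big_mkord; apply: eq_bigr => i _; rewrite IH.
move=> i /andP[/andP[hi _] _]; have -> : dF i (dvs f) = dvs (dv i.+1 f) by [].
by rewrite dv_big // boxsum_dvs0 mulr0.
Qed.

Lemma dvs_ge0 f s : mpos f -> 0 <= dvs f s.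
Proof.
elim: s f => [|i s IH] f h; first exact: mpos_meval.
by apply: (IH (dv i.+1 f)); exact: mpos_dv.
Qed.

Lemma boxsum_ge0 K f ks : mpos f -> 0 <= boxsum wbin K (dvs f) ks.
Proof.
elim: ks f => [|k ks IH] f h /=; first exact: mpos_meval.
by apply: sumr_ge0 => i _; rewrite mulr_ge0 ?ler0n //; apply: (IH (dv i.+1 f)); exact: mpos_dv.
Qed.

Lemma boxsum_le K K' f ks : (K <= K')%N -> mpos f -> boxsum wbin K (dvs f) ks <= boxsum wbin K' (dvs f) ks.
Proof.
move=> hK; elim: ks f => [|k ks IH] f h //=.
rewrite -!(big_mkord xpredT (fun i => wbin i k * boxsum wbin _ (dF i (dvs f)) ks)).
rewrite [leRHS](big_cat_nat (n := K)) //=; apply: ler_wpDr.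
  apply: sumr_ge0 => i _; rewrite mulr_ge0 ?ler0n //; apply: (boxsum_ge0 _ _ (mpos_dv i.+1 h)).
apply: ler_sum => i _; rewrite ler_wpM2l ?ler0n //; exact: (IH _ (mpos_dv i.+1 h)).
Qed.

(** With nonnegative coefficients the box sums increase in [K]; their final value serves as the
    dominating term. *)
Lemma boxsum_le_tau K f ks : mpos f -> boxsum wbin K (dvs f) ks <= tau N f ks.
Proof.
move=> h; rewrite (@tau_boxsum (maxn n K)) ?leq_maxl //; apply: boxsum_le => //; exact: leq_maxr.
Qed.

Lemma dv_X i (m : 'X_{1..n}) : dv i.+1 ('X_[m] : Lam) =
  if pidx n i.+1 is Some j then (m j)%:R *: 'X_[m - U_(j)] else 0.
Proof.
rewrite /dv; case: pidx => [j|] //.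
by rewrite mderivX.
Qed.

Definition mcount (m : 'X_{1..n}) i : nat := if pidx n i.+1 is Some j then m j else 0%N.

Lemma dvs_X (m : 'X_{1..n}) Bd s : all (fun i => i < Bd)%N s ->
  dvs 'X_[m] s = (\prod_(i < Bd) ((mcount m i) ^_ (count_mem (i : nat) s))%:R) * N ^+ (mdeg m - size s).
Proof.
elim: s m => [|i s IH] m hs.
  rewrite /dvs /= mevalX [X in _ = X * _]big1 => [|i _]; last by rewrite ffactn0.
  by rewrite mul1r subn0 mdegE expr_sum.
move: hs => /= /andP[hi hs].
have -> : dvs 'X_[m] (i :: s) = dvs (dv i.+1 'X_[m]) s by [].
rewrite dv_X; case E : (pidx n i.+1) => [j|]; last first.
  rewrite dvs0 (bigD1 (Ordinal hi)) //= eqxx /mcount E add1n ffactE /= mul0n mul0r mul0r //.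
have lin c g : dvs (c *: g) s = c * dvs g s.
  rewrite /dvs; elim: {IH hs} s g => [|b s IHs] g /=; first by rewrite mevalZ.
  by rewrite dvZ IHs.
rewrite lin; case: (posnP (m j)) => [mj0|mj0].
  by rewrite mj0 mul0r (bigD1 (Ordinal hi)) //= eqxx /mcount E mj0 add1n ffactE /= mul0n mul0r mul0r.
rewrite IH // mulrA; congr (_ * _ ^+ _); last first.
  have : (mdeg (m - U_(j)) + 1 = mdeg m)%N.
    by rewrite -(mdeg1 j) -mdegD submK // lep1mP -lt0n.
  by move=> <-; rewrite addn1 subSS.
rewrite (bigD1 (Ordinal hi)) //= [RHS](bigD1 (Ordinal hi)) //= mulrA; congr (_ * _).
  rewrite eqxx add1n /mcount E ffactnS -natrM; congr (_ * _ ^_ _)%:R.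
  by rewrite mnmBE mnm1E eqxx subn1.
apply: eq_bigr => b hb; have hne : (i == b :> nat) = false.
  by apply/negbTE; apply: contraNneq hb => E2; apply/eqP/val_inj.
rewrite hne add0n; congr (_ ^_ _)%:R; rewrite /mcount.
case E3 : (pidx n b.+1) => [l|] //; rewrite mnmBE mnm1E.
have -> : (j == l) = false; last by rewrite subn0.
apply/negbTE/eqP => E4; move/negP: (negbT hne); apply; apply/eqP.
have hh c (x : 'I_n) : pidx n c.+1 = Some x -> c = x.
  case: (pidxP n c.+1) => [[y [Ey] ->] [<-] //|h]; rewrite pidx_none //; exact/pidxP.
by rewrite (hh _ _ E) (hh _ _ E3) E4.
Qed.

End BoxDerivative.

Section EEzProps.
Variables (K : realFieldType) (theta N : K).
Lemma EEz_EEzc k F : EEz theta N k F = EEzc theta N (fun _ _ => 0) k F.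
Proof.
rewrite /EEz /EEzc; congr Symz; elim: k => //= k ->; apply/funext => c; apply/funext => ks.
have E G b : Ez theta N G b ks = Ezc theta N (fun _ _ => 0) G b ks.
  rewrite /Ez /Ezc; congr (_ + _ * _); apply: eq_bigr => i _.
  by rewrite fmul0l addr0.
by rewrite /Dz /Dzc E; case: c => // c; rewrite E.
Qed.
Lemma EEz_lin k a F G ks : EEz theta N k (fun l => a * F l + G l) ks = a * EEz theta N k F ks + EEz theta N k G ks.
Proof. by rewrite !EEz_EEzc EEzc_lin. Qed.
End EEzProps.

Lemma EEz_cont theta N k : fcont (EEz theta N k).
Proof.
move=> F F0 hF ks; rewrite /EEz /Symz.
have H c l : cv (fun n => iter k (Dz theta N) (injz (F n)) c l) (iter k (Dz theta N) (injz F0) c l).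
  elim: k c l => [|k IH] c l; first by case: c => [|c]; [exact: hF | exact: cv_const].
  rewrite iterS.
  have E b : cv (fun n => Ez theta N (iter k (Dz theta N) (injz (F n))) b l) (Ez theta N (iter k (Dz theta N) (injz F0)) b l).
    apply: cvD; first apply: cvD.
    - by apply: cvZ; exact: IH.
    - apply: cvD; first by apply: cvZ; exact: IH.
      by apply: cv_qs => a l'; exact: IH.
    apply: cvZ; apply: cv_sum => i _; apply: cvZ; exact: IH.
  apply: cvB; last by apply: cvZ; exact: IH.
  by apply: cvD; [exact: E | case: c => [|c]; [exact: cv_const | exact: E]].
apply: cvD; first by apply: cvZ; exact: H.
by apply: cv_qs => a l; exact: H.
Qed.

Lemma bin_le_exp m k : ('C(m, k) <= m ^ k)%N.
Proof.
elim: k => [|k IH]; first by rewrite bin0.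
have := mul_bin_left m k; rewrite expnS => h.
apply: (@leq_trans (k.+1 * 'C(m, k.+1))); first by rewrite leq_pmull.
by rewrite h leq_mul // leq_subr.
Qed.

(** A derivative of index [k] costs [k + 1] for its binomial weight, one for the exponent brought
    down, and one for the number of summands. *)
Definition bexp (ks : seq nat) := sumn (map (fun k => k + 3)%N ks).

Lemma tau_X_bound n (N : R) (m : 'X_{1..n}) ks : 1 <= N -> (mdeg m <= n)%N ->
  tau N ('X_[m] : {mpoly R[n]}) ks <= n.+1%:R ^+ bexp ks * N ^+ mdeg m.
Proof.
move=> hN; have N0 : 0 <= N by apply: le_trans hN.
elim: ks m => [|k ks IH] m hm.
  by rewrite /bexp /= mul1r /tau /= mevalX mdegE expr_sum.
rewrite tau_consE.
pose B : R := n.+1%:R ^+ (k + 2) * (n.+1%:R ^+ bexp ks * N ^+ mdeg m).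
have B0 : 0 <= B by rewrite !mulr_ge0 // ?exprn_ge0 ?ler0n.
apply: (@le_trans _ _ (\sum_(i < n) B)).
  apply: ler_sum => i _; rewrite dv_X pidx_ord tauZ.
  have w1 : wbin i k <= n.+1%:R ^+ k.+1.
    rewrite /wbin -natrX ler_nat; apply: leq_trans (bin_le_exp _ _) _.
    by rewrite leq_exp2r // ltnS ltnW.
  have mi : (m i <= mdeg m)%N by rewrite mdegE (bigD1 i) //= leq_addr.
  have t0 : 0 <= tau N ('X_[m - U_(i)] : {mpoly R[n]}) ks.
    by apply: le_trans (boxsum_le_tau N0 0 ks (mpos_X _)); exact: boxsum_ge0 (mpos_X _).
  have md : (mdeg (m - U_(i)) <= mdeg m)%N by exact: mdegB.
  have t1 : tau N ('X_[m - U_(i)] : {mpoly R[n]}) ks <= n.+1%:R ^+ bexp ks * N ^+ mdeg m.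
    apply: le_trans (IH _ (leq_trans md hm)) _; rewrite ler_wpM2l ?exprn_ge0 ?ler0n //.
    exact: ler_weXn2l.
  rewrite /B addn2 exprSr -!mulrA; apply: ler_pM => //; rewrite ?ler0n //.
    by rewrite mulr_ge0 ?ler0n.
  apply: ler_pM => //; rewrite ?ler0n // ler_nat; exact: leq_trans mi (leq_trans hm _).
rewrite sumr_const card_ord -[B *+ n]mulr_natl.
have -> : bexp (k :: ks) = ((k + 2).+1 + bexp ks)%N by rewrite /bexp /=; lia.
rewrite exprD exprS -!mulrA -/B; apply: ler_wpM2r => //.
by rewrite ler_nat.
Qed.

Lemma YsumE N (g : seq nat -> R) n :
  Defs.Ysum N g n = \sum_(la <- parts n | (size la <= N)%N) g la.
Proof.
rewrite /Defs.Ysum lsumE [RHS]big_mkcond; apply: eq_bigr => la _.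
rewrite lengthE; have -> : Nat.leb (size la) N = (size la <= N)%N; last by [].
by apply/idP/idP => [/PeanoNat.Nat.leb_le/ssrnat.leP|/ssrnat.leP/PeanoNat.Nat.leb_le].
Qed.

(** * The generating function and its Taylor coefficients *)

Section GeneratingFunction.
Variables (theta : R) (M : nat -> seq nat -> R) (N : nat).
Hypothesis theta_gt0 : 0 < theta.
Hypothesis N_gt0 : (0 < N)%N.
Hypothesis MN_sum : sums (Defs.Ysum N (M N)) 1.
Let a nu := Defs.acoef theta M N nu.
Variables (x S0 : R).
Hypothesis x_gt1 : 1 < x.
Hypothesis abs_sum : sums (fun n => \sum_(nu <- parts n) `|a nu| * N%:R ^+ size nu * x ^+ n) S0.

Let N1 : 1 <= N%:R :> R. Proof. by rewrite ler1n. Qed.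
Let N0 : 0 <= N%:R :> R. Proof. exact: ler0n. Qed.

Definition ptn n nu : FF := tau N%:R ('X_[mono n nu] : {mpoly R[n]}).
Definition Tterm n : FF := fun ks => \sum_(nu <- parts n) a nu * ptn n nu ks.

(** Within one weight all sums are finite, so power sums can be exchanged for Jack polynomials, on
    which the operators are diagonal. *)
Lemma Tterm_J n ks : Tterm n ks =
  \sum_(la <- parts n | (size la <= N)%N) M N la / Defs.Jack1 theta N la * tauJ theta N la ks.
Proof.
rewrite /Tterm big_seq.
transitivity (\sum_(nu <- parts n | nu \in parts n) \sum_(la <- parts n | (size la <= N)%N)
   (M N la * Defs.Jack theta la nu / Defs.Jack1 theta N la) * ptn n nu ks).
  apply: eq_bigr => nu hnu; rewrite /a /Defs.acoef YsumE psizeE mulr_suml.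
  have -> : sumn nu = n by move: hnu; rewrite mem_partsE => /and3P[_ _ /eqP].
  by apply: eq_bigr => la _; rewrite /Rdiv !RmultE RinvE.
rewrite -big_seq exchange_big /= big_seq_cond [RHS]big_seq_cond; apply: eq_bigr => la /andP[hla _].
have hs : sumn la = n by move: hla; rewrite mem_partsE => /and3P[_ _ /eqP].
rewrite /tauJ hs /Jpol /pol tau_sum mulr_sumr; apply: eq_bigr => nu _.
by rewrite tauZ /ptn; ring.
Qed.

Lemma ptn_ge0 n nu ks : 0 <= ptn n nu ks.
Proof.
by apply: le_trans (boxsum_le_tau N0 0 ks (mpos_X _)); exact: boxsum_ge0 (mpos_X _).
Qed.

Lemma mdeg_mono n nu : nu \in parts n -> mdeg (mono n nu) = size nu.
Proof.
rewrite mem_partsE => hp; rewrite mdegE (size_count (ispart_bound hp)).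
by apply: eq_bigr => i _; rewrite mnmE.
Qed.

Lemma ptn_le n nu ks : nu \in parts n -> ptn n nu ks <= n.+1%:R ^+ bexp ks * N%:R ^+ size nu.
Proof.
move=> hnu; rewrite -(mdeg_mono hnu); apply: tau_X_bound => //.
by rewrite mdeg_mono //; apply: size_ispart; rewrite -mem_partsE.
Qed.

(** The derivatives of [p_nu] in [q] grow polynomially in the weight, and the gap between [1] and
    [x] absorbs this growth: here convergence beyond the unit disc is used. *)
Lemma abs_sums ks : exists S, sums (fun n => \sum_(nu <- parts n) `|a nu| * ptn n nu ks) S.
Proof.
have [C C0 hC] := poly_le_exp (bexp ks) x_gt1.
apply: (@sums_comp _ (fun n => \sum_(i <- [:: C]) i * \sum_(nu <- parts n) `|a nu| * N%:R ^+ size nu * x ^+ n)) => [n|]; last first.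
  exact: (@sums_lin R [:: C] id _ (fun _ => S0) (fun _ => abs_sum)).
rewrite big_seq1 ger0_norm; last by apply: sumr_ge0 => nu _; rewrite mulr_ge0 ?ptn_ge0.
rewrite mulr_sumr !big_seq; apply: ler_sum => nu hnu.
apply: le_trans (ler_wpM2l (normr_ge0 _) (ptn_le ks hnu)) _.
have -> : C * (`|a nu| * N%:R ^+ size nu * x ^+ n) = `|a nu| * N%:R ^+ size nu * (C * x ^+ n) by ring.
rewrite mulrCA mulrC; apply: ler_wpM2l; last exact: hC.
by rewrite mulr_ge0 ?exprn_ge0.
Qed.

Lemma T_exists ks : exists l, sums (fun n => Tterm n ks) l.
Proof.
have [S hS] := abs_sums ks; apply: (sums_comp _ hS) => n.
apply: le_trans (ler_norm_sum _ _ _) _; apply: ler_sum => nu _.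
by rewrite normrM [`|ptn _ _ _|]ger0_norm ?ptn_ge0.
Qed.

Definition Tfun : FF := fun ks => projT1 (cid (T_exists ks)).
Lemma TfunP ks : sums (fun n => Tterm n ks) (Tfun ks).
Proof. exact: projT2 (cid (T_exists ks)). Qed.

(** At [p = 1^N] every normalized Jack polynomial equals one, which leaves the total mass. *)
Lemma Tfun_nil : Tfun [::] = 1.
Proof.
apply: (cv_unique (TfunP [::])); apply: cv_ext MN_sum => K; apply: eq_bigr => n _.
rewrite Tterm_J YsumE big_seq_cond [RHS]big_seq_cond; apply: eq_bigr => la /andP[hla hs].
have hn : sumn la = n by move: hla; rewrite mem_partsE => /and3P[_ _ /eqP].
have J0 := Jack1_gt0 theta_gt0 hla hs.
rewrite /tauJ hn /tau /= -Jack1E // divfK //; exact: lt0r_neq0.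
Qed.

Lemma Tfun_sym : fsym Tfun.
Proof.
move=> p b c l; apply: (cv_unique (TfunP _)); apply: cv_ext (TfunP (p ++ c :: b :: l)) => K.
apply: eq_bigr => n _; apply: eq_bigr => nu _; congr (_ * _); rewrite /ptn.
have dqC f : dq c (dq b f) = dq b (dq c f) :> {mpoly R[n]}.
  rewrite /dq; under eq_bigr => i _ do rewrite dv_sum scaler_sumr.
  under [RHS]eq_bigr => i _ do rewrite dv_sum scaler_sumr.
  rewrite exchange_big /=; apply: eq_bigr => i _; apply: eq_bigr => j _.
  by rewrite !dvZ !scalerA mulrC dv_comm.
have : forall f : {mpoly R[n]}, tau N%:R f (p ++ c :: b :: l) = tau N%:R f (p ++ b :: c :: l).
  by elim: p => [|k p IH] f; [rewrite /tau /= dqC | exact: IH].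
by move=> ->.
Qed.

Definition dFf : FF := fun s => Defs.dF theta M N (map S s).

Lemma dF_term n nu s : nu \in parts n ->
  Defs.lprod (fun j => INR (Defs.ff (Defs.mult nu j) (Defs.mult (map S s) j))) (List.seq 1 (List.list_max (map S s)))
    * INR N ^+ (size nu - size s) = dvs N%:R ('X_[mono n nu] : {mpoly R[n]}) s.
Proof.
move=> hnu; have hp : ispart n nu by rewrite -mem_partsE.
set Bd := List.list_max _.
have hB : all (fun i => i < Bd)%N s.
  rewrite /Bd; elim: (s) => //= i s' IH; apply/andP; split.
    by apply/ssrnat.ltP; exact: (PeanoNat.Nat.le_max_l i.+1 _).
  apply/allP => y hy; have /ssrnat.ltP h := allP IH y hy.
  by apply/ssrnat.ltP; exact: PeanoNat.Nat.lt_le_trans h (PeanoNat.Nat.le_max_r i.+1 _).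
rewrite (dvs_X _ _ hB) mdeg_mono // lprodE List_seqE big_iota1 INRn; congr (_ * _).
apply: eq_bigr => i _; rewrite INRn !multE count_map.
have ffE m c : Defs.ff m c = m ^_ c by elim: c => //= c ->; rewrite ffactnSr mulnC minusE.
rewrite ffE; congr (_ ^_ _)%:R.
rewrite /mcount; case: (pidxP n i.+1) => [[j [Ej] ->]|h]; first by rewrite mnmE Ej.
rewrite pidx_none; last by exact/pidxP.
apply/count_memPn/negP => /(allP (ispart_bound hp)) h2; apply: h.
by case/pidxP: h2 => j -> hj; exists j.
Qed.

(** Dominated by iterated [d/dq_1], in which each derivative in [p] occurs with weight at least
    one. *)
Lemma dFf_sums s : sums (fun n => \sum_(nu <- parts n) a nu * dvs N%:R ('X_[mono n nu] : {mpoly R[n]}) s) (dFf s).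
Proof.
pose K := (foldr maxn 0 s).+1; pose z := nseq (size s) 0%N.
have le1 n (f : {mpoly R[n]}) : mpos f -> dvs N%:R f s <= tau N%:R f z.
  move=> hf; apply: le_trans (boxsum_le_tau N0 K z hf).
  have : all (fun i => i < K)%N s.
    apply/allP => i hi; rewrite /K ltnS; elim: (s) hi => //= b s' IH.
    by rewrite inE leq_max => /orP[/eqP ->|/IH ->]; rewrite ?leqnn ?orbT.
  rewrite /z; move: K => K; elim: (s) f hf => [|i s' IH] f hf //= /andP[hi hs].
  rewrite (bigD1 (Ordinal hi)) //=; apply: ler_wpDr.
    by apply: sumr_ge0 => j _; rewrite mulr_ge0 ?ler0n //; apply: (boxsum_ge0 N0 K _ (mpos_dv j.+1 hf)).
  have h1 := IH _ (mpos_dv i.+1 hf) hs.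
  apply: le_trans (h1) _; rewrite -[leLHS]mul1r; apply: ler_wpM2r.
    exact: (boxsum_ge0 N0 K _ (mpos_dv i.+1 hf)).
  by rewrite /wbin bin1 ler1n.
have [S hS] := abs_sums z.
have [l hl] : exists l, sums (fun n => \sum_(nu <- parts n) a nu * dvs N%:R ('X_[mono n nu] : {mpoly R[n]}) s) l.
  apply: (sums_comp _ hS) => n.
  apply: le_trans (ler_norm_sum _ _ _) _; apply: ler_sum => nu _.
  rewrite normrM ler_wpM2l // ger0_norm ?dvs_ge0 //; last exact: mpos_X.
  exact: le1 (mpos_X _).
suff -> : dFf s = l by [].
apply: series_valE; move: hl; congr sums; apply/funext => n.
rewrite lsumE !big_seq; apply: eq_bigr => nu hnu.
by rewrite -dF_term // RmultE -mulrA; congr (_ * _); rewrite !lengthE size_map powE.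
Qed.

Lemma boxsum_sums w K (u : seq nat -> nat -> R) (F : FF) ks :
  (forall s, sums (u s) (F s)) ->
  sums (fun n => boxsum w K (fun s => u s n) ks) (boxsum w K F ks).
Proof.
elim: ks u F => [|k ks IH] u F h /=; first exact: h.
apply: (sums_lin (index_enum 'I_K)) => i.
by apply: (IH (fun s => u (nat_of_ord i :: s)) (dF i F)) => s; exact: h.
Qed.

Lemma boxsum_lin (I : Type) (r : seq I) w K (c : I -> R) (F : I -> FF) ks :
  boxsum w K (fun s => \sum_(i <- r) c i * F i s) ks = \sum_(i <- r) c i * boxsum w K (F i) ks.
Proof.
elim: ks F => [|k ks IH] F //=.
under [RHS]eq_bigr do rewrite mulr_sumr.
rewrite [RHS]exchange_big /=; apply: eq_bigr => j _.
rewrite (IH (fun i => dF j (F i))) mulr_sumr; apply: eq_bigr => i _; ring.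
Qed.

(** Exchanges the limit over boxes with the sum over weights, by dominated convergence. *)
Lemma boxsum_dFf_cv ks : cv (fun K => boxsum wbin K dFf ks) (Tfun ks).
Proof.
have [S hS] := abs_sums ks.
apply: (cv_sums_dominated (u := fun K n => \sum_(nu <- parts n) a nu *
    boxsum wbin K (dvs N%:R ('X_[mono n nu] : {mpoly R[n]})) ks) _ hS _ _ (TfunP ks)).
- move=> K n; apply: le_trans (ler_norm_sum _ _ _) _; apply: ler_sum => nu _.
  rewrite normrM ler_wpM2l // ger0_norm; last exact: (boxsum_ge0 N0 K _ (mpos_X _)).
  exact: (boxsum_le_tau N0 K _ (mpos_X _)).
- move=> K n hn; apply: eq_bigr => nu _; congr (_ * _).
  by rewrite /ptn; apply: esym; apply: tau_boxsum.
- move=> K.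
  have := boxsum_sums wbin K ks dFf_sums; congr sums; apply/funext => n.
  exact: (boxsum_lin (parts n) wbin K a (fun nu => dvs N%:R ('X_[mono n nu] : {mpoly R[n]}))).
Qed.

Lemma dFf_nil : dFf [::] = 1.
Proof.
rewrite -Tfun_nil; apply: (cv_unique (dFf_sums [::])).
exact: TfunP [::].
Qed.

Lemma dlnF_cumul s : Defs.dlnF theta M N (map S s) = cumul dFf s.
Proof.
have cm (F : FF) (f : nat -> nat) : cumul F (map f s) = cumul (fun l => F (map f l)) s.
  rewrite /cumul /spmom /spsum setparts_map big_map; apply: eq_bigr => p _.
  by rewrite size_map /pprod big_map.
rewrite /Defs.dlnF -[RHS](cm (Defs.dF theta M N)).
apply: cumul_setparts => B; rewrite -/(dFf [::]) dFf_nil /Rdiv RinvE invr1 RmultE mulr1.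
by congr Defs.dF; rewrite List_mapE; apply: eq_map => i; rewrite List_nthE.
Qed.

(** For finite [K] the box sum passes inside the logarithm by [boxsum_spmom]; the limit in [K] is
    then taken on the Taylor coefficients of [F]. The sums of Assumption C thus become derivatives
    of [ln F] in [q]. *)
Lemma multisum_cumul r (C : R) ks (f : seq nat -> R) : size ks = r ->
  (forall s, size s = r -> f (map S s) =
     C * ((\prod_(j <- iota 0 r) wbin (nth 0%N s j) (nth 0%N ks j)) * Defs.dlnF theta M N (map S s))) ->
  Defs.multisum r f = C * cumul Tfun ks.
Proof.
move=> hr hf; apply: lim_valE.
have H : fcv (fun K => boxsum wbin K dFf) Tfun by exact: boxsum_dFf_cv.
apply: cv_ext (cvZ C (cv_spmom (mob R) ks H)) => K.
rewrite -[spmom _ _ _]boxsum_spmom -hr.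
pose G : FF := fun s => C * spmom (mob R) dFf s.
rewrite (@box_sumE wbin K G ks f) => [|s hs]; last first.
  by rewrite hf -?hr // dlnF_cumul /G mulrCA.
have := boxsum_lin [:: C] wbin K id (fun _ => spmom (mob R) dFf) ks.
rewrite big_seq1 => <-; rewrite (_ : (fun s => _) = G) //.
by apply/funext => s; rewrite big_seq1.
Qed.

(** [Z] multiplies each [J_la / J_la(1^N)] by [g la], and that quotient is one at [q = 0];
    continuity on Taylor coefficients lets [Z] act term by term. *)
Lemma sums_eigen (Z : FF -> FF) (g : seq nat -> R) : fflin Z -> fcont Z ->
  (forall la ks, ispart (sumn la) la -> (size la <= N)%N -> Z (tauJ theta N la) ks = g la * tauJ theta N la ks) ->
  sums (Defs.Ysum N (fun la => M N la * g la)) (Z Tfun [::]).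
Proof.
move=> lZ cZ hZ.
have H : fcv (fun K ks => \sum_(i < K.+1) Tterm i ks) Tfun by exact: TfunP.
apply: cv_ext (cZ _ _ H [::]) => K.
rewrite (_ : (fun ks => _) = fun ks => \sum_(i <- index_enum 'I_K.+1) 1 * Tterm i ks); last first.
  by apply/funext => ks; apply: eq_bigr => i _; rewrite mul1r.
rewrite fflin_sum //; apply: eq_bigr => n _; rewrite mul1r YsumE.
rewrite (_ : Tterm n = fun ks => \sum_(la <- [seq la <- parts n | (size la <= N)%N])
   M N la / Defs.Jack1 theta N la * tauJ theta N la ks); last first.
  by apply/funext => ks; rewrite Tterm_J big_filter.
rewrite fflin_sum // big_filter big_seq_cond [RHS]big_seq_cond; apply: eq_bigr => la /andP[hla hs].
have hn : sumn la = n by move: hla; rewrite mem_partsE => /and3P[_ _ /eqP].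
have J0 := Jack1_gt0 theta_gt0 hla hs.
rewrite hZ // ?hn -?mem_partsE //.
have -> : tauJ theta N la [::] = Defs.Jack1 theta N la by rewrite /tauJ hn /tau /= -Jack1E.
by rewrite mulrCA divfK ?lt0r_neq0 // mulrC.
Qed.

End GeneratingFunction.

(** * Assembling the limit *)

Section PowerSumEigenvalues.
Variables (theta : R) (N : nat).
Hypothesis theta_gt0 : 0 < theta.
Hypothesis N_gt0 : (0 < N)%N.
Definition Xop k (F : FF) : FF := fun ks => N%:R^-1 ^+ k * EEz theta N%:R k F ks.
Definition ypow k la : R := \sum_(i < N) Defs.ycoord theta N la i ^+ k.

Let N0 : N%:R != 0 :> R. Proof. by rewrite pnatr_eq0 -lt0n. Qed.

Lemma Xop_lin k a F G ks : Xop k (fun l => a * F l + G l) ks = a * Xop k F ks + Xop k G ks.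
Proof. rewrite /Xop EEz_lin; ring. Qed.
Lemma Xop_cont k : fcont (Xop k).
Proof. by move=> F F0 hF ks; apply: cvZ; exact: EEz_cont. Qed.

Lemma ycoordE la i : Defs.ycoord theta N la i = N%:R^-1 * srow theta (nth 0%N la) i.
Proof.
rewrite /Defs.ycoord /srow List_nthE /Rdiv !RinvE !RmultE !INRn RminusE.
have th0 := lt0r_neq0 theta_gt0; field; by rewrite N0 th0.
Qed.

Lemma Yop_tauJ la k ks : ispart (sumn la) la -> (size la <= N)%N ->
  Yop N%:R Xop k (tauJ theta N la) ks = ypow k la * tauJ theta N la ks.
Proof.
move=> hp hN; set s := srow theta (nth 0%N la).
pose W m : R := \sum_(0 <= i < N) (s i ^+ m - (s i - 1) ^+ m).
(* This scaling is forced by the factor [N^-1 ^+ k] in [Xop] and the [N^-1] in the recursion of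
   [Vop]; it also makes the power sums come out in [y_i = s_i / N]. *)
pose w m := N%:R * N%:R^-1 ^+ m * W m.
have eX j l : Xop j (tauJ theta N la) l = (N%:R^-1 ^+ j * rowE N s j) * tauJ theta N la l.
  by rewrite /Xop tauJ_eigen // mulrA.
have [W0 WS] := rowE_logder N s.
have e1 j : N%:R * N%:R^-1 ^+ j.+1 = N%:R^-1 ^+ j :> R by rewrite exprS mulrA divff ?N0 // mul1r.
have hw := Vop_eigen Xop_lin eX (w := w).
apply: (@Yop_eigen _ _ Xop (tauJ theta N la) w (fun j => ypow j la)) => [|j].
  apply: hw => [|j]; first by rewrite /w /W W0 mulr0.
  rewrite /w e1 /W WS -mulr_natl mulrDr mulr_sumr; congr (_ + _); first by ring.
  apply: eq_bigr => i _; have hi : (i <= j)%N by rewrite -ltnS.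
  rewrite -{1}(subnKC hi) exprD; field; exact: N0.
have yE m : ypow m la = N%:R^-1 ^+ m * psum N s m.
  rewrite /ypow /psum big_mkord mulr_sumr; apply: eq_bigr => i _.
  by rewrite ycoordE exprMn.
have j0 : j.+1%:R != 0 :> R by rewrite pnatr_eq0.
rewrite yE; apply: (mulfI j0); rewrite mulrCA [j.+1%:R * psum _ _ _]mulr_natl psum_rec mulrDr.
rewrite mulrDr mulVKf //; congr (_ + _).
  by rewrite /w e1.
rewrite !mulr_sumr.
apply: eq_bigr => i _; have hi := ltn_ord i.
rewrite yE -mulr_natr !mulrA divff // mul1r.
have -> : N%:R^-1 ^+ j = N%:R^-1 ^+ i * N%:R^-1 * N%:R^-1 ^+ (j.-1 - i) :> R.
  by rewrite -exprSr -exprD; congr (_ ^+ _); lia.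
ring.
Qed.
End PowerSumEigenvalues.

(** Hides the convergence data, which depend on [N], so that one sequence of series can be chosen
    for all [N]. *)
Lemma T_package (theta : R) M N : 0 < theta -> (0 < N)%N ->
  sums (Defs.Ysum N (M N)) 1 ->
  (exists x S, 1 < x /\ sums (fun n => \sum_(nu <- parts n) `|Defs.acoef theta M N nu| * N%:R ^+ size nu * x ^+ n) S) ->
  exists T : FF, [/\ T [::] = 1, fsym T,
   (forall r (C : R) ks (f : seq nat -> R), size ks = r ->
     (forall s, size s = r -> f (map S s) =
       C * ((\prod_(j <- iota 0 r) wbin (nth 0%N s j) (nth 0%N ks j)) * Defs.dlnF theta M N (map S s))) ->
     Defs.multisum r f = C * cumul T ks) &
   (forall (Z : FF -> FF) (g : seq nat -> R), fflin Z -> fcont Z ->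
     (forall la ks, ispart (sumn la) la -> (size la <= N)%N -> Z (tauJ theta N la) ks = g la * tauJ theta N la ks) ->
     sums (Defs.Ysum N (fun la => M N la * g la)) (Z T [::]))].
Proof.
move=> th0 hN hM [x [S [hx hS]]].
exists (Tfun hN hx hS); split.
- exact: Tfun_nil.
- exact: Tfun_sym.
- exact: multisum_cumul.
- exact: sums_eigen.
Qed.

Lemma cvS (f : nat -> R) l : Un_cv f l -> cv (fun n => f n.+1) l.
Proof. by move/(CV_shift' _ 1); apply: cv_ext => n; rewrite plusE addn1. Qed.
Lemma cvS_inv (f : nat -> R) l : cv (fun n => f n.+1) l -> Un_cv f l.
Proof. by move=> h; apply: (CV_shift _ 1); apply: cv_ext h => n; rewrite plusE addn1. Qed.

Lemma binomRE i k : Defs.binomR i.+1 k.+1 = wbin i k.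
Proof.
have ffE m b : Defs.ff m b = m ^_ b by elim: b => //= b ->; rewrite ffactnSr mulnC minusE.
rewrite /Defs.binomR /Rdiv RinvE !INRn ffE factE RmultE -bin_ffact natrM mulfK //.
by rewrite pnatr_eq0 -lt0n fact_gt0.
Qed.

Section LimitCovariance.
Variables (theta : R) (c : nat -> R) (d : nat -> nat -> R).
Hypothesis theta_gt0 : 0 < theta.
(** Coefficients of [U(1 + z) / theta]: the factor [i.+1] of the symbol turns the [(i+1)!] of
    Assumption C into [i!]. *)
Definition vlim : fps R := fun i => theta^-1 * (c i.+1 / (i`!)%:R).
Definition dhlim j b : R := d j.+1 b.+1 / ((j.+1)`!%:R * (b.+1)`!%:R).

Lemma ps_powE k n : Defs.ps_pow (Defs.Bser theta c) k n = (symbA vlim ^+ k) n.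
Proof.
have mE f g m : Defs.ps_mul f g m = ((f : fps R) * g) m.
  by rewrite /Defs.ps_mul sum_f_R0E fpsM; apply: eq_bigr.
have BE : Defs.Bser theta c = symbA vlim.
  apply/funext => m; rewrite /Defs.Bser RplusE RmultE RinvE mE eqbE /symbA.
  rewrite fpsD fps1; congr (_ + _); first by case: eqP.
  rewrite -fpsCM.
  have -> : (Defs.zz1 : fps R) = fpsX R * (1 + fpsX R).
    apply: fpsP => b; rewrite fpsXM /Defs.zz1 !eqbE.
    by case: b => [|[|[|b]]] //; rewrite fpsD fps1 /fpsX /= ?addr0 ?add0r.
  have -> : vlim = fpsC theta^-1 * (Defs.U1 c : fps R).
    apply: fpsP => b; rewrite fpsCM /vlim /Defs.U1 /Rdiv RinvE RmultE INRn factE //.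
  have E (p q r : fps R) : p * (q * r) = q * (p * r) by ring.
  by rewrite E.
elim: k n => [|k IH] n; first by rewrite /= eqbE expr0 fps1; case: eqP.
have E : Defs.ps_pow (Defs.Bser theta c) k = symbA vlim ^+ k by apply/funext.
by rewrite exprS /= mE E BE.
Qed.

Lemma coefAE k (j : Z) e : Z.add j (Z.of_nat k) = Z.of_nat e ->
  Defs.coefA theta c k j = (symbA vlim ^+ k) e.
Proof.
move=> h; rewrite /Defs.coefA h; case: Z.ltb_spec => h'; first by exfalso; lia.
by rewrite Nat2Z.id ps_powE.
Qed.

(** [psid a k] is [theta^-1 (a+1)] times the coefficient of [z^-(a+1)] in the [k]-th power of the
    symbol, and the two terms of [psiq] give the two terms of the formula. In the second the indices
    of [d] appear exchanged, whence the symmetry. *)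
Lemma limit_covE k l B : (k <= B)%N -> (forall i j, (0 < i)%N -> (0 < j)%N -> d i j = d j i) ->
  \sum_(a < B) psid theta vlim a k * psiq theta vlim dhlim a l = Defs.limit_cov theta c d k l.
Proof.
move=> hB dsym.
have th0 := lt0r_neq0 theta_gt0.
transitivity (\sum_(a < k) psid theta vlim a k * psiq theta vlim dhlim a l).
  rewrite [RHS](big_ord_widen_cond B (fun=> true) (fun a => psid theta vlim a k * psiq theta vlim dhlim a l)) //.
  rewrite [RHS]big_mkcond; apply: eq_bigr => a _ /=; case: ifP => // h.
  by rewrite /psid h mulr0 mul0r.
rewrite /Defs.limit_cov !lsumE !List_seqE RplusE.
have -> : \sum_(a < k) psid theta vlim a k * psiq theta vlim dhlim a l =
   \sum_(a < k) psid theta vlim a k * (symbA vlim ^+ l) (a.+1 + l)%N +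
   \sum_(a < k) psid theta vlim a k * \sum_(j < l) (theta^-1 * j.+1%:R * dhlim j a) * (symbA vlim ^+ l) (l - j.+1)%N.
  by rewrite -big_split; apply: eq_bigr => a _; rewrite /psiq mulrDr.
congr (_ + _).
  rewrite big_iota1; apply: eq_bigr => a _; rewrite !RmultE /Rdiv RinvE INRn RmultE.
  rewrite (@coefAE k _ (k - a.+1)); last by have := ltn_ord a; lia.
  rewrite (@coefAE l _ (a.+1 + l)); last by lia.
  by rewrite /psid ltn_ord; ring.
have io (m : nat) (F : nat -> R) : \sum_(j <- iota 0 m) F j = \sum_(j < m) F j.
  by rewrite -{1}[m]subn0 -/(index_iota 0 m) big_mkord.
rewrite RmultE RinvE powE io mulr_sumr.
apply: eq_bigr => a _; rewrite lsumE io !mulr_sumr.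
apply: eq_bigr => j _; rewrite !RmultE.
rewrite (@coefAE k _ (k - a.+1)); last by have := ltn_ord a; lia.
rewrite (@coefAE l _ (l - j.+1)); last by have := ltn_ord j; lia.
rewrite /psid ltn_ord /Defs.V1 /dhlim /Rdiv RinvE !RmultE !INRn !factE (dsym a.+1 j.+1) // !factS !natrM.
have f0 m : m`!%:R != 0 :> R by rewrite pnatr_eq0 -lt0n fact_gt0.
have fa := f0 a; have fj := f0 j.
have a0 : a.+1%:R != 0 :> R by rewrite pnatr_eq0.
have j0 : j.+1%:R != 0 :> R by rewrite pnatr_eq0.
move: (a.+1%:R : R) (j.+1%:R : R) a0 j0 (a`!%:R : R) (j`!%:R : R) fa fj => x y x0 y0 p q p0 q0.
by field; rewrite ?th0 ?x0 ?y0 ?p0 ?q0.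
Qed.
End LimitCovariance.

Section MainTheorem.
Variables (theta : R) (M : nat -> seq nat -> R) (c : nat -> R) (d : nat -> nat -> R).
Hypothesis theta_gt0 : 0 < theta.
Variable T : nat -> FF.
Hypothesis T1 : forall n, T n [::] = 1.
Hypothesis Tsym : forall n, fsym (T n).
Hypothesis Tcum : forall n r (C : R) ks (f : seq nat -> R), size ks = r ->
  (forall s, size s = r -> f (map S s) =
     C * ((\prod_(j <- iota 0 r) wbin (nth 0%N s j) (nth 0%N ks j)) * Defs.dlnF theta M n.+1 (map S s))) ->
  Defs.multisum r f = C * cumul (T n) ks.
Hypothesis Teig : forall n (Z : FF -> FF) (g : seq nat -> R), fflin Z -> fcont Z ->
  (forall la ks, ispart (sumn la) la -> (size la <= n.+1)%N ->
     Z (tauJ theta n.+1 la) ks = g la * tauJ theta n.+1 la ks) ->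
  sums (Defs.Ysum n.+1 (fun la => M n.+1 la * g la)) (Z (T n) [::]).
Hypothesis HC : Defs.AssumptionC theta M c d.

Let ell n k : FF := dF k (cumul (T n)).
Let v : fps R := vlim theta c.
Let dh := dhlim d.

Let f0 m : m`!%:R != 0 :> R. Proof. by rewrite pnatr_eq0 -lt0n fact_gt0. Qed.

Lemma cv_cumul1 i : cv (fun n => n.+1%:R^-1 * ((i.+1)`!%:R * cumul (T n) [:: i])) (c i.+1).
Proof.
have [h _] := HC; have := cvS (h i.+1 ltac:(lia)).
apply: cv_ext => n; rewrite RinvE RmultE INRn; congr (_ * _).
apply: Tcum => // -[|j [|]] // _; rewrite big_seq1.
by rewrite (_ : List.nth 0%N (map S [:: j]) 0%N = j.+1) // binomRE !RmultE factE INRn mulrA.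
Qed.

Lemma cv_cumul2 i b : cv (fun n => ((i.+1)`!%:R * (b.+1)`!%:R) * cumul (T n) [:: i; b]) (d i.+1 b.+1).
Proof.
have [_ [h _]] := HC; have := cvS (h i.+1 b.+1 ltac:(lia) ltac:(lia)).
apply: cv_ext => n; apply: Tcum => // -[|j [|l [|]]] // _.
rewrite /iota big_cons big_seq1.
rewrite (_ : List.nth 0%N (map S [:: j; l]) 0%N = j.+1) // (_ : List.nth 1%N (map S [:: j; l]) 0%N = l.+1) //.
by rewrite !binomRE !RmultE !factE !INRn; ring.
Qed.

Lemma cv_cumul3 ks : (3 <= size ks)%N -> cv (fun n => cumul (T n) ks) 0.
Proof.
move=> hk; have [_ [_ h]] := HC.
have h1 : (3 <= List.length (map S ks))%coq_nat by rewrite lengthE size_map; apply/ssrnat.leP.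
have h2 : List.Forall (fun k => (1 <= k)%coq_nat) (map S ks).
  by apply/List.Forall_forall => x /InP /mapP[y _ ->]; lia.
have := cvS (h (map S ks) h1 h2); apply: cv_ext => n; rewrite lengthE size_map -[RHS]mul1r.
apply: Tcum => // s hs; rewrite mul1r RmultE lprodE List_seqE; congr (_ * _).
rewrite !big_seq; apply: eq_bigr => j; rewrite mem_iota add0n => /andP[_ hj].
by rewrite !List_nthE !(nth_map 0%N) ?hs // binomRE.
Qed.

Let cv_u i : cv (fun n => theta^-1 * i.+1%:R * ell n i [::] / n.+1%:R) (v i).
Proof.
have -> : v i = (theta^-1 / i`!%:R) * c i.+1 by rewrite /v /vlim; ring.
apply: cv_ext (cvZ (theta^-1 / i`!%:R) (cv_cumul1 i)) => n.
rewrite /ell /dF factS natrM; move: (f0 i) => h0.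
by field; rewrite ?nat1r ?natr1 pnatr_eq0 h0 lt0r_neq0.
Qed.

Let cv_ell1 i b : cv (fun n => ell n i [:: b]) (dh i b).
Proof.
have -> : dh i b = ((i.+1)`!%:R * (b.+1)`!%:R)^-1 * d i.+1 b.+1 by rewrite /dh /dhlim mulrC.
apply: cv_ext (cvZ ((i.+1)`!%:R * (b.+1)`!%:R)^-1 (cv_cumul2 i b)) => n.
by rewrite mulKf // mulf_neq0.
Qed.

Let cv_ell2 i a b ks : cv (fun n => ell n i [:: a, b & ks]) 0.
Proof. exact: cv_cumul3. Qed.

(** Symmetry of mixed second derivatives, inherited by the limits. *)
Lemma d_sym i j : (0 < i)%N -> (0 < j)%N -> d i j = d j i.
Proof.
case: i j => // i [|j] // _ _; apply: (cv_unique (cv_cumul2 i j)).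
apply: cv_ext (cv_cumul2 j i) => n; rewrite !cumul2 // [(j.+1)`!%:R * _]mulrC [T n [:: j] * _]mulrC.
by rewrite (Tsym n [::] j i [::]).
Qed.

Let X n := Xop theta n.+1.
Let Y n k := Yop n.+1%:R (X n) k.
Let Yc n k := Yop n.+1%:R (Xc theta ell n) k.

Let T_ell n k : dF k (T n) = fmul (ell n k) (T n).
Proof. by rewrite /ell cumul_dF. Qed.

Lemma Y_conj n k F : Y n k (fmul F (T n)) = fmul (Yc n k F) (T n).
Proof.
apply: Yop_conj => {}k {}F; rewrite /X /Xop /Xc (EEzc_conj theta n.+1%:R (T_ell n)).
by apply/funext => ks; rewrite (fmulZl _ (EEzc _ _ _ _ _)).
Qed.

Section Expectation.
Variables (n : nat) (al be : nat -> R).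
Let W k (F : FF) : FF := fun l => al k * Y n k F l + be k * F l.
Let W' k (F : FF) : FF := fun l => al k * Yc n k F l + be k * F l.
Let g k la := al k * ypow theta n.+1 k la + be k.

(** Affine factors cover raw moments and centred fluctuations at once. Conjugation moves [T n] to
    the outside, and its value at [q = 0] is one. *)
Lemma Ex_foldr (ks : seq nat) :
  Defs.Ex M n.+1 (fun la => \prod_(k <- ks) g k la) = foldr W' (funit R) ks [::].
Proof.
have WT F k : W k (fmul F (T n)) = fmul (W' k F) (T n).
  rewrite /W Y_conj; apply/funext => l.
  by rewrite (fmulDl (fscale _ _) (fscale _ _)) (fmulZl _ (Yc n k F)) (fmulZl _ F).
have E : foldr W (T n) ks = fmul (foldr W' (funit R) ks) (T n).
  by elim: ks => [|k ks IH] /=; [rewrite fmul1l | rewrite IH WT].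
apply: series_valE.
have -> : foldr W' (funit R) ks [::] = foldr W (T n) ks [::] by rewrite E fmul_nil T1 mulr1.
have Wl k : fflin (W k).
  by move=> b F G l; rewrite /W /Y /X (Yop_lin n.+1%:R (@Xop_lin theta n.+1)); ring.
have Wc k : fcont (W k).
  move=> F F0 hF l; apply: cvD; apply: cvZ => //.
  exact: (Yop_cont n.+1%:R (@Xop_cont theta n.+1)).
apply: (Teig (Z := fun F => foldr W F ks)).
- elim: ks {E} => [|k ks IH] b F G l //=.
  rewrite -Wl; congr W; apply/funext => l'; exact: IH.
- by elim: ks {E} => [|k ks IH] F F0 hF //=; apply: Wc; exact: IH.
- move=> la l hp hs; elim: ks l {E} => [|k ks IH] l /=; first by rewrite big_nil mul1r.
  rewrite (_ : foldr W _ ks = fun l => (\prod_(j <- ks) g j la) * tauJ theta n.+1 la l); last exact/funext.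
  by rewrite fflinZ // /W /Y /X Yop_tauJ // big_cons /g; ring.
Qed.
End Expectation.

Lemma momentE n k la : Defs.moment theta n.+1 k la = n.+1%:R^-1 * ypow theta n.+1 k la.
Proof.
rewrite /Defs.moment RinvE RmultE lsumE List_seqE INRn; congr (_ * _).
rewrite /ypow -{1}[n.+1]subn0 -/(index_iota 0 n.+1) big_mkord; apply: eq_bigr => i _; exact: powE.
Qed.

Lemma Ex_moments n ks : Defs.Ex M n.+1 (fun la => Defs.lprod (fun k => Defs.moment theta n.+1 k la) ks) =
  foldr (fun k H l => n.+1%:R^-1 * Yc n k H l) (funit R) ks [::].
Proof.
have := Ex_foldr n (fun=> n.+1%:R^-1) (fun=> 0) ks.
have -> : (fun la => \prod_(k <- ks) (n.+1%:R^-1 * ypow theta n.+1 k la + 0)) =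
   (fun la => Defs.lprod (fun k => Defs.moment theta n.+1 k la) ks).
  by apply/funext => la; rewrite lprodE; apply: eq_bigr => k _; rewrite momentE addr0.
move=> ->; congr (foldr _ _ _ _); apply/funext => k; apply/funext => F; apply/funext => l.
by rewrite mul0r addr0.
Qed.

Lemma xiE n k la : Defs.xi theta M n.+1 k la = 1 * ypow theta n.+1 k la + - ymean theta ell n k.
Proof.
rewrite /Defs.xi RmultE RminusE INRn.
have -> : Defs.Ex M n.+1 (Defs.moment theta n.+1 k) = n.+1%:R^-1 * ymean theta ell n k.
  have := Ex_moments n [:: k]; rewrite /= => <-; congr Defs.Ex.
  by apply/funext => la'; rewrite /= Rmult_1_r.
have n0 : n.+1%:R != 0 :> R by rewrite pnatr_eq0.
by rewrite momentE mul1r mulrBr !mulVKf.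
Qed.

Lemma Ex_xi n (kap : nat -> nat) B :
  Defs.Ex M n.+1 (fun la => Defs.lprod (fun s => Defs.xi theta M n.+1 (kap s) la) B) =
  ximom theta ell kap n B.
Proof.
have := Ex_foldr n (fun=> 1) (fun k => - ymean theta ell n k) (map kap B).
have -> : (fun la => \prod_(k <- map kap B) (1 * ypow theta n.+1 k la + - ymean theta ell n k)) =
   (fun la => Defs.lprod (fun s => Defs.xi theta M n.+1 (kap s) la) B).
  by apply/funext => la; rewrite lprodE big_map; apply: eq_bigr => s _; rewrite xiE.
move=> ->; rewrite /ximom foldr_map; congr (foldr _ _ _ _).
apply/funext => s; apply/funext => F; apply/funext => l.
by rewrite /Xiop mul1r mulNr.
Qed.

Lemma lln ks : cv (fun n => Defs.Ex M n.+1 (fun la => Defs.lprod (fun k => Defs.moment theta n.+1 k la) ks))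
  (Defs.lprod (fun k => tY (toept v) k) ks).
Proof.
rewrite lprodE; apply: cv_ext (ymom_cv cv_u cv_ell1 cv_ell2 ks) => n.
by rewrite Ex_moments.
Qed.

Lemma joint_cum_cv ks : (3 <= size ks)%N -> cv (fun n => Defs.joint_cum theta M n.+1 ks) 0.
Proof.
move=> hk; pose kap := nth 0%N ks.
have kapB s : (kap s <= foldr maxn 0 ks)%N.
  rewrite /kap; elim: (ks) s => [|k ks' IH] [|s] //=; first exact: leq_maxl.
  by apply: leq_trans (IH s) _; exact: leq_maxr.
have [s1 [s2 [s3 [ss E]]]] : exists a b c' l, iota 0 (size ks) = [:: a, b, c' & l] :> seq nat.
  by case: (size ks) hk => [|[|[|m]]] // _; exists 0%N, 1%N, 2%N, (iota 3 m).
have := ximom_cumul cv_u cv_ell1 cv_ell2 kapB s1 s2 s3 ss; apply: cv_ext => n.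
rewrite -E /Defs.joint_cum lsumE List_seqE lengthE /cumul /spmom /spsum.
apply: eq_bigr => pi _; rewrite RmultE mobius_coefE lprodE; congr (_ * _).
apply: eq_bigr => B _; rewrite -(Ex_xi n kap B); congr Defs.Ex.
apply/funext => la; rewrite !lprodE; apply: eq_bigr => s _; by rewrite List_nthE.
Qed.

Lemma covar_cv k l : cv (fun n => Defs.covar theta M n.+1 k l) (Defs.limit_cov theta c d k l).
Proof.
pose kap s := if s is 0%N then k else l.
have kapB s : (kap s <= maxn k l)%N by case: s => [|s] /=; [exact: leq_maxl | exact: leq_maxr].
rewrite -(limit_covE c theta_gt0 l (leq_maxl k l) d_sym).
have h2 := ximom_cov cv_u cv_ell1 cv_ell2 kapB 0 1.
(* The mean fluctuations tend to the first Wick moment, which is zero, so the product of means drops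
   out of the covariance. *)
have h1 s : cv (fun n => ximom theta ell kap n [:: s]) 0.
  have := ximom_cv cv_u cv_ell1 cv_ell2 kapB [:: s].
  by rewrite /xilim wick1.
have := cvB h2 (cvM (h1 0%N) (h1 1%N)); rewrite mul0r subr0; apply: cv_ext => n.
rewrite /Defs.covar RminusE RmultE -!Ex_xi; congr (_ - _ * _); congr Defs.Ex; apply/funext => la.
- by rewrite lprodE !big_cons big_nil mulr1.
- by rewrite lprodE big_seq1.
- by rewrite lprodE big_seq1.
Qed.

End MainTheorem.

Lemma clt_main (theta : R) (M : nat -> seq nat -> R) (c : nat -> R) (d : nat -> nat -> R) :
  Rlt (IZR Z0) theta ->
  (forall N, (1 <= N)%coq_nat -> Defs.is_prob_YN N (M N)) ->
  Defs.AssumptionA theta M ->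
  Defs.AssumptionC theta M c d ->
  Defs.CLT theta M /\
  (forall k l, (1 <= k)%coq_nat -> (1 <= l)%coq_nat ->
     Un_cv (fun N => Defs.covar theta M N k l) (Defs.limit_cov theta c d k l)).
Proof.
move=> /RltP th0' hM [eps [/RltP heps' hA]] hC.
have th0 : 0 < theta := th0'; have heps : 0 < eps := heps'.
have H n : exists T : FF, [/\ T [::] = 1, fsym T,
   (forall r (C : R) ks (f : seq nat -> R), size ks = r ->
     (forall s, size s = r -> f (map S s) =
       C * ((\prod_(j <- iota 0 r) wbin (nth 0%N s j) (nth 0%N ks j)) * Defs.dlnF theta M n.+1 (map S s))) ->
     Defs.multisum r f = C * cumul T ks) &
   (forall (Z : FF -> FF) (g : seq nat -> R), fflin Z -> fcont Z ->
     (forall la ks, ispart (sumn la) la -> (size la <= n.+1)%N ->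
        Z (tauJ theta n.+1 la) ks = g la * tauJ theta n.+1 la ks) ->
     sums (Defs.Ysum n.+1 (fun la => M n.+1 la * g la)) (Z T [::]))].
  apply: T_package => //; first by apply/sumsP; have [] := hM n.+1 ltac:(lia).
  (* The radius [1 + eps / 2] lies inside the disc of convergence and still exceeds one. *)
  have hx : Rle (IZR Z0) (1 + eps / 2) /\ Rlt (1 + eps / 2) (Rplus (IZR (Zpos xH)) eps).
    have h2 : 0 <= 1 + eps / 2 by clear -heps; lra.
    have h3 : 1 + eps / 2 < 1 + eps by clear -heps; lra.
    by split; [apply/RleP; exact: h2 | apply/RltP; exact: h3].
  have [S hS] := hA n.+1 ltac:(lia) _ hx.
  exists (1 + eps / 2), S; split; first by lra.
  move/sumsP: hS; apply: cv_ext => K; apply: eq_bigr => i _; rewrite lsumE; apply: eq_bigr => nu _.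
  by rewrite !RmultE RabsE !powE INRn lengthE.
have [T hT] := choice H.
have T1 n : T n [::] = 1 by case: (hT n).
have Tsym n : fsym (T n) by case: (hT n).
have Tcum n := let: And4 _ _ h _ := hT n in h.
have Teig n := let: And4 _ _ _ h := hT n in h.
have hcov k l : Un_cv (fun N => Defs.covar theta M N k l) (Defs.limit_cov theta c d k l).
  apply: cvS_inv; exact: (covar_cv th0 T1 Tsym Tcum Teig hC k l).
split; last by move=> k l _ _.
split; last split.
- by exists (tY (toept (vlim theta c))) => ks _; apply: cvS_inv; exact: (lln th0 T1 Tcum Teig hC ks).
- by move=> k l _ _; exists (Defs.limit_cov theta c d k l).
- move=> ks /ssrnat.leP hk _; apply: cvS_inv.
  by apply: (joint_cum_cv th0 T1 Tcum Teig hC); rewrite -lengthE.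
Qed.

End JackCLT.

Require Import Defs.
From Stdlib Require Import Reals List.
Open Scope R_scope.

Theorem theorem2p3 (theta : R) (M : nat -> list nat -> R)
    (c : nat -> R) (d : nat -> nat -> R) :
  0 < theta ->
  (forall N, (1 <= N)%nat -> is_prob_YN N (M N)) ->
  AssumptionA theta M ->
  AssumptionC theta M c d ->
  CLT theta M /\
  (forall k l, (1 <= k)%nat -> (1 <= l)%nat ->
     Un_cv (fun N => covar theta M N k l) (limit_cov theta c d k l)).
Proof.
exact (@JackCLT.clt_main theta M c d).
Qed.
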